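(* Let $S\subset\mathbb{C}^n$ be a pseudoconvex smooth real hypersurface with a complex contact form $\theta$. Then any special subbundle $E\subset H^{10}S$ of infinite Levi type at $p\in S$ satisfies the formal Huang–Yin condition at $p$, i.e. the real formal orbit $\mathcal{O}^{\mathbb{R}}_E(p)$ is CR.
   Context: $HS$ is the complex tangent bundle of $S$, $\mathbb{C}HS=H^{10}S\oplus\overline{H^{10}S}$, $H^{10}S$ the bundle of $(1,0)$ tangent vectors; a complex contact form $\theta$ is a nowhere zero $\mathbb{C}$-valued $1$-form on $S$ vanishing on $\mathbb{C}HS$. $S$ is pseudoconvex if near every point a purely imaginary contact form $\theta$ can be chosen with $\theta([L,\overline{L}])\ge0$ for all local sections $L$ of $H^{10}S$. Special subbundles. For a list $L^t,\ldots,L^1\in\Gamma(H^{10}S)\cup\Gamma(\overline{H^{10}S})$, $t\ge1$, the $\theta$-dual form is the complex $1$-form on $H^{10}S$ defined, for $L\in\Gamma(H^{10}S)$ and $x\in S$, by $\omega_{L^1;\theta}(L_x)=\theta([L,L^1])(x)$ if $t=1$, and $\omega_{L^t,\ldots,L^1;\theta}(L_x)=(Lf)(x)$ with $f=\mathrm{Re}\,(L^t\cdots L^3\,\theta([L^2,L^1]))$ if $t\ge2$. A complex subbundle $E\subset H^{10}S$ is special if $E=\{\xi\in H^{10}S:\omega_1(\xi)=\cdots=\omega_l(\xi)=0\}$ for some $\theta$-dual forms $\omega_1,\ldots,\omega_l$ with $\omega_1\wedge\cdots\wedge\omega_l\neq0$ at every point (on $H^{10}S$). Infinite Levi type. $E$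 is of infinite Levi type at $p$ if $L^t\cdots L^3\,\theta([L^2,L^1])(p)=0$ for all $t\ge2$ and all smooth local sections $L^t,\ldots,L^1$, each of $E$ or of $\overline{E}$. Formal submanifolds. A real formal submanifold $O$ of $\mathbb{C}^n\cong\mathbb{R}^{2n}$ at $p$ is identified with an ideal $I(O)\subset\mathbb{R}[[x-p]]$ generated by $k$ elements vanishing at $p$ with linearly independent differentials at $p$; $\dim O=2n-k$. Put $\mathbb{C}I(O)=I(O)+iI(O)\subset\mathbb{C}[[z-p,\bar z-\bar p]]$. A formal vector field $L$ is tangent to $O$ if $L(I(O))\subset I(O)$. $D^{10}_O$ is the space of formal vector fields $\sum_ja_j\partial_{z_j}$, $a_j\in\mathbb{C}[[z-p,\bar z-\bar p]]$, preserving $\mathbb{C}I(O)$; $D^{10}_O(p)$ is the set of their values at $p$; $H^{10}_pO=\{\sum_j\xi_j\partial_{z_j}:\sum_j\xi_j\frac{\partial f}{\partial z_j}(p)=0\ \forall f\in\mathbb{C}I(O)\}$. $O$ is CR if $H^{10}_pO\subset D^{10}_O(p)$. Real formal orbit. Let $j_p^\infty E$ be the set of Taylor series at $p$ of smooth complex vector fields $L$ near $p$ in $\mathbb{C}^n$ with $L|_S$ a section of $E$, and $\mathfrak{g}$ the real Lie algebra of formal vector fields generated by $\{\mathrm{Re}\,L:L\in j_p^\infty E\}$. The real formal orbit $\mathcal{O}^{\mathbb{R}}_E(p)$ is the unique real formal submanifold $O$ at $p$ with $\dim O=\dim\mathfrak{g}(p)$ ($\mathfrak{g}(p)$ the space of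 values at $p$) such that all vector fields in $\mathfrak{g}$ are tangent to $O$. *)

(* Defs.v *)
From HB Require Import structures.
From mathcomp Require Import all_boot all_order all_algebra.
From mathcomp Require Import all_classical all_reals all_analysis.
From mathcomp.real_closed Require Import complex.

Set Implicit Arguments.
Unset Strict Implicit.
Unset Printing Implicit Defensive.

Import Order.TTheory GRing.Theory Num.Theory.
Import numFieldNormedType.Exports.

Local Open Scope classical_set_scope.
Local Open Scope ring_scope.

(* C^n is identified with 'rV[R]_(n + n): the point z = x + iy is             *)
(* row_mx x y.  A complex tangent vector is a v : 'rV[R[i]]_(n + n) listing   *)
(* its components on d/dx_1, ..., d/dx_n, d/dy_1, ..., d/dy_n, and a complex  *)
(* covector is a column of the same size.                                     *)

Section Smooth.
Context {R : realType} {N : nat}.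
Implicit Types (U : set 'rV[R]_N) (f g : 'rV[R]_N -> R[i]) (x : 'rV[R]_N).

Definition ebasis (j : 'I_N) : 'rV[R]_N := delta_mx 0 j.

Fixpoint Ck_on (k : nat) U (f : 'rV[R]_N -> R) : Prop :=
  (forall x, U x -> {for x, continuous f}) /\
  (if k is k'.+1 then
     forall j, (forall x, U x -> derivable f x (ebasis j)) /\
               Ck_on k' U ('D_(ebasis j) f)
   else True).

Definition smooth_on U (f : 'rV[R]_N -> R) : Prop := forall k, Ck_on k U f.

Definition csmooth_on U f : Prop :=
  smooth_on U (fun y => complex.Re (f y)) /\
  smooth_on U (fun y => complex.Im (f y)).

Definition cpartial (j : 'I_N) f : 'rV[R]_N -> R[i] := fun x =>
  Complex ('D_(ebasis j) (fun y => complex.Re (f y)) x)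
          ('D_(ebasis j) (fun y => complex.Im (f y)) x).

End Smooth.

Section Hypersurface.
Context {R : realType} {n : nat}.
Local Notation pt := 'rV[R]_(n + n).
Local Notation vec := 'rV[R[i]]_(n + n).
Local Notation covec := 'cV[R[i]]_(n + n).
Implicit Types (S U : set pt) (x p : pt) (v : vec) (f : pt -> R[i]).

Definition defining_function S U (rho : pt -> R) : Prop :=
  [/\ open U, smooth_on U rho,
      forall y, U y -> (S y <-> rho y = 0) &
      forall y, U y -> exists j, 'D_(ebasis j) rho y != 0].

Definition smooth_hypersurface S : Prop :=
  forall x, S x -> exists U rho, U x /\ defining_function S U rho.

(* The complexified tangent space of S at x.                                  *)
Definition CT S x : set vec := [set v |
  exists U rho, [/\ U x, defining_function S U rho &
    \sum_j v 0 j * real_complex R ('D_(ebasis j) rho x) = 0]].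

(* sum_j xi_j d/dz_j, with d/dz_j = (d/dx_j - i d/dy_j) / 2.                  *)
Definition dz_vec (xi : 'rV[R[i]]_n) : vec :=
  row_mx (2^-1 *: xi) (- ('i%C / 2) *: xi).

Definition vconj v : vec := map_mx conjc v.

Definition H10 S x : set vec :=
  CT S x `&` [set v | exists xi, v = dz_vec xi].

Definition conj_bundle (F : pt -> set vec) : pt -> set vec :=
  fun x => vconj @` F x.

Definition CH S x : set vec := [set v |
  exists a b, [/\ H10 S x a, conj_bundle (H10 S) x b & v = a + b]].

(* Functions, vector fields and forms on S (or on the part of S in an open    *)
(* set U) are represented by functions on the whole of R^(2n), whose values   *)
(* off S are irrelevant in all that follows.                                  *)

(* g is, near x, a smooth extension of the restriction of f to S.             *)
Definition local_extension S x f (g : pt -> R[i]) : Prop :=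
  exists U, [/\ open U, U x, csmooth_on U g &
                forall y, S y -> U y -> g y = f y].

Definition smooth_at S x f : Prop := exists g, local_extension S x f g.

(* The derivative at x of f, smooth on S near x, along v in CT S x: the value *)
(* does not depend on the extension chosen, as v is tangent to S.             *)
Definition dS S f x v : R[i] :=
  let g := xget (fun=> 0) (local_extension S x f) in
  \sum_j v 0 j * cpartial j g x.

Definition vf_app S (L : pt -> vec) f : pt -> R[i] := fun x => dS S f x (L x).

Definition bracket S (L L' : pt -> vec) : pt -> vec := fun x =>
  \row_j (vf_app S L (fun y => L' y 0 j) x - vf_app S L' (fun y => L y 0 j) x).

(* L is a smooth section of F over the part of S in U.                        *)
Definition is_section S (F : pt -> set vec) U (L : pt -> vec) : Prop :=
  forall x, S x -> U x -> F x (L x) /\ forall j, smooth_at S x (fun y => L y 0 j).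

Definition is_section_or_conj S (F : pt -> set vec) U (L : pt -> vec) : Prop :=
  is_section S F U L \/ is_section S (conj_bundle F) U L.

Definition pairing (th : pt -> covec) x v : R[i] := (v *m th x) 0 0.

(* A 1-form on S is represented by covectors of R^(2n), of which only the     *)
(* restrictions to the spaces CT S x matter.                                  *)
Definition smooth_form S U (th : pt -> covec) : Prop :=
  forall x, S x -> U x -> exists W (eta : pt -> covec),
    [/\ open W, W x, forall j, csmooth_on W (fun y => eta y j 0) &
        forall y v, S y -> W y -> CT S y v -> pairing th y v = pairing eta y v].

Definition contact_form_on S U (th : pt -> covec) : Prop :=
  [/\ smooth_form S U th,
      forall x, S x -> U x -> exists2 v, CT S x v & pairing th x v != 0 &
      forall x v, S x -> U x -> CH S x v -> pairing th x v = 0].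

Definition contact_form S (th : pt -> covec) : Prop := contact_form_on S setT th.

Definition purely_imaginary_on S U (th : pt -> covec) : Prop :=
  forall x (w : pt), S x -> U x -> CT S x (map_mx (real_complex R) w) ->
    complex.Re (pairing th x (map_mx (real_complex R) w)) = 0.

(* In R[i], 0 <= z means that z is real and nonnegative.                      *)
Definition pseudoconvex S : Prop :=
  forall x, S x -> exists U (th : pt -> covec),
    [/\ open U, U x, contact_form_on S U th, purely_imaginary_on S U th &
        forall V (L : pt -> vec), open V -> is_section S (H10 S) V L ->
          forall y, S y -> U y -> V y ->
            0 <= pairing th y (bracket S L (fun u => vconj (L u)) y)].

Definition levi S (th : pt -> covec) (L2 L1 : pt -> vec) : pt -> R[i] :=
  fun x => pairing th x (bracket S L2 L1 x).

(* L^t ... L^3 th([L^2, L^1]), with Ks = [:: L^t; ...; L^3].                  *)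
Definition levi_deriv S th (Ks : seq (pt -> vec)) (L2 L1 : pt -> vec) :
    pt -> R[i] :=
  foldr (vf_app S) (levi S th L2 L1) Ks.

(* om represents a th-dual form: the first case is t = 1, the second t >= 2.  *)
(* Only the restriction of om to H10 S is constrained.                        *)
Definition dual_form S (th om : pt -> covec) : Prop :=
  (exists L1, is_section_or_conj S (H10 S) setT L1 /\
     forall L x, is_section S (H10 S) setT L -> S x ->
       pairing om x (L x) = levi S th L L1 x)
  \/
  (exists Ks L2 L1,
     [/\ forall K, K \in Ks -> is_section_or_conj S (H10 S) setT K,
         is_section_or_conj S (H10 S) setT L2,
         is_section_or_conj S (H10 S) setT L1 &
         forall L x, is_section S (H10 S) setT L -> S x ->
           pairing om x (L x) =
           vf_app S L (fun y => real_complex R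
                         (complex.Re (levi_deriv S th Ks L2 L1 y))) x]).

Definition complex_subbundle S (E : pt -> set vec) : Prop :=
  (forall x, S x -> E x `<=` H10 S x) /\
  exists r, forall x, S x -> exists U (e : pt -> 'M[R[i]]_(r, n + n)),
    [/\ open U, U x,
        forall i, is_section S E U (fun y => row i (e y)),
        forall y, S y -> U y -> row_free (e y) &
        forall y v, S y -> U y -> (E y v <-> (v <= e y)%MS)].

(* (om_1 /\ ... /\ om_l)(xi_1, ..., xi_l) = det (om_i (xi_j)).                *)
Definition wedge_neq0 S l (om : 'I_l -> pt -> covec) x : Prop :=
  exists xi : 'I_l -> vec, (forall j, H10 S x (xi j)) /\
    \det (\matrix_(i, j) pairing (om i) x (xi j)) != 0.

Definition special_subbundle S th (E : pt -> set vec) : Prop :=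
  complex_subbundle S E /\
  exists l (om : 'I_l -> pt -> covec),
    [/\ forall i, dual_form S th (om i),
        forall x, S x -> wedge_neq0 S om x &
        forall x, S x ->
          E x = [set v | H10 S x v /\ forall i, pairing (om i) x v = 0]].

Definition infinite_levi_type S th (E : pt -> set vec) p : Prop :=
  forall U Ks L2 L1, open U -> U p ->
    (forall K, K \in Ks -> is_section_or_conj S E U K) ->
    is_section_or_conj S E U L2 -> is_section_or_conj S E U L1 ->
    levi_deriv S th Ks L2 L1 p = 0.

End Hypersurface.

(* Formal power series in N variables, as families of coefficients.  A series *)
(* at p is a series in the coordinates of x - p.                              *)
Definition fps (K : Type) (N : nat) := {ffun 'I_N -> nat} -> K.

Section FormalSeries.
Context {K : fieldType} {N : nat}.
Implicit Types (f g : fps K N).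

Definition fmul f g : fps K N := fun m =>
  \sum_(k : {dffun forall i : 'I_N, 'I_(m i).+1})
    f [ffun i => k i : nat] * g [ffun i => (m i - k i)%N].

Definition fderiv (j : 'I_N) f : fps K N := fun m =>
  f [ffun i => (m i + (i == j))%N] *+ (m j).+1.

Definition fval f : K := f [ffun=> 0%N].

(* The formal vector field sum_j (X j) d/dx_j.                                *)
Definition fvf := 'I_N -> fps K N.
Implicit Types (X Y : fvf).

Definition fapp X f : fps K N := fun m => \sum_j fmul (X j) (fderiv j f) m.

Definition fbracket X Y : fvf := fun j m => fapp X (Y j) m - fapp Y (X j) m.

Definition fvalue X : 'rV[K]_N := \row_j fval (X j).

Definition lie_subalgebra (A : set fvf) : Prop :=
  [/\ A (fun _ _ => 0),
      forall X Y, A X -> A Y -> A (fun j m => X j m + Y j m),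
      forall c X, A X -> A (fun j m => c * X j m) &
      forall X Y, A X -> A Y -> A (fbracket X Y)].

(* I is generated by k series vanishing at the base point, with linearly      *)
(* independent differentials there; it is the ideal of a formal submanifold   *)
(* of dimension N - k.                                                        *)
Definition formal_submanifold (I : set (fps K N)) (k : nat) : Prop :=
  exists h : 'I_k -> fps K N,
    [/\ forall i, fval (h i) = 0,
        row_free (\matrix_(i, j) fval (fderiv j (h i))) &
        I = [set f | exists a : 'I_k -> fps K N,
                       f = fun m => \sum_i fmul (a i) (h i) m]].

Definition ftangent (I : set (fps K N)) X : Prop := forall f, I f -> I (fapp X f).

End FormalSeries.
Arguments fvf : clear implicits.

Section FormalCR.
Context {R : realType} {n : nat}.
Implicit Types (I : set (fps R (n + n))).

(* C[[z, zbar]] is identified with C[[x, y]] by z = x + iy.                   *)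
Definition CI I : set (fps R[i] (n + n)) := [set f |
  I (fun m => complex.Re (f m)) /\ I (fun m => complex.Im (f m))].

Definition fdz (j : 'I_n) (f : fps R[i] (n + n)) : fps R[i] (n + n) := fun m =>
  (fderiv (lshift n j) f m - 'i%C * fderiv (rshift n j) f m) / 2.

(* The field sum_j (a j) d/dz_j, given by the family a.                       *)
Definition D10 I : set ('I_n -> fps R[i] (n + n)) := [set a |
  forall f, CI I f -> CI I (fun m => \sum_j fmul (a j) (fdz j f) m)].

Definition D10_at I : set 'rV[R[i]]_n :=
  [set xi | exists2 a, D10 I a & xi = \row_j fval (a j)].

Definition H10_formal I : set 'rV[R[i]]_n :=
  [set xi | forall f, CI I f -> \sum_j xi 0 j * fval (fdz j f) = 0].

Definition formal_CR I : Prop := H10_formal I `<=` D10_at I.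

End FormalCR.

Section Orbit.
Context {R : realType} {n : nat}.
Local Notation pt := 'rV[R]_(n + n).
Local Notation vec := 'rV[R[i]]_(n + n).
Implicit Types (S : set pt) (E : pt -> set vec) (p : pt).

Definition taylor p (f : pt -> R[i]) : fps R[i] (n + n) := fun m =>
  foldr (fun j g => iter (m j) (cpartial j) g) f (enum 'I_(n + n)) p
  / (\prod_j (m j)`!)%N%:R.

Definition jets S E p : set (fvf R[i] (n + n)) := [set X |
  exists U (L : pt -> vec),
    [/\ open U, U p, forall j, csmooth_on U (fun y => L y 0 j),
        forall y, S y -> U y -> E y (L y) &
        X = fun j => taylor p (fun y => L y 0 j)]].

(* As d/dx_j and d/dy_j are real, Re L is obtained by taking the real parts   *)
(* of the components of L on them.                                            *)
Definition re_vf (X : fvf R[i] (n + n)) : fvf R (n + n) :=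
  fun j m => complex.Re (X j m).

Definition orbit_algebra S E p : set (fvf R (n + n)) :=
  smallest lie_subalgebra (re_vf @` jets S E p).

Definition real_formal_orbit S E p (I : set (fps R (n + n))) : Prop :=
  exists k (V : {vspace pt}),
    [/\ formal_submanifold I k,
        forall w, w \in V <-> exists2 X, orbit_algebra S E p X & w = fvalue X,
        \dim V = (n + n - k)%N &
        forall X, orbit_algebra S E p X -> ftangent I X].

(* The real formal orbit is uniquely determined by real_formal_orbit.         *)
Definition formal_Huang_Yin S E p : Prop :=
  forall I, real_formal_orbit S E p I -> formal_CR I.

End Orbit.

(* Main.v *)
(** Let G be the germs at p of sections of E and of its conjugate, and call a
    function flat if all its iterated derivatives along G vanish at p. Write
    th0 = d'rho and Om = d(th0) for a defining function rho of S; every contact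
    form is a multiple of th0 on the complexified tangent space of S. Infinite
    Levi type says that Om(L, conj L) is flat for L in E. Pseudoconvexity and the
    Cauchy-Schwarz inequality bound |Om(L, conj H)|^2, for H of type (1,0), by
    Om(L, conj L) Om(H, conj H), which is flat; a function whose square is bounded
    on S by a flat function is itself flat, so Om(L, conj H) is flat.

    Consequently bracketing with fields of G preserves the fields H for which
    th0(H) is flat, and by the Jacobi identity so does bracketing with any field of
    the Lie algebra generated by the real parts of G. Hence Om(X, Y) = 0 at p for
    all X, Y in that algebra. If v = X + iY at p is of type (1,0), then
    Om(v, conj v) = 0, so Om(v, -) kills all (0,1) vectors and the 1-dual forms
    vanish on v; the t-dual forms with t >= 2 are restrictions of differentials of
    real functions annihilated by G on S, hence by X and Y. Thus v lies in E, and a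
    local section of E through v, together with its product by i, gives a formal
    (1,0) field tangent to the orbit with value v. *)

From HB Require Import structures.
Require Import Defs.
From mathcomp Require Import all_boot all_order all_algebra.
From mathcomp Require Import all_classical all_reals all_analysis.
From mathcomp.real_closed Require Import complex.
From mathcomp Require Import zify ring lra.

Set Implicit Arguments.
Unset Strict Implicit.
Unset Printing Implicit Defensive.

Import Order.TTheory GRing.Theory Num.Theory.
Import numFieldNormedType.Exports.

Local Open Scope classical_set_scope.
Local Open Scope ring_scope.

(** * Smooth functions of several real variables *)

Section RealSmooth.
Context {R : realType} {N : nat}.
Local Notation T := 'rV[R]_N.
Implicit Types (U : set T) (f g : T -> R) (x v : T).

(** Two obstacles shape the proof. The square-root step restricts a function to curves, so it
    controls only the pure powers [X^m u] of one real field, while flatness asks for all words in G.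
    Mixed words come from pure powers by polarization, which needs a family closed under brackets
    and real combinations. E need not be involutive, so G is replaced by [flat_preserving], the real
    tangent fields mapping flat functions to flat functions: it has these closure properties by its
    very form and contains the real parts of G. Secondly, the inequality is known only on S, so the
    curves must lie in S exactly, though they need follow X only to finite order. The contact form
    of pseudoconvexity is local and need not be [theta]; both are compared with th0, and the unknown
    sign of the factor disappears in the Cauchy-Schwarz inequality, which is quadratic. On the
    formal side, the dimension of the orbit makes the values of the algebra fill its tangent space
    at p, so both parts of a tangent (1,0) vector are such values. Each formal field of the algebra
    is the Taylor series of a smooth one, so the argument can be run with smooth germs. *)

Lemma Ck_on_cont k U f x : Ck_on k U f -> U x -> {for x, continuous f}.
Proof. by case: k => [|k] [cf _]; exact: cf. Qed.

Lemma Ck_on_sub k U V f : V `<=` U -> Ck_on k U f -> Ck_on k V f.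
Proof.
move=> VU; elim: k f => [|k IH] f /= [cf df]; split=> //.
- by move=> x /VU; exact: cf.
- by move=> x /VU; exact: cf.
- by move=> j; have [d1 d2] := df j; split=> [x /VU|]; [exact: d1|exact: IH].
Qed.

Lemma Ck_on_eq k U f g : open U -> (forall x, U x -> f x = g x) ->
  Ck_on k U f -> Ck_on k U g.
Proof.
have nfg (h1 h2 : T -> R) x : open U -> (forall x, U x -> h1 x = h2 x) -> U x ->
    {near x, h1 =1 h2}.
  by move=> oU h12 Ux; have := open_nbhs_nbhs (conj oU Ux); apply: filterS => y /h12.
move=> oU; elim: k f g => [|k IH] f g fg /= [cf df];
  (split=> [x Ux|]; first by
    have := cf _ Ux; rewrite /prop_for /continuous_at (fg _ Ux); apply: cvg_trans;
    have H := nfg _ _ _ oU fg Ux; exact: near_eq_cvg H) => //.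
move=> j.
have [d1 d2] := df j; split=> [x Ux|].
  by apply: near_eq_derivable (d1 _ Ux); exact: (nfg _ _ _ oU fg Ux).
by apply: IH d2 => x Ux; apply: near_eq_derive; exact: (nfg _ _ _ oU fg Ux).
Qed.

Lemma Ck_on_mono k U f : Ck_on k.+1 U f -> Ck_on k U f.
Proof.
elim: k f => [|k IH] f; first by case.
move=> [cf df]; split=> // j; have [d1 d2] := df j; split=> //; exact: IH.
Qed.

Lemma Ck_on_cst k U (c : R) : Ck_on k U (fun=> c).
Proof.
have cc (d : R) x : {for x, continuous (fun=> d)}.
  exact: cst_continuous.
elim: k c => [|k IH] c /=; split; try by move=> x _; exact: cc.
  by [].
move=> j; split=> [x _|]; first exact: derivable_cst.
rewrite (_ : 'D_ _ _ = fun=> 0); first exact: IH.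
apply/funext => x; exact: (derive_cst c).
Qed.

Lemma Ck_onD k U f g : open U ->
  Ck_on k U f -> Ck_on k U g -> Ck_on k U (fun x => f x + g x).
Proof.
move=> oU; elim: k f g => [|k IH] f g /= [cf df] [cg dg].
  by split=> // x Ux; exact: continuousD (cf _ Ux) (cg _ Ux).
split=> [x Ux|j]; first by exact: continuousD (cf _ Ux) (cg _ Ux).
have [d1 d2] := df j; have [e1 e2] := dg j; split=> [x Ux|].
  by apply: derivableD; [exact: d1|exact: e1].
apply: Ck_on_eq (IH _ _ d2 e2) => // x Ux /=.
by rewrite deriveD //; [exact: d1|exact: e1].
Qed.

Lemma Ck_onM k U f g : open U ->
  Ck_on k U f -> Ck_on k U g -> Ck_on k U (fun x => f x * g x).
Proof.
move=> oU; elim: k f g => [|k IH] f g.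
  move=> /= [cf df] [cg dg].
  by split=> // x Ux; exact: continuousM (cf _ Ux) (cg _ Ux).
move=> Cf Cg; have Cf' := Ck_on_mono Cf; have Cg' := Ck_on_mono Cg.
move: Cf Cg => /= [cf df] [cg dg].
split=> [x Ux|j]; first by exact: continuousM (cf _ Ux) (cg _ Ux).
have [d1 d2] := df j; have [e1 e2] := dg j; split=> [x Ux|].
  by apply: derivableM; [exact: d1|exact: e1].
apply: Ck_on_eq (Ck_onD oU (IH _ _ Cf' e2) (IH _ _ Cg' d2)) => // x Ux /=.
by rewrite deriveM //; [exact: d1|exact: e1].
Qed.

Lemma Ck_onV k U f : open U -> (forall x, U x -> f x != 0) ->
  Ck_on k U f -> Ck_on k U (fun x => (f x)^-1).
Proof.
move=> oU f0; elim: k => [|k IH].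
  by move=> [cf _]; split=> // x Ux; exact: continuousV (f0 _ Ux) (cf _ Ux).
move=> Cf; have Cf' := IH (Ck_on_mono Cf).
have [cf df] := Cf.
split=> [x Ux|j]; first by exact: continuousV (f0 _ Ux) (cf _ Ux).
have [d1 d2] := df j; split=> [x Ux|].
  by apply: derivableV; [exact: f0|exact: d1].
have CM := Ck_onM oU (Ck_onM oU Cf' Cf') (Ck_onM oU d2 (Ck_on_cst k U (-1))).
apply: Ck_on_eq CM => // x Ux /=.
rewrite deriveV //; [|exact: f0|exact: d1].
by rewrite /GRing.scale /= -invfM -expr2 mulrN1 mulrN mulNr.
Qed.

Definition rsm x f := exists U, [/\ open U, U x & smooth_on U f].

Lemma rsm_near x f : rsm x f -> \forall y \near x, rsm y f.
Proof.
move=> [U [oU Ux sf]]; have := open_nbhs_nbhs (conj oU Ux).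
by apply: filterS => y Uy; exists U.
Qed.

Lemma rsm_eq x f g : (\forall y \near x, f y = g y) -> rsm x f -> rsm x g.
Proof.
move=> fg [U [oU Ux sf]]; move: fg; rewrite /prop_near1 nbhsE => -[V [oV Vx] VP].
exists (U `&` V); split; [exact: openI|by []|move=> k].
apply: (@Ck_on_eq k _ f); first exact: openI.
  by move=> y [_ /VP].
by apply: Ck_on_sub (sf k) => y [].
Qed.

Lemma rsm_cont x f : rsm x f -> {for x, continuous f}.
Proof. by move=> [U [oU Ux /(_ 0%N) sf]]; exact: Ck_on_cont sf Ux. Qed.

Lemma rsm_derivable x f j : rsm x f -> derivable f x (ebasis j).
Proof. by move=> [U [oU Ux /(_ 1%N) [_ /(_ j) [d _]]]]; exact: d. Qed.

Lemma rsm_D x f j : rsm x f -> rsm x ('D_(ebasis j) f).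
Proof.
move=> [U [oU Ux sf]]; exists U; split=> // k.
by have [_ /(_ j) []] := sf k.+1.
Qed.

Lemma rsm_cst x (c : R) : rsm x (fun=> c).
Proof. by exists setT; split=> //; [exact: openT|move=> k; exact: Ck_on_cst]. Qed.

Lemma rsm_lift2 x f g : rsm x f -> rsm x g ->
  exists U, [/\ open U, U x, smooth_on U f & smooth_on U g].
Proof.
move=> [U [oU Ux sf]] [V [oV Vx sg]]; exists (U `&` V); split=> //.
- exact: openI.
- by move=> k; apply: Ck_on_sub (sf k) => y [].
- by move=> k; apply: Ck_on_sub (sg k) => y [].
Qed.

Lemma rsmD x f g : rsm x f -> rsm x g -> rsm x (fun y => f y + g y).
Proof.
move=> sf sg; have [U [oU Ux cf cg]] := rsm_lift2 sf sg.
by exists U; split=> // k; exact: Ck_onD.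
Qed.

Lemma rsmM x f g : rsm x f -> rsm x g -> rsm x (fun y => f y * g y).
Proof.
move=> sf sg; have [U [oU Ux cf cg]] := rsm_lift2 sf sg.
by exists U; split=> // k; exact: Ck_onM.
Qed.

Lemma rsmN x f : rsm x f -> rsm x (fun y => - f y).
Proof.
move=> sf; have := rsmM (rsm_cst x (-1)) sf.
by apply: rsm_eq; near=> y; rewrite mulN1r.
Unshelve. all: by end_near. Qed.

Lemma rsmB x f g : rsm x f -> rsm x g -> rsm x (fun y => f y - g y).
Proof. by move=> sf sg; apply: rsmD => //; exact: rsmN. Qed.

Lemma rsm_near_neq0 x f : rsm x f -> f x != 0 -> \forall y \near x, f y != 0.
Proof.
move=> sf fx; have := rsm_cont sf; move/cvgr_neq0; exact.
Qed.

Lemma rsmV x f : rsm x f -> f x != 0 -> rsm x (fun y => (f y)^-1).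
Proof.
move=> sf fx; have := rsm_near_neq0 sf fx.
rewrite /prop_near1 nbhsE => -[V [oV Vx] VP].
move: sf => [U [oU Ux sf]]; exists (U `&` V); split=> //; first exact: openI.
move=> k; apply: Ck_onV; first exact: openI.
- by move=> y [_ /VP].
- by apply: Ck_on_sub (sf k) => y [].
Qed.

Lemma rsm_sum x (I : Type) (r : seq I) (F : I -> T -> R) :
  (forall i, rsm x (F i)) -> rsm x (fun y => \sum_(i <- r) F i y).
Proof.
move=> sF; elim: r => [|i r IH].
  by apply: rsm_eq (rsm_cst x 0); near=> y; rewrite big_nil.
apply: rsm_eq (rsmD (sF i) IH); near=> y; by rewrite big_cons.
Unshelve. all: by end_near. Qed.

End RealSmooth.

(** * Differentiability and symmetry of second derivatives from continuous partial derivatives *)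

Section Calculus.
Context {R : realType} {N : nat}.
Local Notation T := 'rV[R]_N.
Implicit Types (U : set T) (f g : T -> R) (x v : T).

Lemma line_derive f x v (s : R) : derivable f (x + s *: v) v ->
  is_derive s (1 : R) (fun s => f (x + s *: v)) ('D_v f (x + s *: v)).
Proof.
move=> df.
have E (h : R) : x + (h + s) *: v = h *: v + (x + s *: v).
  by rewrite scalerDl addrCA.
apply: DeriveDef.
  move: df; rewrite /derivable /=.
  rewrite (_ : (fun h => h^-1 *: (f (h *: v + (x + s *: v)) - f (x + s *: v))) =
     (fun h => h^-1 *: (f (x + (h *: (1:R) + s) *: v) - f (x + s *: v)))) //.
  by apply/funext => h; rewrite -E /GRing.scale /= mulr1.
rewrite /derive /=.
rewrite (_ : (fun h => h^-1 *: (f (h *: v + (x + s *: v)) - f (x + s *: v))) =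
   (fun h => h^-1 *: (f (x + (h *: (1:R) + s) *: v) - f (x + s *: v)))) //.
by apply/funext => h; rewrite -E /GRing.scale /= mulr1.
Qed.

(** The condition [|s| <= |t|] covers both signs of [t], so that later estimates near 0 need no case
    distinction. *)
Lemma centered_MVT (g dg : R -> R) (t : R) :
  (forall s, `|s| <= `|t| -> is_derive s (1 : R) g (dg s)) ->
  exists2 c, `|c| <= `|t| & g t - g 0 = t * dg c.
Proof.
move=> dgP.
have cg (a b : R) : `|a| <= `|t| -> `|b| <= `|t| -> {within `[a, b], continuous g}.
  move=> at_ bt; apply: derivable_within_continuous => s.
  rewrite in_itv /= => /andP[as_ sb]; have [] // := dgP s _.
  move: at_ bt; rewrite !ler_norml => /andP[a1 a2] /andP[b1 b2].
  by rewrite (le_trans a1 as_) (le_trans sb b2).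
have z0 : `|0 : R| <= `|t| by rewrite normr0.
have [t0|t0] := leP 0 t.
  have [|c ct E] := @MVT_segment R g dg 0 t t0 _ (cg _ _ z0 (lexx _)).
    move=> s; rewrite in_itv /= => /andP[s0 st]; apply: dgP.
    by rewrite (ger0_norm (ltW s0)) ger0_norm // ltW.
  exists c; last by rewrite E subr0 mulrC.
  move: ct; rewrite in_itv /= => /andP[c0 ct].
  by rewrite !ger0_norm.
have [|c ct E] := @MVT_segment R g dg t 0 (ltW t0) _ (cg _ _ (lexx _) z0).
  move=> s; rewrite in_itv /= => /andP[s0 st]; apply: dgP.
  by rewrite (ltr0_norm t0) (ltr0_norm st) lerN2 ltW.
exists c; last by rewrite -opprB E sub0r mulrN opprK mulrC.
move: ct; rewrite in_itv /= => /andP[c0 ct].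
by rewrite (ltr0_norm t0) (ler0_norm ct) lerN2.
Qed.

Lemma line_MVT f x v (t : R) :
  (forall s, `|s| <= `|t| -> derivable f (x + s *: v) v) ->
  exists2 c, `|c| <= `|t| & f (x + t *: v) - f x = t * 'D_v f (x + c *: v).
Proof.
move=> df.
have [s st|c ct E] := @centered_MVT (fun s => f (x + s *: v)) (fun s => 'D_v f (x + s *: v)) t.
  by apply: line_derive; exact: df.
by exists c => //; rewrite -E scale0r addr0.
Qed.

Lemma coord_le_norm v i : `|v 0 i| <= `|v|.
Proof. by rewrite [leRHS]/Num.norm /= mx_normrE; apply: (le_bigmax _ _ (0, i)). Qed.

Lemma norm_le_coord v (r : R) : 0 <= r -> (forall i, `|v 0 i| <= r) -> `|v| <= r.
Proof.
move=> r0 vr; rewrite [leLHS]/Num.norm /= mx_normrE bigmax_le // => -[i j] _ /=.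
by rewrite ord1.
Qed.

(** The vertices of the staircase path from 0 to [h], whose successive edges are parallel to the
    coordinate axes. *)
Definition trunc_vec (h : T) (k : nat) : T :=
  \row_i (if (i < k)%N then h 0 i else 0).

Lemma trunc_vecS h (k : 'I_N) :
  trunc_vec h k.+1 = trunc_vec h k + h 0 k *: ebasis k.
Proof.
apply/rowP => i; rewrite !mxE /= ltnS leq_eqVlt.
have [->|ik] := eqVneq i k; first by rewrite !eqxx ltnn /= mulr1 add0r.
by rewrite (inj_eq val_inj) (negbTE ik) /= mulr0 addr0.
Qed.

(** In the sup norm the whole staircase, edges included, stays in the ball of radius [|h|]. It is
    applied with [i = k], where the conditional reduces to [c]. *)
Lemma trunc_vec_le (h : T) (k : nat) (i : 'I_N) (c : R) : `|c| <= `|h 0 i| ->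
  `|trunc_vec h k + (if (i < k)%N then 0 else c) *: ebasis i| <= `|h|.
Proof.
move=> ch; apply: norm_le_coord => // j; rewrite !mxE eqxx /=.
have [->|ji] := eqVneq j i.
  rewrite mulr1; case: ifP => _; first by rewrite addr0 coord_le_norm.
  by rewrite add0r (le_trans ch) ?coord_le_norm.
rewrite mulr0 addr0; case: ifP => _; first exact: coord_le_norm.
by rewrite normr0.
Qed.

Definition grad_lin f x (h : T) : R := \sum_j h 0 j * 'D_(ebasis j) f x.

Lemma grad_lin_linear f x : linear (grad_lin f x : T -> R^o).
Proof.
move=> a u v; rewrite /grad_lin scaler_sumr -big_split /=; apply: eq_bigr => j _.
by rewrite !mxE mulrDl /GRing.scale /= mulrA.
Qed.

HB.instance Definition _ f x := GRing.isLinear.Build R T R^o _ (grad_lin f x : T -> R^o) (@grad_lin_linear f x).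

Lemma grad_lin_continuous f x : continuous (grad_lin f x : T -> R^o).
Proof.
have -> : (grad_lin f x : T -> R^o) = \sum_j (fun h : T => h 0 j * 'D_(ebasis j) f x).
  by apply/funext => h; rewrite fct_sumE.
elim/big_ind: _ => [||j _] y.
- exact: cst_continuous.
- move=> g cf cg z; exact: continuousD (cf z) (cg z).
- rewrite /continuous_at; apply: (@cvgM R T (nbhs y) _ (fun h => h 0 j) (fun=> _)).
    exact: coord_continuous.
  exact: cvg_cst.
Qed.

(** Smoothness is defined by partial derivatives only. The increment of [f] is telescoped along the
    staircase, and the mean value theorem on each edge replaces it by a partial derivative at a
    nearby point, which continuity compares with the one at [x]. *)
Lemma rsm_diff f x : rsm x f ->
  differentiable f x /\ 'd f x = grad_lin f x :> (T -> R).
Proof.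
move=> sf.
have E : f \o shift x = (cst (f x) + (grad_lin f x : T -> R^o)) +o_ (0 : T) id.
  apply/eqaddoP => e e0.
  (* Each of the [N] edges contributes an error of at most [e' * |h|]; the denominator [N.+1] also
     covers [N = 0]. *)
  pose e' : R := e / N.+1%:R.
  have e'0 : 0 < e' by rewrite divr_gt0.
  have H : \forall y \near x, rsm y f /\
      forall j, `|'D_(ebasis j) f x - 'D_(ebasis j) f y| <= e'.
    near=> y; split; first by near: y; exact: rsm_near.
    near: y; apply: filter_forall => j.
    by have /cvgrPdist_le /(_ _ e'0) := rsm_cont (rsm_D j sf).
  have [d /= d0 dP] : \forall h \near (0 : R), forall z, `|z| <= `|h| ->
      rsm (x + z) f /\ forall j, `|'D_(ebasis j) f x - 'D_(ebasis j) f (x + z)| <= e'.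
    have [d /= d0 dP] := (iffLR (nbhs_ballP _ _)) H.
    exists d => //= h; rewrite /ball_ /= sub0r normrN => hd z zh.
    by apply: dP; rewrite -ball_normE /ball_ /= opprD addNKr normrN (le_lt_trans zh).
  near=> h.
  have hd : `|h| < d.
    by near: h; apply/nbhs_ballP; exists d => //= z; rewrite -ball_normE /ball_ /= sub0r normrN.
  have {}dP z : `|z| <= `|h| -> rsm (x + z) f /\
      forall j, `|'D_(ebasis j) f x - 'D_(ebasis j) f (x + z)| <= e'.
    by move=> zh; apply: (dP `|h|); rewrite ?normr_id //= /ball_ /= sub0r normrN normr_id.
  have step (j : 'I_N) : exists2 z, `|z| <= `|h| &
      f (x + trunc_vec h j.+1) - f (x + trunc_vec h j) = h 0 j * 'D_(ebasis j) f (x + z).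
    rewrite trunc_vecS addrA.
    have [|c ch ->] := @line_MVT f (x + trunc_vec h j) (ebasis j) (h 0 j).
      move=> s sh; apply: rsm_derivable; rewrite -addrA; apply: (dP _ _).1.
      by have := @trunc_vec_le h j j s sh; rewrite ltnn.
    exists (trunc_vec h j + c *: ebasis j); last by rewrite addrA.
    by have := @trunc_vec_le h j j c ch; rewrite ltnn.
  have tele : f (h + x) - f x = \sum_(j < N) (f (x + trunc_vec h j.+1) - f (x + trunc_vec h j)).
    rewrite -(big_mkord xpredT (fun j => f (x + trunc_vec h j.+1) - f (x + trunc_vec h j))).
    rewrite telescope_sumr //; congr (f _ - f _).
      by rewrite addrC; congr (_ + _); apply/rowP => i; rewrite mxE ltn_ord.
    by rewrite (_ : trunc_vec h 0 = 0) ?addr0 //; apply/rowP => i; rewrite !mxE.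
  rewrite (_ : (_ - _) h = (f (h + x) - f x) - grad_lin f x h); last first.
    by rewrite !fctE /= opprD addrA.
  rewrite tele -sumrB (le_trans (ler_norm_sum _ _ _)) //.
  apply: (@le_trans _ _ (\sum_(j < N) (e' * `|h|))).
    apply: ler_sum => j _; have [z zh ->] := step j.
    rewrite -mulrBr normrM mulrC ler_pM // ?coord_le_norm //.
    by rewrite distrC; exact: (dP _ zh).2.
  rewrite sumr_const card_ord -[leLHS]mulr_natl mulrA ler_wpM2r //.
  by rewrite /e' mulrCA ger_pMr // ler_pdivrMr // mul1r ler_nat.
have D := diff_unique (@grad_lin_continuous f x) E.
split; last exact: D.
by apply/diff_locallyP; rewrite D; split => //; exact: grad_lin_continuous.
Unshelve. all: by end_near. Qed.

Lemma curve_derive f (ga : R -> T) (dga : 'I_N -> R) (t : R) : rsm (ga t) f ->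
  (forall i, is_derive t (1 : R) (fun s => ga s 0 i) (dga i)) ->
  is_derive t (1 : R) (f \o ga) (\sum_i dga i * 'D_(ebasis i) f (ga t)).
Proof.
move=> sf dg; have [df E] := rsm_diff sf.
have dga' : derivable ga t 1.
  by apply/derivable_mxP => i j; rewrite ord1; have [] := dg j.
have fga : differentiable ga t by exact/derivable1_diffP.
have cfg : differentiable (f \o ga) t by exact: differentiable_comp.
apply: DeriveDef; first exact: diff_derivable.
rewrite deriveE // diff_comp //= E /grad_lin -deriveE // derive_mx //.
by apply: eq_bigr => i _; rewrite mxE; have [_ ->] := dg i.
Qed.

Lemma derivable_translate f v y w : derivable f (y + w) v ->
  is_derive y v (fun z => f (z + w)) ('D_v f (y + w)).
Proof.
move=> df; have E : (fun h : R => h^-1 *: (((fun z => f (z + w)) \o shift y) (h *: v) - f (y + w))) =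
   (fun h => h^-1 *: ((f \o shift (y + w)) (h *: v) - f (y + w))).
  by apply/funext => h; rewrite /= addrA.
by apply: DeriveDef; rewrite /derivable /derive E.
Qed.

(** Two applications of the mean value theorem, to the increment of [f] in direction [j] and then to
    a partial derivative. The left side is symmetric in [i] and [j], whereas the order of
    differentiation on the right is not. *)
Lemma second_difference f x i j (t : R) :
  (forall z, `|z| <= 2 * `|t| -> rsm (x + z) f) ->
  exists2 z, `|z| <= 2 * `|t| &
    f (x + t *: ebasis i + t *: ebasis j) - f (x + t *: ebasis i) -
    (f (x + t *: ebasis j) - f x) =
    t * (t * 'D_(ebasis j) ('D_(ebasis i) f) (x + z)).
Proof.
move=> sf.
have nb (k : 'I_N) : `|ebasis k : T| <= 1.
  apply: norm_le_coord => // l; rewrite !mxE eqxx /=.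
  by case: (_ == _); rewrite ?normr1 ?normr0.
have n2 (a b : R) : `|a| <= `|t| -> `|b| <= `|t| -> `|a *: ebasis i + b *: ebasis j : T| <= 2 * `|t|.
  move=> at_ bt; rewrite (le_trans (ler_normD _ _)) // !normrZ mulrDl mul1r.
  by rewrite lerD // -[leRHS]mulr1 ler_pM.
have n1 (a : R) : `|a| <= `|t| -> `|a *: ebasis i : T| <= 2 * `|t|.
  by move=> at_; have := n2 a 0 at_; rewrite scale0r addr0 normr0; exact.
pose g y := f (y + t *: ebasis j) - f y.
have dg s : `|s| <= `|t| -> is_derive (x + s *: ebasis i) (ebasis i) g
   ('D_(ebasis i) f (x + s *: ebasis i + t *: ebasis j) - 'D_(ebasis i) f (x + s *: ebasis i)).
  move=> st; apply: is_deriveB.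
    apply: derivable_translate; apply: rsm_derivable; rewrite -addrA.
    by apply: sf; exact: n2.
  by apply: derivableP; apply: rsm_derivable; apply: sf; exact: n1.
have [s st|c ct E] := @line_MVT g x (ebasis i) t; first by have [] := dg s st.
have [s st|d dt D] := @line_MVT ('D_(ebasis i) f) (x + c *: ebasis i) (ebasis j) t.
  apply: rsm_derivable; apply: rsm_D; rewrite -addrA; apply: sf; exact: n2.
exists (c *: ebasis i + d *: ebasis j); first exact: n2.
rewrite -/(g x) -/(g (x + t *: ebasis i)) E; congr (t * _).
by have [_ ->] := dg c ct; rewrite D addrA.
Qed.

Lemma halves_dist (e a b c : R) :
  `|b - c| <= e / 2 -> `|a - c| <= e / 2 -> `|a - b| <= e.
Proof.
move=> bc ac; rewrite (splitr e) (le_trans (ler_distD c _ _)) //.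
by rewrite lerD // distrC.
Qed.

(** Both mixed derivatives, at points close to [x], equal the same second difference divided by
    [t ^ 2]; their continuity at [x] does the rest. *)
Lemma rsm_schwarz f x i j : rsm x f ->
  'D_(ebasis i) ('D_(ebasis j) f) x = 'D_(ebasis j) ('D_(ebasis i) f) x.
Proof.
move=> sf; apply/eqP; rewrite -subr_eq0 -normr_le0; apply/ler_addgt0Pr => e e0; rewrite add0r.
have e2 : 0 < e / 2 by rewrite divr_gt0.
have H : \forall y \near x, [/\ rsm y f,
    `|'D_(ebasis i) ('D_(ebasis j) f) x - 'D_(ebasis i) ('D_(ebasis j) f) y| <= e / 2 &
    `|'D_(ebasis j) ('D_(ebasis i) f) x - 'D_(ebasis j) ('D_(ebasis i) f) y| <= e / 2].
  have /cvgrPdist_le /(_ _ e2) h1 := rsm_cont (rsm_D i (rsm_D j sf)).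
  have /cvgrPdist_le /(_ _ e2) h2 := rsm_cont (rsm_D j (rsm_D i sf)).
  move: (rsm_near sf) h1 h2; apply: filterS3 => y a b c; split; [exact: a|exact: b|exact: c].
have [d /= d0 dP] := (iffLR (nbhs_ballP _ _)) H.
(* Then [2 * |t| < d], so the intermediate points of both second differences lie in the good
   ball. *)
pose t := d / 4.
have t0 : 0 < t by rewrite divr_gt0.
have P z : `|z| <= 2 * `|t| -> ball x d (x + z).
  move=> zt; rewrite -ball_normE /ball_ /= opprD addNKr normrN (le_lt_trans zt) //.
  by rewrite gtr0_norm // /t; lra.
have [z zt|z1 z1t E1] := @second_difference f x i j t.
  by have [] := dP _ (P _ zt).
have [z zt|z2 z2t E2] := @second_difference f x j i t.
  by have [] := dP _ (P _ zt).
have E : 'D_(ebasis j) ('D_(ebasis i) f) (x + z1) = 'D_(ebasis i) ('D_(ebasis j) f) (x + z2).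
  have tn0 : t != 0 by rewrite gt_eqF.
  have C : x + t *: ebasis j + t *: ebasis i = x + t *: ebasis i + t *: ebasis j.
    by rewrite -!addrA [t *: _ + _]addrC.
  rewrite C in E2; apply: (mulfI tn0); apply: (mulfI tn0).
  by apply: etrans (esym E1) _; apply: etrans _ E2; ring.
have [_ _ A1] := dP _ (P _ z1t); have [_ A2 _] := dP _ (P _ z2t).
rewrite E in A1.
exact: halves_dist A1 A2.
Qed.

End Calculus.

(** * Approximate integral curves on a hypersurface *)

Section PowerOrder.
Context {R : realType}.
Implicit Types (g h : R -> R) (k : nat).

Definition isO k g := exists C : R, \forall t \near (0 : R), `|g t| <= C * `|t| ^+ k.

Lemma isO_eq k g h : (\forall t \near (0 : R), g t = h t) -> isO k g -> isO k h.
Proof. by move=> gh [C CP]; exists C; apply: filterS2 gh CP => t ->. Qed.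

Lemma isO_pos k g : isO k g ->
  exists2 C : R, 0 <= C & \forall t \near (0 : R), `|g t| <= C * `|t| ^+ k.
Proof.
move=> [C CP]; exists `|C| => //; apply: filterS CP => t /le_trans; apply.
by rewrite ler_wpM2r ?exprn_ge0 // ler_norm.
Qed.

Lemma isOD k g h : isO k g -> isO k h -> isO k (fun t => g t + h t).
Proof.
move=> [C CP] [D DP]; exists (C + D); apply: filterS2 CP DP => t gt ht.
by rewrite mulrDl (le_trans (ler_normD _ _)) // lerD.
Qed.

Lemma isON k g : isO k g -> isO k (fun t => - g t).
Proof. by move=> [C CP]; exists C; apply: filterS CP => t; rewrite normrN. Qed.

Lemma isOB k g h : isO k g -> isO k h -> isO k (fun t => g t - h t).
Proof. by move=> Og Oh; apply: isOD => //; exact: isON. Qed.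

Lemma isOM k l g h : isO k g -> isO l h -> isO (k + l) (fun t => g t * h t).
Proof.
move=> [C CP] [D DP]; exists (C * D); apply: filterS2 CP DP => t gt ht.
by rewrite normrM exprD mulrACA ler_pM.
Qed.

Lemma isO0 k : isO k (fun=> 0).
Proof. by exists 0; near=> t; rewrite normr0 mul0r.
Unshelve. all: by end_near. Qed.

Lemma isO_sum k (I : Type) (r : seq I) (F : I -> R -> R) :
  (forall i, isO k (F i)) -> isO k (fun t => \sum_(i <- r) F i t).
Proof.
move=> OF; elim: r => [|i r IH].
  by apply: isO_eq (isO0 k); near=> t; rewrite big_nil.
by apply: isO_eq (isOD (OF i) IH); near=> t; rewrite big_cons.
Unshelve. all: by end_near. Qed.

Lemma isO_exp k : isO k (fun t => t ^+ k).
Proof. by exists 1; near=> t; rewrite mul1r normrX.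
Unshelve. all: by end_near. Qed.

Lemma isO_cont g : {for 0, continuous g} -> isO 0 g.
Proof.
move=> /cvgrPdist_le /(_ 1 ltr01) H; exists (1 + `|g 0|); apply: filterS H => t H.
rewrite expr0 mulr1 -[g t](subrK (g 0)) (le_trans (ler_normD _ _)) //.
by rewrite lerD // distrC.
Qed.

Lemma isO_cst (c : R) : isO 0 (fun=> c).
Proof. by exists `|c|; near=> t; rewrite expr0 mulr1.
Unshelve. all: by end_near. Qed.

Lemma isO_le k l g : (k <= l)%N -> isO l g -> isO k g.
Proof.
move=> kl /isO_pos[C C0 CP]; exists C.
have H : \forall t \near (0 : R), `|t| <= 1.
  by apply/nbhs_ballP; exists 1 => /= [|t]; [exact: ltr01|]; rewrite /ball /= /ball_ sub0r normrN => /ltW.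
apply: filterS2 CP H => t gt t1; apply: le_trans gt _.
by rewrite ler_wpM2l // ler_wiXn2l.
Qed.

Lemma isO_near0 (P : R -> Prop) : (\forall t \near (0 : R), P t) ->
  exists2 d : R, 0 < d & forall t, `|t| < d -> P t.
Proof.
move=> /nbhs_ballP[d d0 dP]; exists d => // t td; apply: dP.
by rewrite /ball /= /ball_ sub0r normrN.
Qed.

(** The mean value theorem takes the place of integration: [g t] is [t] times a value of [dg] at a
    point no farther from 0 than [t]. *)
Lemma isO_int k g (dg : R -> R) :
  (\forall t \near (0 : R), is_derive t (1 : R) g (dg t)) -> g 0 = 0 ->
  isO k dg -> isO k.+1 g.
Proof.
move=> Dg g0 /isO_pos[C C0 CP].
have [d d0 dP] := isO_near0 (filterI Dg CP).
exists C; apply/nbhs_ballP; exists d => // t; rewrite /ball /= /ball_ sub0r normrN => td.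
have [s st|c ct E] := @centered_MVT R g dg t.
  by have [] := dP s (le_lt_trans st td).
move: E; rewrite g0 subr0 => ->; rewrite normrM exprS mulrCA ler_wpM2l //.
have [_] := dP c (le_lt_trans ct td); move=> /le_trans; apply.
by rewrite ler_wpM2l // lerXn2r ?nnegrE.
Qed.

(** Division by [t ^ k] leaves [|a| <= C * |t|] for all small nonzero [t]. *)
Lemma isO_monomial k (a : R) : isO k.+1 (fun t => a * t ^+ k) -> a = 0.
Proof.
move=> /isO_pos[C C0 CP]; have [d d0 dP] := isO_near0 CP.
apply/eqP; rewrite -normr_le0; apply/ler_addgt0Pr => e e0; rewrite add0r.
(* The first bound keeps [t] where the estimate holds, the second gives [C * t <= e]; the summand 1
   allows [C = 0]. *)
pose t := Num.min (d / 2) (e / (C + 1)).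
have t0 : 0 < t by rewrite lt_min !divr_gt0 // ltr_wpDl.
have td : t < d by rewrite gt_min; apply/orP; left; rewrite ltr_pdivrMr // ltr_pMr // ltr1n.
have := dP t; rewrite gtr0_norm // => /(_ td).
rewrite normrM normrX (gtr0_norm t0) exprS mulrA ler_pM2r ?exprn_gt0 // => /le_trans; apply.
have te : t <= e / (C + 1) by rewrite ge_min lexx orbT.
rewrite -(ler_pM2l (ltr_wpDl C0 ltr01)) in te.
rewrite mulrCA divff ?gt_eqF ?ltr_wpDl // mulr1 in te.
by move: te; rewrite mulrDl mul1r; apply: le_trans; rewrite lerDl ltW.
Qed.

(** The Taylor polynomial with derivatives [a j], cut after [K] terms: its degree is less than [K],
    and [jet a K.+1] is the polynomial of order [K]. *)
Definition jet (a : nat -> R) K (t : R) := \sum_(j < K) a j / j`!%:R * t ^+ j.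

Lemma jetS a K t : jet a K.+1 t = jet a K t + a K / K`!%:R * t ^+ K.
Proof. by rewrite /jet big_ord_recr. Qed.

Lemma jet_eq0 a K t : (forall j, (j < K)%N -> a j = 0) -> jet a K t = 0.
Proof. by move=> a0; rewrite /jet big1 // => i _; rewrite a0 // !mul0r. Qed.

Lemma jet0 a K : jet a K.+1 0 = a 0%N.
Proof.
rewrite /jet big_ord_recl /= fact0 divr1 expr0 mulr1 big1 ?addr0 // => i _.
by rewrite expr0n mulr0.
Qed.

Lemma jet_derive a K t : is_derive t (1 : R) (jet a K.+1) (jet (a \o succn) K t).
Proof.
elim: K => [|K IH].
  rewrite (_ : jet a 1 = fun=> a 0%N); last first.
    by apply/funext => s; rewrite /jet big_ord1 fact0 divr1 expr0 mulr1.
  by rewrite /jet big_ord0; exact: is_derive_cst.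
rewrite (_ : jet a K.+2 = fun t => jet a K.+1 t + (a K.+1 / K.+1`!%:R) *: t ^+ K.+1); last first.
  by apply/funext => s; rewrite jetS.
rewrite jetS /=.
have H : is_derive t (1 : R) (fun t : R => (a K.+1 / K.+1`!%:R) *: t ^+ K.+1) ((a K.+1 / K.+1`!%:R) *: ((K.+1)%:R * t ^+ K)).
  apply: is_deriveZ.
  apply: DeriveDef; first exact: exprn_derivable.
  by rewrite exp_derive /GRing.scale /= mulr1.
suff -> : a K.+1 / K`!%:R * t ^+ K = (a K.+1 / K.+1`!%:R) *: ((K.+1)%:R * t ^+ K).
  exact: is_deriveD.
rewrite /GRing.scale /= mulrA; congr (_ * _).
by rewrite factS natrM invfM -mulrA (mulrC K.+1%:R^-1) -mulrA mulVf ?mulr1 // pnatr_eq0.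
Qed.

Lemma isO_jet_tail a k K : (k <= K)%N -> isO k (fun t => jet a K t - jet a k t).
Proof.
elim: K => [|K IH].
  by rewrite leqn0 => /eqP ->; apply: isO_eq (isO0 0); near=> t; rewrite subrr.
rewrite leq_eqVlt => /predU1P[->|].
  by apply: isO_eq (isO0 _); near=> t; rewrite subrr.
rewrite ltnS => kK.
have H : isO K (fun t => a K / K`!%:R * t ^+ K).
  exact: isOM (isO_cst _) (isO_exp K).
by apply: isO_eq (isOD (IH kK) (isO_le kK H)); near=> t; rewrite jetS addrAC.
Unshelve. all: by end_near. Qed.

End PowerOrder.

(** * Curves following a vector field to finite order, and their correction onto a hypersurface *)

Section FieldCurve.
Context {R : realType} {N : nat}.
Local Notation T := 'rV[R]_N.
Implicit Types (f : T -> R) (x v p : T) (X : T -> T).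

Definition rder X f : T -> R := fun y => \sum_i X y 0 i * 'D_(ebasis i) f y.

Lemma rsm_rder p X f : (forall i, rsm p (fun y => X y 0 i)) -> rsm p f ->
  rsm p (rder X f).
Proof. by move=> sX sf; apply: rsm_sum => i; apply: rsmM => //; exact: rsm_D. Qed.

Lemma curve_cont (ga : R -> T) (dga : R -> 'I_N -> R) t :
  (forall i, is_derive t (1 : R) (fun s => ga s 0 i) (dga t i)) -> {for t, continuous ga}.
Proof.
move=> dg; apply/differentiable_continuous/derivable1_diffP.
by apply/derivable_mxP => i j; rewrite ord1; have [] := dg j.
Qed.

(* Agreement to finite order replaces integral curves, whose existence would need
   the theory of ordinary differential equations. *)
Definition approx_flow (p : T) X k (ga : R -> T) (dga : R -> 'I_N -> R) :=
  [/\ ga 0 = p,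
      forall t i, is_derive t (1 : R) (fun s => ga s 0 i) (dga t i) &
      forall i, isO k (fun t => dga t i - X (ga t) 0 i)].

Lemma comp_cont p f (ga : R -> T) : ga 0 = p -> {for 0, continuous ga} -> rsm p f ->
  {for 0, continuous (f \o ga)}.
Proof.
move=> g0 cg sf; apply: continuous_comp; first exact: cg.
by rewrite g0; exact: rsm_cont.
Qed.

(** The derivative of [f] along the curve is [X f] along the curve plus an error [err f] of order
    [k]. Induction on [l], with [f] replaced by [X f], expands this derivative, and [isO_int] gains
    one order. *)
Lemma flow_expansion p X k ga dga f l : (forall i, rsm p (fun y => X y 0 i)) ->
  approx_flow p X k ga dga -> rsm p f -> (l <= k)%N ->
  isO l.+1 (fun t => f (ga t) - jet (fun j => iter j (rder X) f p) l.+1 t).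
Proof.
move=> sX [g0 dg Ok] sf.
have cg : {for 0, continuous ga} by exact: curve_cont (dg 0).
pose err f t := \sum_i (dga t i - X (ga t) 0 i) * 'D_(ebasis i) f (ga t).
have Oerr h : rsm p h -> isO k (err h).
  move=> sh; apply: isO_sum => i; rewrite -[k]addn0; apply: isOM; first exact: Ok.
  exact: (isO_cont (comp_cont g0 cg (rsm_D i sh))).
have dfg h : rsm p h ->
    \forall t \near (0 : R), is_derive t (1 : R) (h \o ga) (rder X h (ga t) + err h t).
  move=> sh.
  have H : \forall t \near (0 : R), rsm (ga t) h.
    have H' : \forall y \near ga 0, rsm y h by rewrite g0; exact: rsm_near.
    exact: (cg _ H').
  apply: filterS H => t sht.
  rewrite /rder /err -big_split /=.
  rewrite (eq_bigr (fun i => dga t i * 'D_(ebasis i) h (ga t))); last first.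
    by move=> i _; ring.
  exact: curve_derive.
elim: l f sf => [|l IH] f sf lk.
  apply: (@isO_int _ 0 _ (fun t => rder X f (ga t) + err f t)).
  - apply: filterS (dfg _ sf) => t H.
    rewrite (_ : (fun _ => _) = (f \o ga) - cst (f p)); last first.
      by apply/funext => s; rewrite /jet big_ord1 fact0 divr1 expr0 mulr1.
    rewrite -[rder X f _ + _]subr0; exact: is_deriveB.
  - by rewrite jet0 g0 subrr.
  - apply: isOD; last by apply: isO_le (Oerr _ sf).
    exact: (isO_cont (comp_cont g0 cg (rsm_rder sX sf))).
apply: (@isO_int _ l.+1 _ (fun t => (rder X f (ga t) - jet (fun j => iter j (rder X) (rder X f) p) l.+1 t) + err f t)).
- apply: filterS (dfg _ sf) => t H.
  rewrite addrAC; apply: is_deriveB.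
  have := jet_derive (fun j => iter j (rder X) f p) l.+1 t.
  rewrite (_ : (_ \o succn) = (fun j => iter j (rder X) (rder X f) p)) //.
  by apply/funext => j; rewrite /= -iterS iterSr.
- by rewrite jet0 g0 subrr.
- apply: isOD; last by apply: isO_le (Oerr _ sf).
  by apply: IH; [exact: rsm_rder|exact: ltnW].
Qed.

Lemma derive_coord (x : T) i j : 'D_(ebasis i) (fun y : T => y 0 j) x = (j == i)%:R.
Proof.
rewrite /derive; apply: cvg_lim => //.
apply: (@cvg_trans _ ((fun=> (j == i)%:R : R) @ (0 : R)^')); last exact: cvg_cst.
apply: near_eq_cvg; near=> h.
rewrite /= !mxE eqxx /= addrK /GRing.scale /= mulKf //.
by near: h; exact: nbhs_dnbhs_neq.
Unshelve. all: by end_near. Qed.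

Lemma rder_coord X i : rder X (fun y : T => y 0 i) = fun y => X y 0 i.
Proof.
apply/funext => y; rewrite /rder (bigD1 i) //= derive_coord eqxx mulr1.
rewrite big1 ?addr0 // => j ji.
by rewrite derive_coord eq_sym (negbTE ji) mulr0.
Qed.

(** The coordinates of the curve are the Taylor polynomials that an integral curve would have, with
    coefficients the iterated derivatives [X^j x_i] at [p]. The order of agreement is bootstrapped:
    agreement to order [k] determines the expansion of [X] along the curve through order [k], and
    this matches the velocity of the curve up to order [k.+1]. *)
Lemma approx_flow_exists p X K : (forall i, rsm p (fun y => X y 0 i)) ->
  exists ga dga, approx_flow p X K ga dga.
Proof.
move=> sX.
pose a (i : 'I_N) j := iter j (rder X) (fun y : T => y 0 i) p.
pose ga t : T := \row_i jet (a i) K.+1 t.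
pose dga t i := jet (a i \o succn) K t.
exists ga, dga.
have g0 : ga 0 = p by apply/rowP => i; rewrite mxE jet0.
have dg t i : is_derive t (1 : R) (fun s => ga s 0 i) (dga t i).
  rewrite (_ : (fun s => _) = jet (a i) K.+1); first exact: jet_derive.
  by apply/funext => s; rewrite mxE.
have cg : {for 0, continuous ga} by exact: curve_cont (dg 0).
suff H k : (k <= K)%N -> approx_flow p X k ga dga by exact: H.
elim: k => [_|k IH kK].
  split=> // i; apply: isOB; last exact: (isO_cont (comp_cont g0 cg (sX i))).
  rewrite /dga; case: (K) => [|K'].
    by apply: isO_eq (isO0 _); near=> t; rewrite /jet big_ord0.
  apply: isO_cont; apply/differentiable_continuous/derivable1_diffP.
  by have [] := jet_derive (a i \o succn) K' 0.
split=> // i.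
have := flow_expansion sX (IH (ltnW kK)) (sX i) (leqnn k).
rewrite (_ : (fun j => _) = (a i \o succn)); last first.
  by apply/funext => j; rewrite /a /= -iterS iterSr rder_coord.
move=> H; apply: isO_eq (isOB (isO_jet_tail (a i \o succn) kK) H).
near=> t; rewrite /dga; ring.
Unshelve. all: by end_near. Qed.

(** A quantitative form of the implicit function theorem. Near [p] the derivative along [ebasis j]
    is at least half its value at [p], so a displacement proportional to [|rho z|] reaches both
    signs of [rho], and the intermediate value theorem gives a zero. *)
Lemma near_zero p rho j : rsm p rho -> 'D_(ebasis j) rho p != 0 -> rho p = 0 ->
  exists2 C : R, 0 <= C & \forall z \near p, exists2 s : R,
    `|s| <= C * `|rho z| & rho (z + s *: ebasis j) = 0.
Proof.
wlog Dp : rho / 0 < 'D_(ebasis j) rho p.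
  move=> wl sr; rewrite neq_lt => /orP[Dn|Dp] r0; last by apply: wl; rewrite // gt_eqF.
  have DN z : rsm z rho -> 'D_(ebasis j) (fun y => - rho y) z = - 'D_(ebasis j) rho z.
    by move=> sz; rewrite deriveN //; exact: rsm_derivable.
  have [||||C C0 CP] := wl (fun y => - rho y).
  - by rewrite DN // oppr_gt0.
  - exact: rsmN.
  - by rewrite DN // oppr_eq0 lt_eqF.
  - by rewrite r0 oppr0.
  exists C => //; apply: filterS CP => z [s sz rz]; exists s; first by rewrite -[`|rho z|]normrN.
  by apply: oppr_inj; rewrite rz oppr0.
move=> sr _ r0.
set D := 'D_(ebasis j) rho p in Dp *.
pose de := D / 2.
have de0 : 0 < de by rewrite divr_gt0.
have H1 : \forall y \near p, de <= 'D_(ebasis j) rho y.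
  have /cvgrPdist_le /(_ _ de0) := rsm_cont (rsm_D j sr); apply: filterS => y.
  rewrite -/D ler_norml => /andP[_]; rewrite lerBlDr -lerBlDl; apply: le_trans.
  by rewrite /de; lra.
have [r /= rp0 rP] := (iffLR (nbhs_ballP _ _)) (filterI (rsm_near sr) H1).
have nb : `|ebasis j : T| <= 1.
  apply: norm_le_coord => // l; rewrite !mxE eqxx /=.
  by case: (_ == _); rewrite ?normr1 ?normr0.
have {}rP z : `|z - p| < r -> rsm z rho /\ de <= 'D_(ebasis j) rho z.
  by move=> zr; apply: rP; rewrite -ball_normE /ball_ /= distrC.
exists de^-1; first by rewrite invr_ge0 ltW.
have r2 : 0 < r / 2 by rewrite divr_gt0.
have H2 : \forall z \near p, `|z - p| < r / 2.
  by apply/nbhs_ballP; exists (r / 2) => //= z; rewrite -ball_normE /ball_ /= distrC.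
have H3 : \forall z \near p, `|rho z| <= de * (r / 2).
  have d1 : 0 < de * (r / 2) by rewrite mulr_gt0.
  by have /cvgrPdist_le /(_ _ d1) := rsm_cont sr; apply: filterS => z; rewrite r0 sub0r normrN.
apply: filterS2 H2 H3 => z zp rz.
(* With slope at least [de], moving by [a] changes [rho] by at least [|rho z|], hence up to or past
   0. *)
set a := de^-1 * `|rho z|.
have a0 : 0 <= a by rewrite mulr_ge0 // invr_ge0 ltW.
have ar : a <= r / 2 by rewrite /a mulrC ler_pdivrMr // mulrC.
have inb s : `|s| <= a -> `|z + s *: ebasis j - p| < r.
  move=> sa; rewrite addrAC (le_lt_trans (ler_normD _ _)) // (splitr r) ltr_leD //.
  rewrite normrZ; apply: le_trans ar; apply: le_trans sa.
  by rewrite ler_piMr.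
have na : `|a| = a by rewrite ger0_norm.
have ade : a * de = `|rho z| by rewrite /a mulrAC mulVf ?mul1r // gt_eqF.
have up : 0 <= rho (z + a *: ebasis j).
  have [s sa|c ca E] := @line_MVT _ _ rho z (ebasis j) a.
    by apply: rsm_derivable; apply: (rP _ _).1; apply: inb; rewrite -na.
  rewrite na in ca; have [_ dc] := rP _ (inb c ca).
  have : a * de <= rho (z + a *: ebasis j) - rho z by rewrite E ler_wpM2l.
  by rewrite ade; have := ler_norm (- rho z); rewrite normrN; lra.
have dn : rho (z + (- a) *: ebasis j) <= 0.
  have [s sa|c ca E] := @line_MVT _ _ rho z (ebasis j) (- a).
    by apply: rsm_derivable; apply: (rP _ _).1; apply: inb; rewrite -na -(normrN a).
  rewrite normrN na in ca; have [_ dc] := rP _ (inb c ca).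
  have : rho (z + (- a) *: ebasis j) - rho z <= - (a * de).
    by rewrite E mulNr lerN2 ler_wpM2l.
  by rewrite ade; have := ler_norm (rho z); lra.
have cn : {within `[- a, a], continuous (fun s => rho (z + s *: ebasis j))}.
  apply: derivable_within_continuous => s; rewrite in_itv /= -ler_norml => sa.
  have [|//] := @line_derive _ _ rho z (ebasis j) s _.
  by apply: rsm_derivable; apply: (rP _ _).1; exact: inb.
have Na : - a <= a by rewrite (le_trans _ a0) // oppr_le0.
have [|s] := @IVT R (fun s => rho (z + s *: ebasis j)) (- a) a 0 Na cn.
  rewrite min_l ?max_r //; first by rewrite dn up.
  - exact: le_trans dn up.
  - exact: le_trans dn up.
by rewrite in_itv /= -ler_norml => sa rs; exists s.
Qed.

Lemma isO_cvg0 (g : R -> R) : isO 1 g -> g t @[t --> 0] --> (0 : R).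
Proof.
move=> /isO_pos[C C0 CP]; apply/cvgrPdist_le => e e0.
have H : \forall t \near (0 : R), `|t| <= e / (C + 1).
  apply/nbhs_ballP; exists (e / (C + 1)) => /=; first by rewrite divr_gt0 // ltr_wpDl.
  by move=> t; rewrite /ball /= /ball_ sub0r normrN => /ltW.
apply: filterS2 CP H => t; rewrite sub0r normrN expr1 => /le_trans le1 le2; apply: le1.
rewrite ler_pdivlMr ?ltr_wpDl // in le2; apply: le_trans le2.
by rewrite mulrC ler_wpM2l // lerDl.
Qed.

(* The approximate integral curve, corrected along [ebasis j], lies exactly on
   [rho = 0] without changing its jet: the correction is [O(rho)], and [rho] is
   [O(t^(K+1))] along the curve. *)
Lemma jet_curve p rho j X K : rsm p rho -> 'D_(ebasis j) rho p != 0 ->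
  (forall i, rsm p (fun y => X y 0 i)) ->
  (forall l, (l <= K)%N -> iter l (rder X) rho p = 0) ->
  exists y : R -> T, [/\ y t @[t --> 0] --> p,
    \forall t \near (0 : R), rho (y t) = 0 &
    forall f, rsm p f ->
      isO K.+1 (fun t => f (y t) - jet (fun l => iter l (rder X) f p) K.+1 t)].
Proof.
move=> sr Dr sX jr.
have [C C0 CP] := near_zero sr Dr (jr 0%N (leq0n _)).
have [ga [dga flow]] := approx_flow_exists K sX.
have [g0 dg _] := flow.
have cg : {for 0, continuous ga} by exact: curve_cont (dg 0).
have cg' : ga t @[t --> 0] --> p by rewrite -g0; exact: cg.
have Or : isO K.+1 (rho \o ga).
  apply: isO_eq (flow_expansion sX flow sr (leqnn K)); near=> t.
  by rewrite jet_eq0 ?subr0 // => i iK; exact: jr.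
pose P t : set R := [set s | `|s| <= C * `|rho (ga t)| /\ rho (ga t + s *: ebasis j) = 0].
pose s t := xget 0 (P t).
have sP : \forall t \near (0 : R), P t (s t).
  have H : \forall t \near (0 : R), exists2 s0 : R, `|s0| <= C * `|rho (ga t)| & rho (ga t + s0 *: ebasis j) = 0.
    exact: (cg' _ CP).
  apply: filterS H => t [s0 s1 s2].
  by rewrite /s; apply: (xgetI 0 (conj s1 s2)).
have Os : isO K.+1 s.
  have [D D0 DP] := isO_pos Or; exists (C * D).
  apply: filterS2 sP DP => t [st _] rt; apply: le_trans st _.
  by rewrite -mulrA ler_wpM2l.
have s0 : s t @[t --> 0] --> (0 : R) by apply: isO_cvg0; exact: isO_le Os.
exists (fun t => ga t + s t *: ebasis j); split.
- rewrite -[X in _ --> X]addr0 -(scale0r (ebasis j : T)).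
  by apply: cvgD => //; apply: cvgZr_tmp.
- by apply: filterS sP => t [].
move=> f sf.
suff H : isO K.+1 (fun t => f (ga t + s t *: ebasis j) - f (ga t)).
  apply: isO_eq (isOD H (flow_expansion sX flow sf (leqnn K))).
  by near=> t; rewrite addrA subrK.
(* A bound for the derivative of [f] along [ebasis j] near [p]: the correction [s t] changes [f] by
   at most [M * |s t|], so the expansion of [f] survives it. *)
pose M := `|'D_(ebasis j) f p| + 1.
have HM : \forall y \near p, `|'D_(ebasis j) f y| <= M.
  have /cvgrPdist_le /(_ _ ltr01) := rsm_cont (rsm_D j sf).
  apply: filterS => y; rewrite distrC => dy.
  rewrite -['D_(ebasis j) f y](subrK ('D_(ebasis j) f p)) /M addrC.
  by apply: le_trans (ler_normD _ _) _; rewrite lerD2l.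
have [r /= r0 rP] := (iffLR (nbhs_ballP _ _)) (filterI (rsm_near sf) HM).
have r2 : 0 < r / 2 by rewrite divr_gt0.
have /cvgrPdist_lt /(_ _ r2) h1 := cg'.
have /cvgrPdist_lt /(_ _ r2) h2 := s0.
have [D D0 DP] := isO_pos Os; exists (M * D).
apply: filterS3 h1 h2 DP => t gt st Dt.
rewrite sub0r normrN in st.
have inb c : `|c| <= `|s t| -> ball p r (ga t + c *: ebasis j).
  move=> cs; rewrite -ball_normE /ball_ /= opprD addrA.
  rewrite (le_lt_trans (ler_normB _ _)) // (splitr r) ltr_leD // normrZ.
  apply: le_trans (ltW st); apply: le_trans cs; rewrite ler_piMr //.
  apply: norm_le_coord => // l; rewrite !mxE eqxx /=.
  by case: (_ == _); rewrite ?normr1 ?normr0.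
have [c cs|c cs ->] := @line_MVT _ _ f (ga t) (ebasis j) (s t).
  by apply: rsm_derivable; have [] := rP _ (inb _ cs).
have [_ Mc] := rP _ (inb _ cs).
rewrite normrM mulrC -mulrA ler_pM //.
Unshelve. all: by end_near. Qed.

(** The constant field [v] annihilates [rho] at [p], so [jet_curve] with order 1 gives a curve in
    the hypersurface with velocity [v]. Along it [f] is zero, while its expansion starts with [t]
    times the derivative in question. *)
Lemma tangent_derivative_vanishing p rho j f (v : T) :
  rsm p rho -> 'D_(ebasis j) rho p != 0 -> rho p = 0 ->
  \sum_i v 0 i * 'D_(ebasis i) rho p = 0 -> rsm p f ->
  (\forall y \near p, rho y = 0 -> f y = 0) ->
  \sum_i v 0 i * 'D_(ebasis i) f p = 0.
Proof.
move=> sr Dr r0 tv sf f0.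
have [|y [yp ry yf]] := @jet_curve p rho j (fun=> v) 1 sr Dr (fun i => rsm_cst _ _).
  by case=> [|[|]].
have fp : f p = 0 by exact: (nbhs_singleton f0).
suff H : isO 2 (fun t => - (\sum_i v 0 i * 'D_(ebasis i) f p) * t ^+ 1).
  by have /eqP := isO_monomial H; rewrite oppr_eq0 => /eqP.
apply: isO_eq (yf f sf).
have := yp _ f0; move: ry; apply: filterS2 => t /= ry /(_ ry) ->.
rewrite 2!jetS jet_eq0 // add0r /= fp !mul0r !add0r.
by rewrite (_ : 1`! = 1%N) // divr1 /rder mulNr.
Qed.

(* Along the curve of [jet_curve], [u^2 <= ka = O(t^(2m+1))], so the coefficient of
   [t^m] in [u] is zero. *)
Lemma square_root_jet p rho j X (u ka : T -> R) m :
  rsm p rho -> 'D_(ebasis j) rho p != 0 ->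
  (forall i, rsm p (fun y => X y 0 i)) -> rsm p u -> rsm p ka ->
  (forall l, iter l (rder X) rho p = 0) ->
  (forall l, iter l (rder X) ka p = 0) ->
  (forall l, (l < m)%N -> iter l (rder X) u p = 0) ->
  (\forall y \near p, rho y = 0 -> u y ^+ 2 <= ka y) ->
  iter m (rder X) u p = 0.
Proof.
move=> sr Dr sX su ska jr jka ju uka.
have [y [yp ry yf]] := @jet_curve p rho j X (m + m) sr Dr sX (fun l _ => jr l).
have Oka : isO (m + m).+1 (ka \o y).
  apply: isO_eq (yf _ ska); near=> t.
  by rewrite jet_eq0 ?subr0 // => i iK; exact: jka.
have Ou2 : isO (m + m).+1 (fun t => u (y t) ^+ 2).
  have [C CP] := Oka; exists C.
  have := yp _ uka; move: ry CP; apply: filterS3 => t /= ry CP /(_ ry) le.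
  by rewrite ger0_norm ?sqr_ge0 // (le_trans le) // (le_trans (ler_norm _)).
pose b := iter m (rder X) u p / m`!%:R.
have Oub : isO m.+1 (fun t => u (y t) - b * t ^+ m).
  have H1 := isO_le (leq_addr m m.+1) (yf _ su).
  have H2 := isO_jet_tail (fun l => iter l (rder X) u p) (leq_addr m m.+1).
  apply: isO_eq (isOD H1 H2); near=> t.
  by rewrite /= addrA subrK jetS jet_eq0 // add0r.
have Obm : isO m (fun t => b * t ^+ m) by exact: isOM (isO_cst b) (isO_exp m).
have Ou : isO m (fun t => u (y t) + b * t ^+ m).
  apply: isO_eq (isOD (isO_le (leqnSn m) Oub) (isOD Obm Obm)); near=> t.
  by rewrite addrA subrK.
(* Difference of squares: [b^2 t^(2m)] is [u^2] minus the product of [u - b t^m], of order [m + 1],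
   and [u + b t^m], of order [m]. *)
have : isO (m + m).+1 (fun t => b ^+ 2 * t ^+ (m + m)).
  apply: isO_eq (isOB Ou2 (isOM Oub Ou)); near=> t; rewrite exprD; ring.
move/isO_monomial/eqP; rewrite expf_eq0 /= mulf_eq0 invr_eq0 pnatr_eq0.
by rewrite -leqn0 leqNgt fact_gt0 orbF => /eqP.
Unshelve. all: by end_near. Qed.

End FieldCurve.

(** * Complex vector fields *)

Section ComplexNumbers.
Context {R : realType}.
Implicit Types a b c : R[i].

Lemma cReD a b : complex.Re (a + b) = complex.Re a + complex.Re b.
Proof. by case: a b => [? ?] [? ?]. Qed.

Lemma cImD a b : complex.Im (a + b) = complex.Im a + complex.Im b.
Proof. by case: a b => [? ?] [? ?]. Qed.

Lemma cReN a : complex.Re (- a) = - complex.Re a.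
Proof. by case: a. Qed.

Lemma cImN a : complex.Im (- a) = - complex.Im a.
Proof. by case: a. Qed.

Lemma cReM a b : complex.Re (a * b) =
  complex.Re a * complex.Re b - complex.Im a * complex.Im b.
Proof. by case: a b => [? ?] [? ?]. Qed.

Lemma cImM a b : complex.Im (a * b) =
  complex.Re a * complex.Im b + complex.Im a * complex.Re b.
Proof. by case: a b => [? ?] [? ?]. Qed.

Lemma Re_conjc a : complex.Re (conjc a) = complex.Re a.
Proof. by case: a. Qed.

Lemma Im_conjc a : complex.Im (conjc a) = - complex.Im a.
Proof. by case: a. Qed.

Lemma cRe_sum (I : Type) (r : seq I) (F : I -> R[i]) :
  complex.Re (\sum_(i <- r) F i) = \sum_(i <- r) complex.Re (F i).
Proof. by elim: r => [|i r IH]; rewrite ?big_nil // !big_cons cReD IH. Qed.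

Lemma cIm_sum (I : Type) (r : seq I) (F : I -> R[i]) :
  complex.Im (\sum_(i <- r) F i) = \sum_(i <- r) complex.Im (F i).
Proof. by elim: r => [|i r IH]; rewrite ?big_nil // !big_cons cImD IH. Qed.

Lemma complex_ext a b :
  complex.Re a = complex.Re b -> complex.Im a = complex.Im b -> a = b.
Proof. by case: a b => [? ?] [? ?] /= -> ->. Qed.

Lemma cReV a : complex.Re (a^-1) =
  complex.Re a * (complex.Re a ^+ 2 + complex.Im a ^+ 2)^-1.
Proof. by case: a => x y. Qed.

Lemma cImV a : complex.Im (a^-1) =
  - complex.Im a * (complex.Re a ^+ 2 + complex.Im a ^+ 2)^-1.
Proof. by case: a => x y /=; rewrite mulNr. Qed.

Lemma sum_sqr_neq0 a : a != 0 -> complex.Re a ^+ 2 + complex.Im a ^+ 2 != 0.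
Proof.
case: a => x y; rewrite eq_complex /= negb_and paddr_eq0 ?sqr_ge0 //.
by rewrite !sqrf_eq0 negb_and.
Qed.

Lemma conjcD a b : conjc (a + b) = conjc a + conjc b.
Proof. exact: rmorphD. Qed.

Lemma conjcM a b : conjc (a * b) = conjc a * conjc b.
Proof. exact: rmorphM. Qed.

Lemma conjcN a : conjc (- a) = - conjc a.
Proof. exact: rmorphN. Qed.

Lemma conjc_sum (I : Type) (r : seq I) (F : I -> R[i]) :
  conjc (\sum_(i <- r) F i) = \sum_(i <- r) conjc (F i).
Proof. exact: rmorph_sum. Qed.

End ComplexNumbers.

(** * Calculus of complex-valued functions and complex vector fields *)

Section ComplexSmooth.
Context {R : realType} {N : nat}.
Local Notation T := 'rV[R]_N.
Local Notation V := 'rV[R[i]]_N.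
Implicit Types (x y : T) (f g h : T -> R[i]).

Definition csm x f :=
  rsm x (fun y => complex.Re (f y)) /\ rsm x (fun y => complex.Im (f y)).

Lemma csmP x f : csm x f <-> exists U, [/\ open U, U x & csmooth_on U f].
Proof.
split=> [[sr si]|[U [oU Ux [sr si]]]]; last by split; exists U.
by have [U [oU Ux cr ci]] := rsm_lift2 sr si; exists U.
Qed.

Lemma csm_near x f : csm x f -> \forall y \near x, csm y f.
Proof. by move=> [/rsm_near sr /rsm_near si]; apply: filterS2 sr si => y; split. Qed.

Lemma csm_eq x f g : (\forall y \near x, f y = g y) -> csm x f -> csm x g.
Proof.
move=> fg [sr si]; split; [apply: rsm_eq sr|apply: rsm_eq si];
by apply: filterS fg => y ->.
Qed.

Lemma csm_cst x (c : R[i]) : csm x (fun=> c).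
Proof. by split; exact: rsm_cst. Qed.

Lemma csm_real x (f : T -> R) : rsm x f -> csm x (fun y => real_complex R (f y)).
Proof. by move=> sf; split => //=; exact: rsm_cst. Qed.

Lemma csmD x f g : csm x f -> csm x g -> csm x (fun y => f y + g y).
Proof.
move=> [fr fi] [gr gi]; split.
  by apply: rsm_eq (rsmD fr gr); apply: filterE => y; rewrite cReD.
by apply: rsm_eq (rsmD fi gi); apply: filterE => y; rewrite cImD.
Qed.

Lemma csmN x f : csm x f -> csm x (fun y => - f y).
Proof.
move=> [fr fi]; split.
  by apply: rsm_eq (rsmN fr); apply: filterE => y; rewrite cReN.
by apply: rsm_eq (rsmN fi); apply: filterE => y; rewrite cImN.
Qed.

Lemma csmB x f g : csm x f -> csm x g -> csm x (fun y => f y - g y).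
Proof. by move=> sf sg; apply: csmD => //; exact: csmN. Qed.

Lemma csmM x f g : csm x f -> csm x g -> csm x (fun y => f y * g y).
Proof.
move=> [fr fi] [gr gi]; split.
  apply: rsm_eq (rsmB (rsmM fr gr) (rsmM fi gi)).
  by apply: filterE => y; rewrite cReM.
apply: rsm_eq (rsmD (rsmM fr gi) (rsmM fi gr)).
by apply: filterE => y; rewrite cImM.
Qed.

Lemma csm_conj x f : csm x f -> csm x (fun y => conjc (f y)).
Proof.
move=> [fr fi]; split.
  by apply: rsm_eq fr; apply: filterE => y; rewrite Re_conjc.
by apply: rsm_eq (rsmN fi); apply: filterE => y; rewrite Im_conjc.
Qed.

Lemma csm_sum x (I : Type) (r : seq I) (F : I -> T -> R[i]) :
  (forall i, csm x (F i)) -> csm x (fun y => \sum_(i <- r) F i y).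
Proof.
move=> sF; elim: r => [|i r IH].
  by apply: csm_eq (csm_cst x 0); apply: filterE => y; rewrite big_nil.
by apply: csm_eq (csmD (sF i) IH); apply: filterE => y; rewrite big_cons.
Qed.

Lemma csmV x f : csm x f -> f x != 0 -> csm x (fun y => (f y)^-1).
Proof.
move=> [fr fi] fx.
have sn : rsm x (fun y => (complex.Re (f y) ^+ 2 + complex.Im (f y) ^+ 2)^-1).
  apply: rsmV; last exact: sum_sqr_neq0.
  apply: rsm_eq (rsmD (rsmM fr fr) (rsmM fi fi)).
  by apply: filterE => y; rewrite !expr2.
split.
  by apply: rsm_eq (rsmM fr sn); apply: filterE => y; rewrite cReV.
by apply: rsm_eq (rsmM (rsmN fi) sn); apply: filterE => y; rewrite cImV.
Qed.

Lemma csm_near_neq0 x f : csm x f -> f x != 0 -> \forall y \near x, f y != 0.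
Proof.
move=> [fr fi] fx.
have sn : rsm x (fun y => complex.Re (f y) ^+ 2 + complex.Im (f y) ^+ 2).
  apply: rsm_eq (rsmD (rsmM fr fr) (rsmM fi fi)).
  by apply: filterE => y; rewrite !expr2.
have := rsm_near_neq0 sn (sum_sqr_neq0 fx); apply: filterS => y; apply: contra_neq.
by move=> ->; rewrite /= expr0n /= addr0.
Qed.

Lemma csm_cpartial x f j : csm x f -> csm x (cpartial j f).
Proof. by move=> [fr fi]; split; exact: rsm_D. Qed.

Lemma cpartial_eq x f g j : (\forall y \near x, f y = g y) ->
  cpartial j f x = cpartial j g x.
Proof.
move=> fg; rewrite /cpartial; congr Complex; apply: near_eq_derive;
by apply: filterS fg => y ->.
Qed.

Lemma cpartial_cst x (c : R[i]) j : cpartial j (fun=> c) x = 0.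
Proof.
apply: complex_ext => /=.
  exact: (derive_cst (complex.Re c)).
exact: (derive_cst (complex.Im c)).
Qed.

Lemma cpartialD x f g j : csm x f -> csm x g ->
  cpartial j (fun y => f y + g y) x = cpartial j f x + cpartial j g x.
Proof.
move=> [fr fi] [gr gi]; apply: complex_ext; rewrite ?cReD ?cImD /=.
  rewrite -deriveD; [|exact: rsm_derivable|exact: rsm_derivable].
  by apply: near_eq_derive; apply: filterE => y; rewrite cReD.
rewrite -deriveD; [|exact: rsm_derivable|exact: rsm_derivable].
by apply: near_eq_derive; apply: filterE => y; rewrite cImD.
Qed.

Lemma cpartialM x f g j : csm x f -> csm x g ->
  cpartial j (fun y => f y * g y) x = f x * cpartial j g x + g x * cpartial j f x.
Proof.
move=> [fr fi] [gr gi].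
have E (u v : T -> R) : rsm x u -> rsm x v ->
    is_derive x (ebasis j) (fun y => u y * v y) (u x * 'D_(ebasis j) v x + v x * 'D_(ebasis j) u x).
  move=> su sv; have du := derivableP (rsm_derivable (j := j) su).
  by have dv := derivableP (rsm_derivable (j := j) sv); exact: is_deriveM.
apply: complex_ext.
  rewrite /= (@near_eq_derive _ _ _ _ (fun y => complex.Re (f y) * complex.Re (g y) - complex.Im (f y) * complex.Im (g y))).
    have [_ ->] := is_deriveB (E _ _ fr gr) (E _ _ fi gi).
    by rewrite cReD !cReM /=; ring.
  by apply: filterE => y; rewrite cReM.
rewrite /= (@near_eq_derive _ _ _ _ (fun y => complex.Re (f y) * complex.Im (g y) + complex.Im (f y) * complex.Re (g y))).
  have [_ ->] := is_deriveD (E _ _ fr gi) (E _ _ fi gr).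
  by rewrite cImD !cImM /=; ring.
by apply: filterE => y; rewrite cImM.
Qed.

Lemma cpartialZ x (c : R[i]) f j : csm x f ->
  cpartial j (fun y => c * f y) x = c * cpartial j f x.
Proof. by move=> sf; rewrite cpartialM ?cpartial_cst ?mulr0 ?addr0 //; exact: csm_cst. Qed.

Lemma cpartialN x f j : csm x f -> cpartial j (fun y => - f y) x = - cpartial j f x.
Proof.
move=> sf; rewrite -mulN1r -cpartialZ //; apply: cpartial_eq.
by apply: filterE => y; rewrite mulN1r.
Qed.

Lemma cpartialB x f g j : csm x f -> csm x g ->
  cpartial j (fun y => f y - g y) x = cpartial j f x - cpartial j g x.
Proof. by move=> sf sg; rewrite cpartialD ?cpartialN //; exact: csmN. Qed.

Lemma cpartial_sum x (I : Type) (r : seq I) (F : I -> T -> R[i]) j :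
  (forall i, csm x (F i)) ->
  cpartial j (fun y => \sum_(i <- r) F i y) x = \sum_(i <- r) cpartial j (F i) x.
Proof.
move=> sF; elim: r => [|i r IH].
  rewrite big_nil (@cpartial_eq x _ (fun=> 0)) ?cpartial_cst //.
  by apply: filterE => y; rewrite big_nil.
rewrite big_cons -IH -cpartialD //; last exact: csm_sum.
by apply: cpartial_eq; apply: filterE => y; rewrite big_cons.
Qed.

Lemma cpartial_conj x f j : csm x f ->
  cpartial j (fun y => conjc (f y)) x = conjc (cpartial j f x).
Proof.
move=> [fr fi]; apply: complex_ext; rewrite ?Re_conjc ?Im_conjc /=.
  by apply: near_eq_derive; apply: filterE => y; rewrite Re_conjc.
rewrite -deriveN; last exact: rsm_derivable.
by apply: near_eq_derive; apply: filterE => y; rewrite Im_conjc.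
Qed.

Lemma cpartial_real x (f : T -> R) j :
  cpartial j (fun y => real_complex R (f y)) x = real_complex R ('D_(ebasis j) f x).
Proof. by apply: complex_ext => //=; exact: (derive_cst (0 : R)). Qed.

Lemma cpartialC x f i j : csm x f ->
  cpartial i (cpartial j f) x = cpartial j (cpartial i f) x.
Proof. by move=> [fr fi]; apply: complex_ext => /=; exact: rsm_schwarz. Qed.

Implicit Types L M H : T -> V.

Definition vsm x L := forall j, csm x (fun y => L y 0 j).

(** With [brk] below, the ambient counterpart of [vf_app] and [bracket]. No extension has to be
    chosen, so the usual calculus applies; [vf_app_ext] and [bracket_ext] carry the results over to
    S. *)
Definition der L f : T -> R[i] := fun y => \sum_j L y 0 j * cpartial j f y.

Definition brk L M : T -> V := fun y =>
  \row_j (der L (fun z => M z 0 j) y - der M (fun z => L z 0 j) y).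

Lemma vsm_near x L : vsm x L -> \forall y \near x, vsm y L.
Proof.
move=> sL; have H : \forall y \near x, forall j, csm y (fun z => L z 0 j).
  exact: (@filter_forall _ _ (fun j y => csm y (fun z => L z 0 j)) (nbhs x) _ (fun j => csm_near (sL j))).
exact: H.
Qed.

Lemma csm_der x L f : vsm x L -> csm x f -> csm x (der L f).
Proof. by move=> sL sf; apply: csm_sum => j; apply: csmM => //; exact: csm_cpartial. Qed.

Lemma vsm_brk x L M : vsm x L -> vsm x M -> vsm x (brk L M).
Proof.
move=> sL sM j.
apply: csm_eq (csmB (csm_der sL (sM j)) (csm_der sM (sL j))).
by apply: filterE => y; rewrite mxE.
Qed.

Lemma der_eq x L f g : (\forall y \near x, f y = g y) -> der L f x = der L g x.
Proof. by move=> fg; apply: eq_bigr => j _; congr (_ * _); exact: cpartial_eq. Qed.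

Lemma der_eq_near x L f g : (\forall y \near x, f y = g y) ->
  \forall y \near x, der L f y = der L g y.
Proof. by move/near_join => H; apply: filterS H => y; exact: der_eq. Qed.

Lemma derD x L f g : csm x f -> csm x g ->
  der L (fun y => f y + g y) x = der L f x + der L g x.
Proof.
move=> sf sg; rewrite /der -big_split /=; apply: eq_bigr => j _.
by rewrite cpartialD // mulrDr.
Qed.

Lemma derM x L f g : csm x f -> csm x g ->
  der L (fun y => f y * g y) x = f x * der L g x + g x * der L f x.
Proof.
move=> sf sg; rewrite /der !mulr_sumr -big_split /=; apply: eq_bigr => j _.
by rewrite cpartialM //; ring.
Qed.

Lemma der_cst x L (c : R[i]) : der L (fun=> c) x = 0.
Proof. by rewrite /der big1 // => j _; rewrite cpartial_cst mulr0. Qed.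

Lemma derZ x L (c : R[i]) f : csm x f -> der L (fun y => c * f y) x = c * der L f x.
Proof.
by move=> sf; rewrite derM ?der_cst ?mulr0 ?addr0 //; exact: csm_cst.
Qed.

Lemma derN x L f : csm x f -> der L (fun y => - f y) x = - der L f x.
Proof.
move=> sf; rewrite /der -sumrN; apply: eq_bigr => j _.
by rewrite cpartialN // mulrN.
Qed.

Lemma derB x L f g : csm x f -> csm x g ->
  der L (fun y => f y - g y) x = der L f x - der L g x.
Proof. by move=> sf sg; rewrite derD ?derN //; exact: csmN. Qed.

Lemma der_conj x L f : csm x f ->
  der L (fun y => conjc (f y)) x = conjc (der (fun y => map_mx conjc (L y)) f x).
Proof.
move=> sf; rewrite /der conjc_sum; apply: eq_bigr => j _.
by rewrite cpartial_conj // conjcM mxE conjcK.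
Qed.

Lemma der_addv x L M f : der (fun y => L y + M y) f x = der L f x + der M f x.
Proof. by rewrite /der -big_split /=; apply: eq_bigr => j _; rewrite mxE mulrDl. Qed.

Lemma der_scalev x (c : T -> R[i]) L f : der (fun y => c y *: L y) f x = c x * der L f x.
Proof. by rewrite /der mulr_sumr; apply: eq_bigr => j _; rewrite mxE mulrA. Qed.

Lemma der_sum x L (I : Type) (r : seq I) (F : I -> T -> R[i]) :
  (forall i, csm x (F i)) ->
  der L (fun y => \sum_(i <- r) F i y) x = \sum_(i <- r) der L (F i) x.
Proof.
move=> sF; rewrite /der exchange_big /=; apply: eq_bigr => j _.
by rewrite cpartial_sum // mulr_sumr.
Qed.

(** Expanding both compositions, the second-order terms agree by the symmetry of second derivatives,
    and the first-order terms are the components of the bracket. *)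
Lemma der_brk x L M f : vsm x L -> vsm x M -> csm x f ->
  der (brk L M) f x = der L (der M f) x - der M (der L f) x.
Proof.
have E A B : vsm x A -> vsm x B -> csm x f -> der A (der B f) x =
    \sum_j (der A (fun z => B z 0 j) x * cpartial j f x) +
    \sum_j \sum_i A x 0 i * B x 0 j * cpartial i (cpartial j f) x.
  move=> sA sB sf; rewrite [in LHS]/der.
  rewrite (eq_bigr (fun i => \sum_j A x 0 i * (cpartial j f x * cpartial i (fun z => B z 0 j) x + B x 0 j * cpartial i (cpartial j f) x))).
    rewrite exchange_big /= -big_split /=; apply: eq_bigr => j _.
    by rewrite /der mulr_suml -big_split /=; apply: eq_bigr => i _; ring.
  move=> i _; rewrite cpartial_sum; last by move=> j; apply: csmM; [exact: sB|exact: csm_cpartial].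
  rewrite mulr_sumr; apply: eq_bigr => j _.
  by rewrite cpartialM; [rewrite addrC|exact: sB|exact: csm_cpartial].
move=> sL sM sf; rewrite !E // opprD addrACA.
rewrite [X in _ + (X - _)]exchange_big /=.
rewrite [X in _ + X](_ : _ = 0) ?addr0.
  rewrite -sumrB; apply: eq_bigr => j _; by rewrite mxE mulrBl.
apply/eqP; rewrite subr_eq0; apply/eqP; apply: eq_bigr => i _; apply: eq_bigr => j _.
by rewrite cpartialC // [L x 0 i * _]mulrC.
Qed.

(** Componentwise, [der_brk] applied to the coefficients of the three fields turns the identity into
    a cancellation of compositions of derivations. *)
Lemma brk_jacobi x L M H : vsm x L -> vsm x M -> vsm x H ->
  brk (brk L M) H x = brk L (brk M H) x - brk M (brk L H) x.
Proof.
move=> sL sM sH; apply/rowP => j; rewrite !mxE.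
have E A B K : vsm x A -> vsm x B -> vsm x K ->
    der K (fun z => brk A B z 0 j) x =
    der K (der A (fun z => B z 0 j)) x - der K (der B (fun z => A z 0 j)) x.
  move=> sA sB sK.
  rewrite -derB; [|exact: csm_der|exact: csm_der].
  by apply: der_eq; apply: filterE => y; rewrite mxE.
rewrite (der_brk sL sM (sH j)) (der_brk sM sH (sL j)) (der_brk sL sH (sM j)).
rewrite (E L M H sL sM sH) (E M H L sM sH sL) (E L H M sL sH sM).
have C (a b c d e g : R[i]) : a - b - (c - d) = a - e - (g - d) - (b - g - (e - c)).
  by ring.
exact: C.
Qed.

End ComplexSmooth.

Lemma near_and {X : topologicalType} (x : X) (P Q : X -> Prop) :
  (\forall y \near x, P y) -> (\forall y \near x, Q y) ->
  \forall y \near x, P y /\ Q y.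
Proof. by move=> HP HQ; apply: filterS2 HP HQ. Qed.

(** * The Levi form of a hypersurface *)

Section HypersurfaceCalculus.
Context {R : realType} {n : nat}.
Local Notation T := 'rV[R]_(n + n).
Local Notation V := 'rV[R[i]]_(n + n).
Implicit Types (S U : set T) (x y p : T) (v w : V) (f g : T -> R[i]) (L M : T -> V).
Implicit Types (rho : T -> R).

Definition ddir f y v : R[i] := \sum_j v 0 j * cpartial j f y.

Lemma ddirE L f y : der L f y = ddir f y (L y).
Proof. by []. Qed.

Lemma ddir_real rho y v :
  ddir (fun z => real_complex R (rho z)) y v =
  \sum_j v 0 j * real_complex R ('D_(ebasis j) rho y).
Proof. by apply: eq_bigr => j _; rewrite cpartial_real. Qed.

Lemma defining_rsm S U rho y : defining_function S U rho -> U y -> rsm y rho.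
Proof. by move=> [oU sr _ _] Uy; exists U. Qed.

Lemma defining_near S U rho y : defining_function S U rho -> U y ->
  \forall z \near y, U z.
Proof. by move=> [oU _ _ _] Uy; exact: open_nbhs_nbhs. Qed.

(** The complex form of [tangent_derivative_vanishing]. As [rho] is real, the real and imaginary
    parts of [v] are both tangent, and each is applied to both parts of [f]. *)
Lemma ddir_vanishing S U rho y f v : defining_function S U rho -> U y -> S y ->
  ddir (fun z => real_complex R (rho z)) y v = 0 ->
  csm y f -> (\forall z \near y, S z -> f z = 0) -> ddir f y v = 0.
Proof.
move=> D Uy Sy tv [fr fi] f0.
have sr := defining_rsm D Uy.
have [_ _ DS /(_ y Uy) [j Dj]] := D.
have ry : rho y = 0 by apply/DS.
move: tv; rewrite ddir_real => tv.
(* Here [c] is either the real or the imaginary part; four uses cover all combinations of a part of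
   [v] with a part of [f]. *)
have part (h : T -> R) (c : R[i] -> R) : (forall (a : R[i]) (b : R), c (a * real_complex R b) = c a * b) ->
    (forall (F : 'I_(n + n) -> R[i]), c (\sum_i F i) = \sum_i c (F i)) -> c 0 = 0 ->
    rsm y h -> (\forall z \near y, S z -> h z = 0) ->
    \sum_i c (v 0 i) * 'D_(ebasis i) h y = 0.
  move=> cM csum c0 sh h0.
  have := @tangent_derivative_vanishing R _ y rho j h (\row_i c (v 0 i)) sr Dj ry.
  rewrite (eq_bigr (fun i => c (v 0 i * real_complex R ('D_(ebasis i) rho y)))); last first.
    by move=> i _; rewrite mxE cM.
  rewrite -csum tv c0 => /(_ erefl sh).
  rewrite (eq_bigr (fun i => c (v 0 i) * 'D_(ebasis i) h y)); last by move=> i _; rewrite mxE.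
  apply; have := defining_near D Uy; apply: filterS2 h0 => z h0 Uz rz.
  by apply: h0; apply/DS.
have Re1 : forall (a : R[i]) (b : R), complex.Re (a * real_complex R b) = complex.Re a * b.
  by move=> a b; rewrite cReM /= mulr0 subr0.
have Im1 : forall (a : R[i]) (b : R), complex.Im (a * real_complex R b) = complex.Im a * b.
  by move=> a b; rewrite cImM /= mulr0 add0r.
have fr0 : \forall z \near y, S z -> complex.Re (f z) = 0 by apply: filterS f0 => z H /H ->.
have fi0 : \forall z \near y, S z -> complex.Im (f z) = 0 by apply: filterS f0 => z H /H ->.
have rr := part _ _ Re1 (fun F => cRe_sum _ _) erefl fr fr0.
have ri := part _ _ Re1 (fun F => cRe_sum _ _) erefl fi fi0.
have ir := part _ _ Im1 (fun F => cIm_sum _ _) erefl fr fr0.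
have ii := part _ _ Im1 (fun F => cIm_sum _ _) erefl fi fi0.
apply: complex_ext; rewrite /ddir ?cRe_sum ?cIm_sum /=.
  under eq_bigr do rewrite cReM /=.
  by rewrite sumrB rr ii subrr.
under eq_bigr do rewrite cImM /=.
by rewrite big_split /= ri ir addr0.
Qed.

(** [CT] asks for some defining function. Any other one vanishes on S, so its derivative along a
    vector tangent for the first is zero, and every choice gives the same space. *)
Lemma CTP S U rho y v : defining_function S U rho -> U y -> S y ->
  CT S y v <-> ddir (fun z => real_complex R (rho z)) y v = 0.
Proof.
move=> D Uy Sy; rewrite ddir_real; split=> [[U' [rho' [U'y D' tv]]]|tv]; last by exists U, rho.
rewrite -ddir_real; apply: (ddir_vanishing D' U'y Sy).
- by rewrite ddir_real.
- by apply: csm_real; exact: defining_rsm D Uy.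
- have := defining_near D Uy; apply: filterS => z Uz Sz.
  by have [_ _ DS _] := D; rewrite (iffLR (DS z Uz) Sz).
Qed.

Lemma ddir_CT S y f v : S y -> CT S y v -> csm y f ->
  (\forall z \near y, S z -> f z = 0) -> ddir f y v = 0.
Proof.
move=> Sy [U [rho [Uy D tv]]]; apply: (ddir_vanishing D Uy Sy).
by rewrite ddir_real.
Qed.

Definition eqS S x f g := \forall y \near x, S y -> f y = g y.

Definition tanS S x L := \forall y \near x, S y -> CT S y (L y).

Lemma ddir_eqS S y f g v : S y -> CT S y v -> csm y f -> csm y g -> eqS S y f g ->
  ddir f y v = ddir g y v.
Proof.
move=> Sy tv sf sg fg; apply/eqP; rewrite -subr_eq0; apply/eqP.
rewrite -sumrB -[RHS](@ddir_CT S y (fun z => f z - g z) v) //.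
- by apply: eq_bigr => j _; rewrite cpartialB // mulrBr.
- exact: csmB.
- by apply: filterS fg => z H /H ->; rewrite subrr.
Qed.

Lemma eqS_near S x f g : eqS S x f g -> \forall y \near x, eqS S y f g.
Proof. by move/near_join. Qed.

Lemma der_eqS S x L f g : tanS S x L -> csm x f -> csm x g -> eqS S x f g ->
  eqS S x (der L f) (der L g).
Proof.
move=> tL /csm_near sf /csm_near sg /eqS_near fg.
apply: filterS3 sf sg (near_and tL fg) => y sf sg [tL' fg'] Sy.
by rewrite !ddirE; apply: (ddir_eqS Sy) => //; exact: tL'.
Qed.

Lemma local_extensionP S x f g :
  local_extension S x f g <-> csm x g /\ eqS S x g f.
Proof.
split=> [[U [oU Ux sg gf]]|[/csmP[U [oU Ux [s1 s2]]] H]].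
  split; first by apply/csmP; exists U.
  by have := open_nbhs_nbhs (conj oU Ux); apply: filterS => y Uy Sy; exact: gf.
move: H; rewrite /eqS /prop_near1 nbhsE => -[W [oW Wx] WP].
exists (U `&` W); split=> //; first exact: openI.
  by split=> k; [apply: Ck_on_sub (s1 k)|apply: Ck_on_sub (s2 k)] => y [].
by move=> y Sy [_ Wy]; exact: WP.
Qed.

(** [dS] selects an extension by choice. Two extensions agree on S, hence have equal derivatives
    along tangent vectors, so any convenient [g] may be used. *)
Lemma vf_app_ext S L f g x : S x -> CT S x (L x) -> csm x g -> eqS S x f g ->
  vf_app S L f x = ddir g x (L x).
Proof.
move=> Sx tL sg fg; rewrite /vf_app /dS.
set h := xget _ _.
have [sh hf] : csm x h /\ eqS S x h f.
  apply/local_extensionP; apply: (@xgetI _ _ (local_extension S x f) g).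
  by apply/local_extensionP; split=> //; apply: filterS fg => z H /H ->.
apply: (ddir_eqS Sx) => //; apply: filterS2 hf fg => z H1 H2 Sz.
by rewrite H1 // H2.
Qed.

Lemma tanS_near S x L : tanS S x L -> \forall y \near x, tanS S y L.
Proof. by move/near_join. Qed.

(** [L rho] and [M rho] vanish on S, so their derivatives along the tangent fields [M] and [L]
    vanish there too, and the bracket annihilates [rho] on S. *)
Lemma tanS_brk S x L M : S x -> (exists U rho, U x /\ defining_function S U rho) ->
  vsm x L -> vsm x M -> tanS S x L -> tanS S x M -> tanS S x (brk L M).
Proof.
move=> Sx [U [rho [Ux D]]] sL sM tL tM.
pose r z := real_complex R (rho z).
have sr : csm x r by apply: csm_real; exact: defining_rsm D Ux.
have z0 K : vsm x K -> tanS S x K -> eqS S x (der K r) (fun=> 0).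
  move=> sK tK; apply: filterS2 (defining_near D Ux) tK => y Uy tK Sy.
  by rewrite ddirE; apply/(CTP _ D Uy Sy); exact: tK.
have L0 := der_eqS tM (csm_der sL sr) (csm_cst x 0) (z0 L sL tL).
have M0 := der_eqS tL (csm_der sM sr) (csm_cst x 0) (z0 M sM tM).
have H := near_and (vsm_near sL) (near_and (vsm_near sM) (near_and (csm_near sr) (defining_near D Ux))).
apply: filterS3 L0 M0 H => y L0 M0 [sL' [sM' [sr' Uy]]] Sy.
apply/(CTP _ D Uy Sy); rewrite -/r -ddirE der_brk // L0 // M0 //.
by rewrite !der_cst subrr.
Qed.

Definition veqS S x L M := \forall y \near x, S y -> L y = M y.

Lemma veqS_coord S x L M j : veqS S x L M -> eqS S x (fun y => L y 0 j) (fun y => M y 0 j).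
Proof. by apply: filterS => y H /H ->. Qed.

Lemma bracket_ext S x L M L' M' : S x -> vsm x L' -> vsm x M' ->
  tanS S x L' -> tanS S x M' -> veqS S x L L' -> veqS S x M M' ->
  veqS S x (bracket S L M) (brk L' M').
Proof.
move=> Sx sL sM tL tM LL MM.
have H1 := near_and (vsm_near sL) (vsm_near sM).
have H2 := near_and tL tM.
have H3 : \forall y \near x, veqS S y L L' /\ veqS S y M M'.
  exact: near_and (@near_join _ _ _ LL) (@near_join _ _ _ MM).
apply: filterS3 H1 H2 H3 => y [sL' sM'] [tL' tM'] [LL' MM'] Sy.
have Ly := nbhs_singleton LL' Sy; have My := nbhs_singleton MM' Sy.
apply/rowP => j; rewrite !mxE; congr (_ - _).
  rewrite (vf_app_ext Sy _ (sM' j) (veqS_coord j MM')) ?Ly //; exact: tL'.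
rewrite (vf_app_ext Sy _ (sL' j) (veqS_coord j LL')) ?My //; exact: tM'.
Qed.

(** Values of a section off S are arbitrary and each coefficient has its own extension; these are
    assembled into one smooth ambient germ, on which [der] and [brk] can be computed. *)
Lemma section_ext S (F : T -> set V) U L x : is_section S F U L -> open U -> U x -> S x ->
  exists L', [/\ vsm x L', veqS S x L L' &
    \forall y \near x, S y -> F y (L' y)].
Proof.
move=> sec oU Ux Sx; have [_ ext] := sec x Sx Ux.
have {}ext j : exists g, csm x g /\ eqS S x g (fun y => L y 0 j).
  by have [g /local_extensionP] := ext j; exists g.
pose g j := sval (cid (ext j)).
have gP j : csm x (g j) /\ eqS S x (g j) (fun y => L y 0 j) by exact: svalP (cid (ext j)).
pose L' y : V := \row_j g j y.
have LL : veqS S x L L'.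
  have H : \forall y \near x, forall j, S y -> g j y = L y 0 j.
    exact: (@filter_forall _ _ (fun j y => S y -> g j y = L y 0 j) (nbhs x) _ (fun j => (gP j).2)).
  by apply: filterS H => y H Sy; apply/rowP => j; rewrite mxE H.
exists L'; split=> //.
  by move=> j; apply: csm_eq (gP j).1; apply: filterE => y; rewrite mxE.
have HU := open_nbhs_nbhs (conj oU Ux).
by apply: filterS2 HU LL => y Uy LL' Sy; rewrite -LL' //; exact: (sec y Sy Uy).1.
Qed.

Lemma germ_section S (F : T -> set V) U L : U `<=` [set y | vsm y L] ->
  (forall y, S y -> U y -> F y (L y)) -> is_section S F U L.
Proof.
move=> sU FU y Sy Uy; split; first exact: FU.
move=> j; exists (fun z => L z 0 j); apply/local_extensionP; split; first exact: sU.
exact: filterE.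
Qed.

End HypersurfaceCalculus.

(** * Type decomposition, the form d'rho and its exterior derivative *)

Section LeviForm.
Context {R : realType} {n : nat}.
Local Notation T := 'rV[R]_(n + n).
Local Notation V := 'rV[R[i]]_(n + n).
Local Notation rc := (real_complex R).
Implicit Types (S U : set T) (x y p : T) (v w : V) (f g : T -> R[i]) (L M : T -> V).
Implicit Types (rho : T -> R) (xi : 'rV[R[i]]_n).

Lemma mulii : 'i%C * 'i%C = -1 :> R[i].
Proof. by rewrite -expr2 sqr_i. Qed.

Lemma conjc_i : conjc 'i%C = - 'i%C :> R[i].
Proof. by apply: complex_ext; rewrite ?cReN ?cImN /= ?oppr0. Qed.

Lemma two_neq0 : 2 != 0 :> R[i].
Proof. by rewrite pnatr_eq0. Qed.

Lemma conjc_2V : conjc (2^-1) = 2^-1 :> R[i].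
Proof. by rewrite conjc_inv conjc_nat. Qed.

(* The coefficients of [v] on the [d/dz_k]. *)
Definition comp10 v : 'rV[R[i]]_n :=
  \row_k (v 0 (lshift n k) + 'i%C * v 0 (rshift n k)).

Lemma dz_vec_l xi k : dz_vec xi 0 (lshift n k) = xi 0 k / 2.
Proof. by rewrite /dz_vec row_mxEl mxE mulrC. Qed.

Lemma dz_vec_r xi k : dz_vec xi 0 (rshift n k) = - ('i%C * xi 0 k / 2).
Proof. by rewrite /dz_vec row_mxEr !mxE; ring. Qed.

Lemma row_ext v w : (forall k, v 0 (lshift n k) = w 0 (lshift n k)) ->
  (forall k, v 0 (rshift n k) = w 0 (rshift n k)) -> v = w.
Proof.
move=> El Er; apply/rowP => j; case: (fintype.splitP j) => k kE.
  by have -> : j = lshift n k by exact: val_inj.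
by have -> : j = rshift n k by exact: val_inj.
Qed.

Lemma vconjE v j : vconj v 0 j = conjc (v 0 j).
Proof. by rewrite mxE. Qed.

Lemma vconjK v : vconj (vconj v) = v.
Proof. by apply/rowP => j; rewrite !vconjE conjcK. Qed.

Lemma vconjD v w : vconj (v + w) = vconj v + vconj w.
Proof. by apply/rowP => j; rewrite !(vconjE, mxE) conjcD. Qed.

Lemma vconjZ (a : R[i]) v : vconj (a *: v) = conjc a *: vconj v.
Proof. by apply/rowP => j; rewrite !(vconjE, mxE) conjcM. Qed.

Lemma vconjN v : vconj (- v) = - vconj v.
Proof. by apply/rowP => j; rewrite !(vconjE, mxE) conjcN. Qed.

Lemma comp10D v w : comp10 (v + w) = comp10 v + comp10 w.
Proof. by apply/rowP => k; rewrite !mxE; ring. Qed.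

Lemma comp10Z (a : R[i]) v : comp10 (a *: v) = a *: comp10 v.
Proof. by apply/rowP => k; rewrite !mxE; ring. Qed.

Lemma dz_vecD xi1 xi2 : dz_vec (xi1 + xi2) = dz_vec xi1 + dz_vec xi2.
Proof. by apply: row_ext => k; rewrite !(dz_vec_l, dz_vec_r, mxE) //; ring. Qed.

Lemma dz_vecZ (a : R[i]) xi : dz_vec (a *: xi) = a *: dz_vec xi.
Proof. by apply: row_ext => k; rewrite !(dz_vec_l, dz_vec_r, mxE) //; ring. Qed.

Lemma comp10_dz xi : comp10 (dz_vec xi) = xi.
Proof.
apply/rowP => k; rewrite !(dz_vec_l, dz_vec_r, mxE).
have h : 2 * 2^-1 = 1 :> R[i] by rewrite divff // two_neq0.
have i2 := mulii.
by ring: h i2.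
Qed.

Lemma comp10_conj_dz xi : comp10 (vconj (dz_vec xi)) = 0.
Proof.
apply/rowP => k; rewrite !(vconjE, dz_vec_l, dz_vec_r, mxE).
rewrite conjcN !conjcM conjc_i conjc_2V !mulNr opprK !mulrA mulii mulN1r.
by rewrite mulNr subrr.
Qed.

Lemma comp10_decomposition v :
  v = dz_vec (comp10 v) + vconj (dz_vec (comp10 (vconj v))).
Proof.
have h : 2 * 2^-1 = 1 :> R[i] by rewrite divff // two_neq0.
have i2 := mulii.
apply: row_ext => k; rewrite !(vconjE, dz_vec_l, dz_vec_r, mxE);
rewrite ?(conjcN, conjcM, conjcD, conjcK, conjc_i, conjc_2V).
  by ring: h i2.
by ring: h i2.
Qed.

Definition dzop k f : T -> R[i] := fun y =>
  (cpartial (lshift n k) f y - 'i%C * cpartial (rshift n k) f y) / 2.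

Lemma csm_dzop y k f : csm y f -> csm y (dzop k f).
Proof.
move=> sf; apply: csmM; last exact: csm_cst.
by apply: csmB; [|apply: csmM; first exact: csm_cst]; exact: csm_cpartial.
Qed.

Lemma cpartial_dzop y j k f : csm y f ->
  cpartial j (dzop k f) y =
  (cpartial j (cpartial (lshift n k) f) y - 'i%C * cpartial j (cpartial (rshift n k) f) y) / 2.
Proof.
move=> sf; have sl := csm_cpartial (lshift n k) sf; have sr := csm_cpartial (rshift n k) sf.
have si : csm y (fun z => 'i%C * cpartial (rshift n k) f z) by apply: csmM => //; exact: csm_cst.
rewrite cpartialM; [|exact: csmB|exact: csm_cst].
by rewrite cpartial_cst mulr0 add0r cpartialB // cpartialZ // mulrC.
Qed.

Lemma dzopC y k l f : csm y f -> dzop k (dzop l f) y = dzop l (dzop k f) y.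
Proof.
move=> sf; have E (a b : 'I_n) : dzop a (dzop b f) y =
    (cpartial (lshift n a) (dzop b f) y - 'i%C * cpartial (rshift n a) (dzop b f) y) / 2.
  by [].
rewrite !E !(cpartial_dzop _ _ sf).
rewrite (cpartialC (rshift n l) (rshift n k) sf) (cpartialC (lshift n l) (rshift n k) sf).
rewrite (cpartialC (rshift n l) (lshift n k) sf) (cpartialC (lshift n l) (lshift n k) sf).
have C (a b c d : R[i]) : (((a - 'i%C * b) / 2) - 'i%C * ((c - 'i%C * d) / 2)) / 2 =
    (((a - 'i%C * c) / 2) - 'i%C * ((b - 'i%C * d) / 2)) / 2 by ring.
exact: C.
Qed.

Lemma ddir_split f y v : ddir f y v =
  \sum_k (v 0 (lshift n k) * cpartial (lshift n k) f y +
          v 0 (rshift n k) * cpartial (rshift n k) f y).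
Proof. by rewrite /ddir big_split_ord /= big_split. Qed.

Lemma ddir_dz f y xi : ddir f y (dz_vec xi) = \sum_k xi 0 k * dzop k f y.
Proof.
rewrite ddir_split; apply: eq_bigr => k _; rewrite dz_vec_l dz_vec_r /dzop.
by ring.
Qed.

Lemma ddirD f y v w : ddir f y (v + w) = ddir f y v + ddir f y w.
Proof. by rewrite /ddir -big_split; apply: eq_bigr => j _; rewrite mxE mulrDl. Qed.

Lemma ddirZ f y (a : R[i]) v : ddir f y (a *: v) = a * ddir f y v.
Proof. by rewrite /ddir mulr_sumr; apply: eq_bigr => j _; rewrite mxE mulrA. Qed.

Definition dzr rho k : T -> R[i] := dzop k (fun z => rc (rho z)).

(* [th0] is d'rho, and [Om] is its exterior derivative (see [th0_brk]). *)
Definition th0 rho y v : R[i] := \sum_k comp10 v 0 k * dzr rho k y.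

Definition Om rho y v w : R[i] :=
  \sum_k (comp10 w 0 k * ddir (dzr rho k) y v - comp10 v 0 k * ddir (dzr rho k) y w).

Lemma csm_dzr y rho k : rsm y rho -> csm y (dzr rho k).
Proof. by move=> sr; apply: csm_dzop; exact: csm_real. Qed.

Lemma th0D rho y v w : th0 rho y (v + w) = th0 rho y v + th0 rho y w.
Proof.
by rewrite /th0 -big_split comp10D; apply: eq_bigr => k _; rewrite mxE mulrDl.
Qed.

Lemma th0Z rho y (a : R[i]) v : th0 rho y (a *: v) = a * th0 rho y v.
Proof.
by rewrite /th0 mulr_sumr comp10Z; apply: eq_bigr => k _; rewrite mxE mulrA.
Qed.

Lemma th0N rho y v : th0 rho y (- v) = - th0 rho y v.
Proof. by rewrite -scaleN1r th0Z mulN1r. Qed.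

Lemma th0_dz rho y xi : th0 rho y (dz_vec xi) = \sum_k xi 0 k * dzr rho k y.
Proof. by rewrite /th0 comp10_dz. Qed.

Lemma th0_conj_dz rho y xi : th0 rho y (vconj (dz_vec xi)) = 0.
Proof. by rewrite /th0 comp10_conj_dz big1 // => k _; rewrite mxE mul0r. Qed.

Lemma th0_comp10 rho y v : th0 rho y (dz_vec (comp10 v)) = th0 rho y v.
Proof. by rewrite th0_dz. Qed.

(** This is d rho = d'rho + d''rho; since [rho] is real, d''rho is the conjugate of d'rho on the
    conjugate vector. *)
Lemma drho_split rho y v :
  ddir (fun z => rc (rho z)) y v = th0 rho y v + conjc (th0 rho y (vconj v)).
Proof.
rewrite ddir_split /th0 conjc_sum -big_split /=; apply: eq_bigr => k _.
rewrite !mxE /dzr /dzop !cpartial_real.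
rewrite ?(conjcN, conjcM, conjcD, conjcK, conjc_i, conjc_2V, conjc_real).
have C (a b c d e t : R[i]) : e * e = -1 -> 2 * t = 1 ->
    a * c + b * d = (a + e * b) * ((c - e * d) * t) + (a + - e * b) * ((c - - e * d) * t).
  by move=> i2 h; ring: h i2.
by apply: C; [exact: mulii|rewrite divff // two_neq0].
Qed.

(** Cartan's formula for the exterior derivative of a 1-form, which justifies the definition of
    [Om]. *)
Lemma th0_brk rho y L M : rsm y rho -> vsm y L -> vsm y M ->
  th0 rho y (brk L M y) =
  der L (fun z => th0 rho z (M z)) y - der M (fun z => th0 rho z (L z)) y
  - Om rho y (L y) (M y).
Proof.
move=> sr.
have sc K k : vsm y K -> csm y (fun z => comp10 (K z) 0 k).
  move=> sK; apply: csm_eq (csmD (sK (lshift n k)) (csmM (csm_cst y 'i%C) (sK (rshift n k)))).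
  by apply: filterE => z; rewrite mxE.
have E K H : vsm y K -> vsm y H -> der K (fun z => th0 rho z (H z)) y =
    \sum_k (der K (fun z => comp10 (H z) 0 k) y * dzr rho k y + comp10 (H y) 0 k * ddir (dzr rho k) y (K y)).
  move=> sK sH; rewrite /th0 der_sum; last first.
    by move=> k; apply: csmM; [exact: sc|exact: csm_dzr].
  apply: eq_bigr => k _; rewrite derM; [|exact: sc|exact: csm_dzr].
  by rewrite addrC [in LHS]mulrC.
have B k K H : vsm y K -> vsm y H -> der K (fun z => comp10 (H z) 0 k) y =
    der K (fun z => H z 0 (lshift n k)) y + 'i%C * der K (fun z => H z 0 (rshift n k)) y.
  move=> sK sH; rewrite -derZ; last exact: sH.
  rewrite -derD; [|exact: sH|by apply: csmM; [exact: csm_cst|exact: sH]].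
  by apply: der_eq; apply: filterE => z; rewrite mxE.
move=> sL sM; rewrite !E // /th0 /Om -!sumrB; apply: eq_bigr => k _.
rewrite !B // !mxE; by ring.
Qed.

Lemma OmC rho y v w : Om rho y v w = - Om rho y w v.
Proof. by rewrite /Om -sumrN; apply: eq_bigr => k _; rewrite opprB. Qed.

Lemma OmDr rho y v w1 w2 : Om rho y v (w1 + w2) = Om rho y v w1 + Om rho y v w2.
Proof.
rewrite /Om -big_split /= comp10D; apply: eq_bigr => k _.
by rewrite ddirD mxE; ring.
Qed.

Lemma OmZr rho y (a : R[i]) v w : Om rho y v (a *: w) = a * Om rho y v w.
Proof.
rewrite /Om mulr_sumr comp10Z; apply: eq_bigr => k _.
by rewrite ddirZ mxE; ring.
Qed.

Lemma OmDl rho y v1 v2 w : Om rho y (v1 + v2) w = Om rho y v1 w + Om rho y v2 w.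
Proof. by rewrite OmC OmDr opprD -!(OmC _ _ _ w). Qed.

Lemma OmZl rho y (a : R[i]) v w : Om rho y (a *: v) w = a * Om rho y v w.
Proof. by rewrite OmC OmZr -mulrN -OmC. Qed.

Lemma Om_self rho y v : Om rho y v v = 0.
Proof. by rewrite /Om big1 // => k _; rewrite subrr. Qed.

(** The operators d/dz_k commute, so d d'rho has no component of type (2,0). *)
Lemma Om_dz rho y xi1 xi2 : rsm y rho -> Om rho y (dz_vec xi1) (dz_vec xi2) = 0.
Proof.
move=> sr; rewrite /Om !comp10_dz sumrB; apply/eqP; rewrite subr_eq0; apply/eqP.
under eq_bigr do rewrite ddir_dz mulr_sumr.
rewrite exchange_big /=; apply: eq_bigr => l _; rewrite ddir_dz mulr_sumr.
apply: eq_bigr => k _; rewrite /dzr dzopC; last exact: csm_real.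
by ring.
Qed.

(** The squared Hermitian length of d'rho; the vector [dbar] below is dual to d'rho for the standard
    Hermitian product. *)
Definition Qr rho y : R[i] := \sum_k dzr rho k y * conjc (dzr rho k y).

Definition dbar rho y : 'rV[R[i]]_n := \row_k conjc (dzr rho k y).

(* A purely imaginary tangent field with [th0 = 1]. *)
Definition Nr rho y : V :=
  (Qr rho y)^-1 *: (dz_vec (dbar rho y) - vconj (dz_vec (dbar rho y))).

Lemma Qr_conj rho y : conjc (Qr rho y) = Qr rho y.
Proof. by rewrite /Qr conjc_sum; apply: eq_bigr => k _; rewrite conjcM conjcK mulrC. Qed.

Lemma Nr_conj rho y : vconj (Nr rho y) = - Nr rho y.
Proof.
rewrite /Nr vconjZ conjc_inv Qr_conj vconjD vconjN vconjK -scalerN opprB.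
by rewrite addrC.
Qed.

Lemma th0_Nr rho y : Qr rho y != 0 -> th0 rho y (Nr rho y) = 1.
Proof.
move=> Q0; rewrite /Nr th0Z th0D th0N th0_conj_dz subr0 th0_dz.
rewrite (_ : \sum_k _ = Qr rho y) ?mulVf //.
by apply: eq_bigr => k _; rewrite mxE mulrC.
Qed.

Lemma sum_conj_eq0 (m : nat) (a : 'I_m -> R[i]) :
  \sum_k a k * conjc (a k) = 0 -> forall k, a k = 0.
Proof.
move=> /eqP; rewrite psumr_eq0; last by move=> k _; exact: mulcJ_ge0.
move=> /allP H k; have := H k (mem_index_enum k).
by rewrite mulf_eq0 conjc_eq0 orbb => /eqP.
Qed.

(** If d'rho were zero then so would be d rho, by [drho_split], against the definition of a defining
    function. *)
Lemma Qr_neq0 S U rho y : defining_function S U rho -> U y -> Qr rho y != 0.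
Proof.
move=> [_ _ _ Dr] Uy; have [j Dj] := Dr y Uy.
apply: contra_neq Dj => Q0; have d0 := sum_conj_eq0 Q0.
have := drho_split rho y (delta_mx 0 j).
rewrite /th0 !big1; [|by move=> k _; rewrite d0 mulr0|by move=> k _; rewrite d0 mulr0].
rewrite conjc0 addr0 ddir_real (bigD1 j) //= !mxE !eqxx mul1r big1 ?addr0.
  by move/complexI.
by move=> k kj; rewrite !mxE eqxx (negbTE kj) mul0r.
Qed.

Lemma CT_th0 S U rho y v : defining_function S U rho -> U y -> S y ->
  CT S y v <-> th0 rho y v + conjc (th0 rho y (vconj v)) = 0.
Proof. by move=> D Uy Sy; rewrite -drho_split; exact: (CTP _ D Uy Sy). Qed.

Lemma CT_dz S U rho y xi : defining_function S U rho -> U y -> S y ->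
  CT S y (dz_vec xi) <-> \sum_k xi 0 k * dzr rho k y = 0.
Proof.
by move=> D Uy Sy; rewrite (CT_th0 _ D Uy Sy) th0_conj_dz conjc0 addr0 th0_dz.
Qed.

Lemma H10_th0 S U rho y v : defining_function S U rho -> U y -> S y ->
  H10 S y v <-> (exists xi, v = dz_vec xi) /\ th0 rho y v = 0.
Proof.
move=> D Uy Sy; split=> [[tv [xi E]]|[[xi E] tv]].
  split; first by exists xi.
  by move: tv; rewrite E th0_dz; move/(CT_dz _ D Uy Sy).
split; last by exists xi.
by move: tv; rewrite E th0_dz => H; apply/(CT_dz _ D Uy Sy).
Qed.

Lemma H10_CT S y v : H10 S y v -> CT S y v.
Proof. by case. Qed.

Lemma CT_conj S y v : CT S y v -> CT S y (vconj v).
Proof.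
move=> [U [rho [Uy D tv]]]; exists U, rho; split=> //.
have := congr1 conjc tv; rewrite conjc0 conjc_sum => H; rewrite -[RHS]H.
apply: eq_bigr => j _.
by rewrite conjcM conjc_real vconjE.
Qed.

Lemma Nr_CT S U rho y : defining_function S U rho -> U y -> S y -> CT S y (Nr rho y).
Proof.
move=> D Uy Sy; apply/(CT_th0 _ D Uy Sy).
by rewrite Nr_conj th0N th0_Nr ?(Qr_neq0 D Uy) // conjcN conjc1 subrr.
Qed.

Lemma CT_add S y v w : S y -> CT S y v -> CT S y w -> CT S y (v + w).
Proof.
move=> Sy tv tw; have [U [rho [Uy D _]]] := tv.
move/(CTP _ D Uy Sy): tv => tv; move/(CTP _ D Uy Sy): tw => tw.
by apply/(CTP _ D Uy Sy); rewrite ddirD tv tw addr0.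
Qed.

End LeviForm.

(** * Contact forms, semidefiniteness of the Levi form and the Cauchy-Schwarz inequality *)

Section ContactForms.
Context {R : realType} {n : nat}.
Local Notation T := 'rV[R]_(n + n).
Local Notation V := 'rV[R[i]]_(n + n).
Local Notation rc := (real_complex R).
Implicit Types (S U W : set T) (x y p : T) (v w : V) (f g : T -> R[i]) (L M : T -> V).
Implicit Types (rho : T -> R) (xi : 'rV[R[i]]_n) (th : T -> 'cV[R[i]]_(n + n)).

(** Hermitian symmetry is not assumed: in the order of [R[i]], nonnegativity includes being real,
    and this forces [A], [D] real and [B'] conjugate to [B]. *)
Lemma hermitian_CS (A B B' D : R[i]) :
  (forall s t : R[i], 0 <= s * conjc s * A + s * conjc t * B + conjc s * t * B' + t * conjc t * D) ->
  B * conjc B <= A * D.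
Proof.
move=> H.
have HH s t : complex.Im (s * conjc s * A + s * conjc t * B + conjc s * t * B' + t * conjc t * D) = 0 /\
    0 <= complex.Re (s * conjc s * A + s * conjc t * B + conjc s * t * B' + t * conjc t * D).
  by have := H s t; rewrite lecE /= => /andP[/eqP].
case: A B B' D {H} HH => [a a'] [x y] [x' y'] [d d'] HH.
(* The vectors (1,0), (0,1), (1,1) and (1,i) yield the symmetry and the signs of the diagonal
   entries. *)
have [/= i1 r1] := HH 1 0; have [/= i2 r2] := HH 0 1.
have [/= i3 r3] := HH 1 1; have [/= i4 r4] := HH 1 'i%C.
have a'0 : a' = 0 by lra.
have d'0 : d' = 0 by lra.
have yy : y' = - y by lra.
have xx : x' = x by lra.
have m0 : 0 <= x ^+ 2 + y ^+ 2 by rewrite addr_ge0 ?sqr_ge0.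
(* The test vector [s = r], [t = - B] leaves a real quadratic polynomial in [r], in which [B] enters
   only through its squared modulus. *)
have Hr (r : R) : 0 <= r ^+ 2 * a - 2 * r * (x ^+ 2 + y ^+ 2) + (x ^+ 2 + y ^+ 2) * d.
  have [_ /=] := HH (Complex r 0) (Complex (- x) (- y)).
  rewrite a'0 d'0 yy xx => h; apply: (le_trans h); rewrite le_eqVlt.
  by apply/orP; left; apply/eqP; ring.
rewrite a'0 d'0 lecE /=; apply/andP; split; first by apply/eqP; ring.
rewrite !mulr0 subr0 mulrN opprK -!expr2.
move: m0 Hr; set m := x ^+ 2 + y ^+ 2 => m0 Hr.
have a0 : 0 <= a by lra.
have d0 : 0 <= d by lra.
(* If [a = 0], any [r] above [d / 2], such as [d + 1], contradicts [Hr] unless [m = 0]. *)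
have [ae|an] := eqVneq a 0.
  by have := Hr (d + 1); rewrite ae mulr0 mul0r; nra.
have ap : 0 < a by rewrite lt_def an.
(* The minimum of the quadratic polynomial is at [r = m / a]. *)
have := Hr (m / a).
have -> : (m / a) ^+ 2 * a - 2 * (m / a) * m + m * d = (m * (a * d - m)) / a.
  by field.
rewrite pmulr_lge0 ?invr_gt0 //.
have [->|mn] := eqVneq m 0; first by move=> _; rewrite mulr_ge0.
have mp : 0 < m by rewrite lt_def mn.
by rewrite pmulr_rge0 // subr_ge0.
Qed.

(** Orthogonal projection onto the kernel of d'rho for the standard Hermitian product: the component
    along [dbar] is removed. *)
Definition hproj rho y xi : 'rV[R[i]]_n :=
  xi - ((\sum_k xi 0 k * dzr rho k y) / Qr rho y) *: dbar rho y.

Lemma hproj_tan rho y xi : Qr rho y != 0 ->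
  \sum_k hproj rho y xi 0 k * dzr rho k y = 0.
Proof.
move=> Q0; rewrite /hproj; set a := _ / _.
under eq_bigr do rewrite !mxE mulrDl mulNr -mulrA.
rewrite sumrB -mulr_sumr [X in a * X](_ : _ = Qr rho y); last first.
  by apply: eq_bigr => k _; rewrite mulrC.
by rewrite /a mulfVK // subrr.
Qed.

Lemma hproj_id rho y xi : \sum_k xi 0 k * dzr rho k y = 0 -> hproj rho y xi = xi.
Proof. by move=> E; rewrite /hproj E mul0r scale0r subr0. Qed.

(** The kernels of d'rho and d'rho' coincide on S, since both are cut out by [CT]. The difference
    [u] of the projections lies in this kernel and is also a combination of the two dual vectors,
    which are orthogonal to it; so [u] is orthogonal to itself. *)
Lemma hproj_indep S U rho U' rho' y xi : defining_function S U rho -> U y ->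
  defining_function S U' rho' -> U' y -> S y -> hproj rho y xi = hproj rho' y xi.
Proof.
move=> D Uy D' U'y Sy.
pose u := hproj rho y xi - hproj rho' y xi.
have sw (eta : 'rV[R[i]]_n) : \sum_k eta 0 k * dzr rho k y = 0 <-> \sum_k eta 0 k * dzr rho' k y = 0.
  by rewrite -(CT_dz _ D Uy Sy) -(CT_dz _ D' U'y Sy).
have u1 : \sum_k u 0 k * dzr rho k y = 0.
  have lin (a b : 'rV[R[i]]_n) : \sum_k (a - b) 0 k * dzr rho k y =
      \sum_k a 0 k * dzr rho k y - \sum_k b 0 k * dzr rho k y.
    by rewrite -sumrB; apply: eq_bigr => k _; rewrite !mxE mulrDl mulNr.
  have h2 := iffRL (sw _) (hproj_tan xi (Qr_neq0 D' U'y)).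
  have h1 := hproj_tan xi (Qr_neq0 D Uy).
  apply: etrans (lin (hproj rho y xi) (hproj rho' y xi)) _.
  have sub0 (a b : R[i]) : a = 0 -> b = 0 -> a - b = 0 by move=> -> ->; rewrite subrr.
  exact: sub0 h1 h2.
have u2 := iffLR (sw u) u1.
have : \sum_k u 0 k * conjc (u 0 k) = 0.
  set a := (\sum_k xi 0 k * dzr rho k y) / Qr rho y.
  set b := (\sum_k xi 0 k * dzr rho' k y) / Qr rho' y.
  have E k : u 0 k = b * conjc (dzr rho' k y) - a * conjc (dzr rho k y).
    by rewrite /u /hproj -/a -/b !mxE; ring.
  under eq_bigr => k _ do rewrite {1}E mulrBl.
  rewrite sumrB.
  have F r (e : R[i]) : \sum_k u 0 k * dzr r k y = 0 ->
      \sum_k e * conjc (dzr r k y) * conjc (u 0 k) = 0.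
    move=> Z; under eq_bigr => k _ do rewrite -mulrA -conjcM [_ * u 0 k]mulrC.
    by rewrite -mulr_sumr -conjc_sum Z conjc0 mulr0.
  by rewrite !F // subrr.
move=> /sum_conj_eq0 u0; apply/eqP; rewrite -subr_eq0; apply/eqP/rowP => k.
by rewrite [RHS]mxE -(u0 k).
Qed.

(* The orthogonal projection onto the (1,0) space does not depend on the defining
   function, so these pointwise choices glue to a smooth global section. *)
Definition hsec S xi y : V := xget 0 [set w | exists U rho,
  [/\ U y, defining_function S U rho & w = dz_vec (hproj rho y xi)]].

Lemma hsecE S U rho y xi : defining_function S U rho -> U y -> S y ->
  hsec S xi y = dz_vec (hproj rho y xi).
Proof.
move=> D Uy Sy; rewrite /hsec.
case: xgetP => [w _ [U' [rho' [U'y D' ->]]]|/(_ (dz_vec (hproj rho y xi)))].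
  by rewrite (hproj_indep xi D' U'y D Uy Sy).
by case; exists U, rho.
Qed.

Lemma csm_Qr y rho : rsm y rho -> csm y (Qr rho).
Proof.
move=> sr; apply: csm_sum => k; apply: csmM; first exact: csm_dzr.
by apply: csm_conj; exact: csm_dzr.
Qed.

Lemma vsm_dz y (a : T -> 'rV[R[i]]_n) : (forall k, csm y (fun z => a z 0 k)) ->
  vsm y (fun z => dz_vec (a z)).
Proof.
move=> sa j; case: (fintype.splitP j) => k kE.
  have -> : j = lshift n k by exact: val_inj.
  apply: csm_eq (csmM (sa k) (csm_cst y 2^-1)); apply: filterE => z.
  by rewrite dz_vec_l.
have -> : j = rshift n k by exact: val_inj.
apply: csm_eq (csmN (csmM (csmM (csm_cst y 'i%C) (sa k)) (csm_cst y 2^-1))).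
by apply: filterE => z; rewrite dz_vec_r.
Qed.

Lemma vsm_conj y L : vsm y L -> vsm y (fun z => vconj (L z)).
Proof.
move=> sL j; apply: csm_eq (csm_conj (sL j)); apply: filterE => z.
by rewrite vconjE.
Qed.

Lemma vsm_scale y f L : csm y f -> vsm y L -> vsm y (fun z => f z *: L z).
Proof.
move=> sf sL j; apply: csm_eq (csmM sf (sL j)); apply: filterE => z.
by rewrite mxE.
Qed.

Lemma vsm_add y L M : vsm y L -> vsm y M -> vsm y (fun z => L z + M z).
Proof.
move=> sL sM j; apply: csm_eq (csmD (sL j) (sM j)); apply: filterE => z.
by rewrite mxE.
Qed.

Lemma csm_dbar y rho k : rsm y rho -> csm y (fun z => dbar rho z 0 k).
Proof.
move=> sr; apply: csm_eq (csm_conj (csm_dzr k sr)); apply: filterE => z.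
by rewrite mxE.
Qed.

Lemma vsm_hproj S U rho y xi : defining_function S U rho -> U y ->
  vsm y (fun z => dz_vec (hproj rho z xi)).
Proof.
move=> D Uy; have sr := defining_rsm D Uy; apply: vsm_dz => k.
have s1 : csm y (fun z => (\sum_k xi 0 k * dzr rho k z) / Qr rho z).
  apply: csmM; last by apply: csmV (csm_Qr sr) (Qr_neq0 D Uy).
  by apply: csm_sum => l; apply: csmM; [exact: csm_cst|exact: csm_dzr].
apply: csm_eq (csmB (csm_cst y (xi 0 k)) (csmM s1 (csm_dbar k sr))).
by apply: filterE => z; rewrite !mxE.
Qed.

Lemma hsec_section S xi : smooth_hypersurface S -> is_section S (H10 S) setT (hsec S xi).
Proof.
move=> HS x Sx _; have [U [rho [Ux D]]] := HS x Sx; split.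
  rewrite (hsecE xi D Ux Sx); apply/(H10_th0 _ D Ux Sx); split; first by exists (hproj rho x xi).
  by rewrite th0_dz hproj_tan // (Qr_neq0 D Ux).
move=> j; exists (fun z => dz_vec (hproj rho z xi) 0 j); apply/local_extensionP.
split; first exact: (vsm_hproj xi D Ux).
have := defining_near D Ux; apply: filterS => z Uz Sz.
by rewrite (hsecE xi D Uz Sz).
Qed.

(** Dual forms are specified only through their values on global sections. This makes every (1,0)
    vector the value of one, so the forms can be evaluated on single vectors. *)
Lemma hsec_id S y xi : smooth_hypersurface S -> S y -> H10 S y (dz_vec xi) ->
  hsec S xi y = dz_vec xi.
Proof.
move=> HS Sy; have [U [rho [Uy D]]] := HS y Sy.
move=> /(H10_th0 _ D Uy Sy) [_]; rewrite th0_dz => E.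
by rewrite (hsecE xi D Uy Sy) hproj_id.
Qed.

Lemma pairingD th y v w : pairing th y (v + w) = pairing th y v + pairing th y w.
Proof. by rewrite /pairing mulmxDl mxE. Qed.

Lemma pairingZ th y (a : R[i]) v : pairing th y (a *: v) = a * pairing th y v.
Proof. by rewrite /pairing -scalemxAl mxE. Qed.

(** Subtracting [th0 v] times [Nr] from [v] leaves a tangent vector whose (1,0) and (0,1) parts are
    both tangent, hence one in [CH], where the contact form vanishes. *)
Lemma contact_factor S U rho W th y v : defining_function S U rho -> U y -> S y ->
  contact_form_on S W th -> W y -> CT S y v ->
  pairing th y v = th0 rho y v * pairing th y (Nr rho y).
Proof.
move=> D Uy Sy [_ _ thCH] Wy tv.
have Q0 := Qr_neq0 D Uy.
pose w := v + (- th0 rho y v) *: Nr rho y.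
have w1 : th0 rho y w = 0 by rewrite /w th0D th0Z th0_Nr // mulr1 subrr.
have w2 : th0 rho y (vconj w) = 0.
  move/(CT_th0 _ D Uy Sy): tv => tv.
  rewrite /w vconjD vconjZ Nr_conj conjcN scaleNr scalerN opprK th0D th0Z th0_Nr // mulr1.
  by rewrite -[th0 rho y (vconj v)](conjcK) -conjcD addrC tv conjc0.
have wCH : CH S y w.
  exists (dz_vec (comp10 w)), (vconj (dz_vec (comp10 (vconj w)))); split.
  - apply/(H10_th0 _ D Uy Sy); split; first by exists (comp10 w).
    by rewrite th0_comp10.
  - exists (dz_vec (comp10 (vconj w))) => //.
    apply/(H10_th0 _ D Uy Sy); split; first by exists (comp10 (vconj w)).
    by rewrite th0_comp10.
  - exact: comp10_decomposition.
have := thCH y w Sy Wy wCH.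
rewrite /w pairingD pairingZ mulNr => /eqP; rewrite subr_eq0 => /eqP; exact.
Qed.

Lemma contact_neq0 S U rho W th y : defining_function S U rho -> U y -> S y ->
  contact_form_on S W th -> W y -> pairing th y (Nr rho y) != 0.
Proof.
move=> D Uy Sy C Wy; have [_ th_neq0 _] := C; have [v tv] := th_neq0 y Sy Wy.
by rewrite (contact_factor D Uy Sy C Wy tv) mulf_eq0 negb_or => /andP[].
Qed.

(** The product of [Nr] by i is a real tangent vector, on which the form takes an imaginary
    value. *)
Lemma contact_real S U rho W th y : defining_function S U rho -> U y -> S y ->
  purely_imaginary_on S W th -> W y -> complex.Im (pairing th y (Nr rho y)) = 0.
Proof.
move=> D Uy Sy P Wy.
pose w : T := map_mx (@complex.Re R) ('i%C *: Nr rho y).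
have E : map_mx rc w = 'i%C *: Nr rho y.
  apply/rowP => j; rewrite mxE [w _ _]mxE.
  have : vconj ('i%C *: Nr rho y) 0 j = ('i%C *: Nr rho y) 0 j.
    by rewrite vconjZ Nr_conj conjc_i scaleNr scalerN opprK.
  rewrite vconjE; case: (('i%C *: Nr rho y) 0 j) => a b [] /= H.
  by apply: complex_ext => //=; lra.
have tw : CT S y (map_mx rc w).
  rewrite E; apply/(CTP _ D Uy Sy); rewrite ddirZ.
  by move/(CTP _ D Uy Sy): (Nr_CT D Uy Sy) => ->; rewrite mulr0.
have := P y w Sy Wy tw; rewrite E pairingZ cReM /= mul0r mul1r sub0r.
by move/eqP; rewrite oppr_eq0 => /eqP.
Qed.

(** In Cartan's formula the functions [th0 L] and [th0 M] vanish on S and are differentiated along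
    tangent vectors, so only [Om] survives. *)
Lemma levi_Om S U rho W th y L M : defining_function S U rho -> U y -> S y ->
  contact_form_on S W th -> W y -> vsm y L -> vsm y M -> tanS S y L -> tanS S y M ->
  (\forall z \near y, S z -> th0 rho z (L z) = 0) ->
  (\forall z \near y, S z -> th0 rho z (M z) = 0) ->
  pairing th y (brk L M y) = - (pairing th y (Nr rho y) * Om rho y (L y) (M y)).
Proof.
move=> D Uy Sy C Wy sL sM tL tM zL zM.
have sr := defining_rsm D Uy.
have tB : tanS S y (brk L M) by apply: tanS_brk => //; exists U, rho.
rewrite (contact_factor D Uy Sy C Wy (nbhs_singleton tB Sy)).
have sth K : vsm y K -> csm y (fun z => th0 rho z (K z)).
  move=> sK; apply: csm_sum => k; apply: csmM; last exact: csm_dzr.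
  apply: csm_eq (csmD (sK (lshift n k)) (csmM (csm_cst y 'i%C) (sK (rshift n k)))).
  by apply: filterE => z; rewrite mxE.
rewrite th0_brk // !ddirE.
rewrite (ddir_CT Sy (nbhs_singleton tL Sy) (sth M sM) zM).
rewrite (ddir_CT Sy (nbhs_singleton tM Sy) (sth L sL) zL).
by rewrite subr0 sub0r mulNr mulrC.
Qed.

(** The contact form used is the local one supplied by pseudoconvexity. Its factor relative to [th0]
    is real by [contact_real] and nonzero; its sign is left open and may be recorded pointwise, as
    [Om_CS] is insensitive to it. *)
Lemma levi_semidefinite S U rho p : smooth_hypersurface S -> pseudoconvex S ->
  defining_function S U rho -> U p -> S p ->
  \forall y \near p, S y -> exists2 c : R, c != 0 &
    forall v, H10 S y v -> 0 <= rc c * Om rho y v (vconj v).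
Proof.
move=> HS PC D Up Sp; have [W [th [oW Wp C P pos]]] := PC p Sp.
have HW := open_nbhs_nbhs (conj oW Wp).
apply: filterS2 HW (defining_near D Up) => y Wy Uy Sy.
have cn := contact_neq0 D Uy Sy C Wy; have ci := contact_real D Uy Sy P Wy.
set c := pairing th y (Nr rho y) in cn ci.
have cr : c = rc (complex.Re c) by apply: complex_ext.
exists (- complex.Re c).
  by apply: contra_neq cn => /eqP; rewrite oppr_eq0 cr => /eqP /= ->.
move=> v Hv; have [_ [xi vE]] := Hv.
have hs := hsec_section xi HS.
have [L [sL LE FL]] := section_ext hs (openT) I Sy.
have vL : L y = v by rewrite -(nbhs_singleton LE Sy) hsec_id // -?vE.
have sLc := vsm_conj sL.
have tL : tanS S y L by apply: filterS FL => z H /H; exact: H10_CT.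
have tLc : tanS S y (fun z => vconj (L z)).
  by apply: filterS tL => z H /H; exact: CT_conj.
have LEc : veqS S y (fun z => vconj (hsec S xi z)) (fun z => vconj (L z)).
  by apply: filterS LE => z H /H ->.
have := pos setT (hsec S xi) openT hs y Sy Wy I.
rewrite (nbhs_singleton (bracket_ext Sy sL sLc tL tLc LE LEc) Sy).
have UN := defining_near D Uy.
rewrite (levi_Om D Uy Sy C Wy sL sLc tL tLc).
- by rewrite vL -/c rmorphN /= mulNr -cr.
- by apply: filterS2 UN FL => z Uz H Sz; have /(H10_th0 _ D Uz Sz)[] := H Sz.
- apply: filterS2 UN FL => z Uz H Sz; have /(H10_th0 _ D Uz Sz)[[eta ->] _] := H Sz.
  exact: th0_conj_dz.
Qed.

Lemma H10_lin S y (a b : R[i]) v w : (exists U rho, U y /\ defining_function S U rho) ->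
  S y -> H10 S y v -> H10 S y w -> H10 S y (a *: v + b *: w).
Proof.
move=> [U [rho [Uy D]]] Sy /(H10_th0 _ D Uy Sy)[[xi1 E1] t1] /(H10_th0 _ D Uy Sy)[[xi2 E2] t2].
apply/(H10_th0 _ D Uy Sy); split; last by rewrite th0D !th0Z t1 t2 !mulr0 addr0.
by exists (a *: xi1 + b *: xi2); rewrite dz_vecD !dz_vecZ E1 E2.
Qed.

(** [hermitian_CS] is applied to [c * Om], and both sides are then divided by [c ^ 2 > 0], which
    removes the unknown sign. *)
Lemma Om_CS S U rho y (c : R) v w : defining_function S U rho -> U y -> S y -> c != 0 ->
  (forall v, H10 S y v -> 0 <= rc c * Om rho y v (vconj v)) ->
  H10 S y v -> H10 S y w ->
  Om rho y v (vconj w) * conjc (Om rho y v (vconj w)) <=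
  Om rho y v (vconj v) * Om rho y w (vconj w).
Proof.
move=> D Uy Sy c0 pos Hv Hw.
have DE : exists U rho, U y /\ defining_function S U rho by exists U, rho.
have H := @hermitian_CS (rc c * Om rho y v (vconj v)) (rc c * Om rho y v (vconj w))
  (rc c * Om rho y w (vconj v)) (rc c * Om rho y w (vconj w)).
rewrite conjcM conjc_real in H.
have c2 : 0 < rc c * rc c by rewrite -rmorphM /= ltcR -expr2 exprn_even_gt0.
rewrite -(ler_pM2l c2) mulrACA [leRHS]mulrACA; apply: H => s t.
have := pos _ (H10_lin s t DE Sy Hv Hw).
rewrite vconjD !vconjZ !OmDl !OmDr !OmZl !OmZr => h; apply: (le_trans h).
by rewrite le_eqVlt; apply/orP; left; apply/eqP; ring.
Qed.

End ContactForms.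

(** * Flat functions *)

Section Flatness.
Context {R : realType} {n : nat}.
Local Notation T := 'rV[R]_(n + n).
Local Notation V := 'rV[R[i]]_(n + n).
Local Notation rc := (real_complex R).
Implicit Types (S U W : set T) (x y p : T) (v w : V) (f g : T -> R[i]) (X Y Z L M : T -> V).
Implicit Types (G : set (T -> V)) (s : seq (T -> V)).

(** Vanishing at [p] of all derivatives along words in [G] of length at most [k]. The recursion
    differentiates [f] first, which suits inductions using the product rule; [word] is the form
    suited to permuting letters. *)
Fixpoint vanishes G p k f : Prop :=
  f p = 0 /\ (if k is k'.+1 then forall Z, G Z -> vanishes G p k' (der Z f) else True).

Definition flat G p f := forall k, vanishes G p k f.

Definition word s f := foldr der f s.

Fixpoint all_in G s : Prop := if s is Z :: s' then G Z /\ all_in G s' else True.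

Lemma all_in_cat G s1 s2 : all_in G (s1 ++ s2) <-> all_in G s1 /\ all_in G s2.
Proof.
elim: s1 => [|Z s IH] /=; first by split=> [|[]].
by rewrite IH; split=> [[? []]|[[]]].
Qed.

Lemma all_in_nseq G k X : G X -> all_in G (nseq k X).
Proof. by move=> GX; elim: k. Qed.

Lemma vanishes_le G p k f : vanishes G p k.+1 f -> vanishes G p k f.
Proof.
elim: k f => [|k IH] f [f0 H]; split=> // Z GZ; exact: IH (H Z GZ).
Qed.

Lemma flat_val G p f : flat G p f -> f p = 0.
Proof. by move=> /(_ 0%N)[]. Qed.

Lemma flat_der G p f Z : flat G p f -> G Z -> flat G p (der Z f).
Proof. by move=> ff GZ k; have [_] := ff k.+1; exact. Qed.

Lemma word_flat G p f : (forall s, all_in G s -> word s f p = 0) -> flat G p f.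
Proof.
move=> H k; elim: k f H => [|k IH] f H; split; try by exact: (H [::]).
  by [].
move=> Z GZ; apply: IH => s Gs; have := H (rcons s Z).
rewrite /word foldr_rcons; apply.
by rewrite -cats1; apply/all_in_cat.
Qed.

Definition field_germs S p : set (T -> V) := [set Z | vsm p Z /\ tanS S p Z].

Section Germs.
Variables (S : set T) (p : T) (G : set (T -> V)).
Hypotheses (Sp : S p) (GS : G `<=` field_germs S p).

Lemma csm_word s f : all_in G s -> csm p f -> csm p (word s f).
Proof.
elim: s => [|Z s IH] //= [GZ Gs] sf; apply: csm_der; last exact: IH.
by have [] := GS GZ.
Qed.

Lemma word_eqS s f g : all_in G s -> csm p f -> csm p g -> eqS S p f g ->
  eqS S p (word s f) (word s g).
Proof.
elim: s => [|Z s IH] //= [GZ Gs] sf sg fg; have [sZ tZ] := GS GZ.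
apply: der_eqS => //; [exact: csm_word|exact: csm_word|exact: IH].
Qed.

(** The fields of [G] are tangent to S near [p], so equality on S persists under differentiation:
    flatness depends only on the restriction to S. *)
Lemma vanishes_eqS k f g : csm p f -> csm p g -> eqS S p f g ->
  vanishes G p k f -> vanishes G p k g.
Proof.
elim: k f g => [|k IH] f g sf sg fg [f0 H].
  by split=> //; rewrite -(nbhs_singleton fg Sp).
split; first by rewrite -(nbhs_singleton fg Sp).
move=> Z GZ; have [sZ tZ] := GS GZ.
by apply: IH (H Z GZ); [exact: csm_der|exact: csm_der|exact: der_eqS].
Qed.

Lemma flat_eqS f g : csm p f -> csm p g -> eqS S p f g -> flat G p f -> flat G p g.
Proof. by move=> sf sg fg ff k; exact: vanishes_eqS (ff k). Qed.

Lemma near_eqS f g : (\forall y \near p, f y = g y) -> eqS S p f g.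
Proof. by apply: filterS => y. Qed.

Lemma vanishesD k f g : csm p f -> csm p g -> vanishes G p k f -> vanishes G p k g ->
  vanishes G p k (fun y => f y + g y).
Proof.
elim: k f g => [|k IH] f g sf sg [f0 Hf] [g0 Hg].
  by split=> //; rewrite f0 g0 addr0.
split; first by rewrite f0 g0 addr0.
move=> Z GZ; have [sZ tZ] := GS GZ.
have sd h : csm p h -> csm p (der Z h) by move=> sh; exact: csm_der.
apply: vanishes_eqS (IH _ _ (sd f sf) (sd g sg) (Hf Z GZ) (Hg Z GZ)).
- by apply: csmD; exact: sd.
- by apply: sd; exact: csmD.
apply: near_eqS; apply: filterS2 (csm_near sf) (csm_near sg) => y sf' sg'.
by rewrite derD.
Qed.

Lemma flatD f g : csm p f -> csm p g -> flat G p f -> flat G p g ->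
  flat G p (fun y => f y + g y).
Proof. by move=> sf sg ff fg k; exact: vanishesD. Qed.

(** By the product rule every term keeps a derivative of [f] as a factor. Hence flat functions form
    an ideal in the smooth germs. *)
Lemma vanishesM k f g : csm p f -> csm p g -> vanishes G p k f ->
  vanishes G p k (fun y => f y * g y).
Proof.
elim: k f g => [|k IH] f g sf sg [f0 Hf].
  by split=> //; rewrite f0 mul0r.
have Hk : vanishes G p k f by apply: vanishes_le; split.
split; first by rewrite f0 mul0r.
move=> Z GZ; have [sZ tZ] := GS GZ.
have sd h : csm p h -> csm p (der Z h) by move=> sh; exact: csm_der.
have H1 := IH _ _ sf (sd g sg) Hk.
have H2 := IH _ _ (sd f sf) sg (Hf Z GZ).
apply: vanishes_eqS (vanishesD _ _ H1 H2); try by repeat (apply: csmD || apply: csmM || apply: sd).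
apply: near_eqS; apply: filterS2 (csm_near sf) (csm_near sg) => y sf' sg'.
by rewrite derM // [der Z f y * _]mulrC.
Qed.

Lemma flatM f g : csm p f -> csm p g -> flat G p f -> flat G p (fun y => f y * g y).
Proof. by move=> sf sg ff k; exact: vanishesM. Qed.

Lemma flatZ (c : R[i]) f : csm p f -> flat G p f -> flat G p (fun y => c * f y).
Proof.
move=> sf ff; have := flatM sf (csm_cst p c) ff.
apply: flat_eqS; [by apply: csmM => //; exact: csm_cst|by apply: csmM => //; exact: csm_cst|].
by apply: filterE => y _; rewrite mulrC.
Qed.

Lemma flatB f g : csm p f -> csm p g -> flat G p f -> flat G p g ->
  flat G p (fun y => f y - g y).
Proof.
move=> sf sg ff fg.
have := flatD sf (csmM (csm_cst p (-1)) sg) ff (flatZ (-1) sg fg).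
apply: flat_eqS.
- by apply: csmD => //; apply: csmM => //; exact: csm_cst.
- exact: csmB.
- by apply: filterE => y _; rewrite mulN1r.
Qed.

Lemma flat0 : flat G p (fun=> 0).
Proof.
move=> k; elim: k => [|k IH]; split=> // Z GZ; have [sZ tZ] := GS GZ.
apply: vanishes_eqS IH; [exact: csm_cst|by apply: csm_der => //; exact: csm_cst|].
by apply: filterE => y _; rewrite der_cst.
Qed.

Lemma flat_eqS0 f : csm p f -> eqS S p f (fun=> 0) -> flat G p f.
Proof.
move=> sf f0; apply: flat_eqS flat0 => //; first exact: csm_cst.
by apply: filterS f0 => y H /H ->.
Qed.

Lemma vanishes_conj k f : (forall Z, G Z -> G (fun y => vconj (Z y))) ->
  csm p f -> vanishes G p k f -> vanishes G p k (fun y => conjc (f y)).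
Proof.
move=> GC; elim: k f => [|k IH] f sf [f0 H].
  by split=> //; rewrite f0 conjc0.
split=> [|Z GZ]; first by rewrite f0 conjc0.
have [sZ tZ] := GS GZ; have [sZc tZc] := GS (GC _ GZ).
apply: vanishes_eqS (IH _ _ (H _ (GC _ GZ))).
- by apply: csm_conj; exact: csm_der.
- by apply: csm_der => //; exact: csm_conj.
- by apply: near_eqS; apply: filterS (csm_near sf) => y sf'; rewrite der_conj.
- exact: csm_der.
Qed.

Lemma flat_conj f : (forall Z, G Z -> G (fun y => vconj (Z y))) ->
  csm p f -> flat G p f -> flat G p (fun y => conjc (f y)).
Proof. by move=> GC sf ff k; exact: vanishes_conj. Qed.

Lemma word_cat s1 s2 f : word (s1 ++ s2) f = word s1 (word s2 f).
Proof. by rewrite /word foldr_cat. Qed.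

Lemma word_near s f g : all_in G s -> (\forall y \near p, f y = g y) ->
  \forall y \near p, word s f y = word s g y.
Proof. by elim: s => [|Z s IH] //= [GZ Gs] fg; apply: der_eq_near; exact: IH. Qed.

Lemma word_comb s f g (a : R[i]) : all_in G s -> csm p f -> csm p g ->
  \forall y \near p, word s (fun z => f z + a * g z) y = word s f y + a * word s g y.
Proof.
elim: s => [|Z s IH] /= Gs sf sg; first exact: filterE.
have [GZ Gs'] := Gs.
have H := der_eq_near Z (IH Gs' sf sg).
have s1 := csm_near (csm_word Gs' sf); have s2 := csm_near (csm_word Gs' sg).
apply: filterS3 H s1 s2 => y -> s1 s2.
by rewrite derD ?derZ //; apply: csmM => //; exact: csm_cst.
Qed.

End Germs.

(** * From pure powers of fields to arbitrary words *)

Section Polarization.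
Variables (S : set T) (p : T) (G : set (T -> V)) (u : T -> R[i]).
Hypotheses (Sp : S p) (GS : G `<=` field_germs S p) (su : csm p u).
Hypothesis G_brk : forall X Y, G X -> G Y -> G (brk X Y).
Hypothesis G_comb : forall X Y (t : R), G X -> G Y -> G (fun y => X y + rc t *: Y y).

Let W s := word s u p.

Lemma word_comb_field pre X Y (t : R) post : all_in G pre -> G X -> G Y -> all_in G post ->
  W (pre ++ (fun y => X y + rc t *: Y y) :: post) =
  W (pre ++ X :: post) + rc t * W (pre ++ Y :: post).
Proof.
move=> Gp GX GY Gq; rewrite /W !word_cat.
have [sX _] := GS GX; have [sY _] := GS GY.
have sq := csm_word GS Gq su.
have := word_comb GS (rc t) Gp (csm_der sX sq) (csm_der sY sq).
move=> /nbhs_singleton <- /=.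
congr (word pre _ p); apply/funext => y.
by rewrite der_addv der_scalev.
Qed.

(** The difference of the two words is the word in which [X] and [Y] are replaced by their bracket;
    it has length [m] and vanishes by assumption. *)
Lemma word_swap m pre X Y post : (forall s, size s = m -> all_in G s -> W s = 0) ->
  (size pre + size post).+1 = m ->
  all_in G pre -> G X -> G Y -> all_in G post ->
  W (pre ++ X :: Y :: post) = W (pre ++ Y :: X :: post).
Proof.
move=> IH sz Gp GX GY Gq; apply/eqP; rewrite -subr_eq0 -mulN1r; apply/eqP.
have [sX _] := GS GX; have [sY _] := GS GY.
have sq := csm_word GS Gq su.
have := word_comb GS (-1) Gp (csm_der sX (csm_der sY sq)) (csm_der sY (csm_der sX sq)).
move=> /nbhs_singleton; rewrite /W !word_cat /= => <-.
rewrite -(IH (pre ++ brk X Y :: post)); first last.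
- by apply/all_in_cat; split => //=; split => //; exact: G_brk.
- by rewrite size_cat /= addnS.
rewrite /W word_cat /=.
have H : \forall y \near p, der X (der Y (word post u)) y + -1 * der Y (der X (word post u)) y =
    der (brk X Y) (word post u) y.
  apply: filterS3 (vsm_near sX) (vsm_near sY) (csm_near sq) => y sX' sY' sq'.
  by rewrite der_brk // mulN1r.
exact: (nbhs_singleton (word_near Gp H)).
Qed.

Lemma word_move m pre k X Y post : (forall s, size s = m -> all_in G s -> W s = 0) ->
  (size pre + k + size post)%N = m ->
  all_in G pre -> G X -> G Y -> all_in G post ->
  W (pre ++ Y :: nseq k X ++ post) = W (pre ++ nseq k X ++ Y :: post).
Proof.
move=> IH; elim: k pre => [|k IHk] pre sz Gp GX GY Gq //=.
rewrite (word_swap IH) //; last 2 first.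
- by rewrite size_cat size_nseq -sz; lia.
- by apply/all_in_cat; split => //; exact: all_in_nseq.
have := IHk (pre ++ [:: X]); rewrite -!catA /=; apply=> //.
- by rewrite size_cat /= -sz; lia.
- by apply/all_in_cat.
Qed.

Lemma poly_vanishing (q : {poly R[i]}) : (forall t : R, q.[rc t] = 0) -> q = 0.
Proof.
move=> q0; apply/eqP; apply: contraT => qn0.
(* The numbers [0, ..., size q - 1] would be more distinct roots than a nonzero [q] can have. *)
have := @max_poly_roots _ q [seq rc k%:R | k <- iota 0 (size q)] qn0.
rewrite size_map size_iota ltnn; apply.
  by apply/allP => z /mapP[k _ ->]; apply/rootP; exact: q0.
rewrite map_inj_uniq ?iota_uniq // => a b /complexI /eqP.
by rewrite eqr_nat => /eqP.
Qed.

(* Words commute modulo shorter ones, so the coefficient of [t] in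
   [(X + t Y)^k] is [k] times a single word. *)
Lemma word_poly m pre k X Y post : (forall s, size s = m -> all_in G s -> W s = 0) ->
  (size pre + k + size post)%N = m.+1 ->
  all_in G pre -> G X -> G Y -> all_in G post ->
  exists q : {poly R[i]}, [/\
    forall t : R, q.[rc t] = W (pre ++ nseq k (fun y => X y + rc t *: Y y) ++ post),
    q`_0 = W (pre ++ nseq k X ++ post) &
    q`_1 = W (pre ++ nseq k.-1 X ++ Y :: post) *+ k].
Proof.
move=> IH; elim: k pre => [|k IHk] pre sz Gp GX GY Gq /=.
  by exists (W (pre ++ post))%:P; split=> [t||]; rewrite ?hornerC ?coefC.
have GpX : all_in G (pre ++ [:: X]) by apply/all_in_cat.
have GpY : all_in G (pre ++ [:: Y]) by apply/all_in_cat.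
have [|q1 [q1t q10 q11]] := IHk (pre ++ [:: X]) _ GpX GX GY Gq.
  by rewrite size_cat /= -sz; lia.
have [|q2 [q2t q20 q21]] := IHk (pre ++ [:: Y]) _ GpY GX GY Gq.
  by rewrite size_cat /= -sz; lia.
exists (q1 + 'X * q2); split=> [t||].
- rewrite hornerD hornerM hornerX q1t q2t -!catA /= word_comb_field //.
  apply/all_in_cat; split => //; apply: all_in_nseq; exact: G_comb.
- by rewrite coefD coefXM /= addr0 q10 -catA.
- rewrite coefD coefXM /= q11 q20 -!catA /= mulrS addrC.
  congr (_ + _).
    by case: (k) => [|k'] //=.
  by apply: (word_move IH) => //; move: sz; lia.
Qed.

(* Vanishing of the pure powers [X^(m+1)] suffices. *)
Lemma polarization m : (forall s, size s = m -> all_in G s -> W s = 0) ->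
  (forall X, G X -> W (nseq m.+1 X) = 0) ->
  forall s, size s = m.+1 -> all_in G s -> W s = 0.
Proof.
move=> IH diag.
(* Induction on the number [i] of free letters at the end of a word that starts with equal letters:
   [i = 0] is the pure power, [i = m.+1] the general word. *)
suff H i : (i <= m.+1)%N -> forall X s, G X -> size s = i -> all_in G s ->
    W (nseq (m.+1 - i) X ++ s) = 0.
  case=> [//|X s] [sz] [GX Gs]; have := H m.+1 (leqnn _) X (X :: s) GX.
  by rewrite subnn /= sz; apply.
elim: i => [_ X [|//] GX _ _|i IHi im X [//|Y s] GX [sz] [GY Gs]].
  by rewrite subn0 cats0; exact: diag.
have [|q [qt _ q1]] := @word_poly m [::] (m.+1 - i) X Y s IH _ I GX GY Gs.
  by rewrite /= sz; lia.
(* Replacing [X] by [X + t Y] in the block of equal letters again gives words covered by the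
   induction, for every real [t]. The coefficient of [t] is a positive multiple of the word having
   [Y] as one more free letter. *)
have q0 : q = 0.
  apply: poly_vanishing => t; rewrite qt /=; apply: IHi => //; first exact: ltnW.
  exact: G_comb.
move/eqP: q1; rewrite q0 coef0 eq_sym /= -mulr_natr mulf_eq0 pnatr_eq0.
rewrite subn_eq0 leqNgt im orbF => /eqP <-.
by congr (W (nseq _ _ ++ _)); lia.
Qed.

Lemma words_vanish : u p = 0 ->
  (forall m X, G X -> (forall s, (size s <= m)%N -> all_in G s -> W s = 0) -> W (nseq m.+1 X) = 0) ->
  forall s, all_in G s -> W s = 0.
Proof.
move=> u0 diag s; move: {2}(size s) (leqnn (size s)) => m; elim: m s => [|m IH] s.
  by rewrite leqn0 => /nilP ->.
rewrite leq_eqVlt => /predU1P[sz|]; last by rewrite ltnS; exact: IH.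
apply: (@polarization m) => //; first by move=> s' sz'; apply: IH; rewrite sz'.
by move=> X GX; exact: diag.
Qed.

End Polarization.

End Flatness.

(** * Flatness of a function whose square is bounded by a flat function *)

Section SquareRoot.
Context {R : realType} {n : nat}.
Local Notation T := 'rV[R]_(n + n).
Local Notation V := 'rV[R[i]]_(n + n).
Local Notation rc := (real_complex R).
Implicit Types (S U W : set T) (x y p : T) (v w : V) (f g : T -> R[i]) (X Y Z L M : T -> V).
Implicit Types (G : set (T -> V)) (s : seq (T -> V)).

Definition real_field X := forall y, vconj (X y) = X y.

Definition re_field X : T -> T := fun y => map_mx (@complex.Re R) (X y).

Lemma conjc_fixed (a : R[i]) : conjc a = a -> a = rc (complex.Re a).
Proof. by case: a => a b [H]; apply: complex_ext => //=; lra. Qed.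

Lemma real_field_coord X y j : real_field X -> X y 0 j = rc (re_field X y 0 j).
Proof.
move=> rX; rewrite /re_field mxE; apply: conjc_fixed.
by rewrite -vconjE rX.
Qed.

Lemma der_real X (f : T -> R) : real_field X ->
  der X (fun y => rc (f y)) = fun y => rc (rder (re_field X) f y).
Proof.
move=> rX; apply/funext => y; rewrite /der /rder rmorph_sum; apply: eq_bigr => j _.
by rewrite cpartial_real (real_field_coord _ _ rX) rmorphM.
Qed.

Lemma iter_der_real X (f : T -> R) k : real_field X ->
  iter k (der X) (fun y => rc (f y)) = fun y => rc (iter k (rder (re_field X)) f y).
Proof. by move=> rX; elim: k => //= k ->; rewrite der_real. Qed.

Lemma real_brk X Y : real_field X -> real_field Y -> real_field (brk X Y).
Proof.
move=> rX rY y; apply/rowP => j; rewrite vconjE !mxE.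
have E A B : real_field A -> real_field B ->
    conjc (der A (fun z => B z 0 j) y) = der A (fun z => B z 0 j) y.
  move=> rA rB; rewrite (_ : (fun z => B z 0 j) = fun z => rc (re_field B z 0 j)).
    by rewrite der_real // conjc_real.
  by apply/funext => z; rewrite real_field_coord.
by rewrite conjcD conjcN !E.
Qed.

Lemma rsm_re_field p X i : vsm p X -> rsm p (fun y => re_field X y 0 i).
Proof. by move=> sX; have [sr _] := sX i; apply: rsm_eq sr; apply: filterE => y; rewrite mxE. Qed.

Lemma word_nseq k X f : word (nseq k X) f = iter k (der X) f.
Proof. by elim: k => //= k ->. Qed.

Section Root.
Variables (S U : set T) (rho : T -> R) (p : T) (G : set (T -> V)).
Hypotheses (D : defining_function S U rho) (Up : U p) (Sp : S p).
Hypothesis GS : G `<=` field_germs S p.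
Hypothesis G_conj : forall Z, G Z -> G (fun y => vconj (Z y)).
Hypothesis G_scale : forall (a : R[i]) Z, G Z -> G (fun y => a *: Z y).

(** Flatness is tested on [G], which need not be stable under brackets. Derivations mapping flat
    functions to flat functions are stable, and reality of the fields is what allows them to be
    followed along real curves. *)
Definition flat_preserving : set (T -> V) := [set X |
  [/\ vsm p X, tanS S p X, real_field X &
      forall f, csm p f -> flat G p f -> flat G p (der X f)]].

Lemma flat_preserving_germs : flat_preserving `<=` field_germs S p.
Proof. by move=> X []. Qed.

Lemma tanS_add L M : tanS S p L -> tanS S p M -> tanS S p (fun y => L y + M y).
Proof.
by move=> tL tM; apply: filterS2 tL tM => y tL tM Sy; apply: CT_add; auto.
Qed.

Lemma CT_scale y (a : R[i]) v : CT S y v -> CT S y (a *: v).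
Proof.
move=> [U' [r [Uy D' tv]]]; exists U', r; split=> //.
have := congr1 ( *%R a) tv; rewrite mulr0 mulr_sumr => H; rewrite -[RHS]H.
apply: eq_bigr => j _.
by rewrite mxE mulrA.
Qed.

Lemma tanS_scale f L : tanS S p L -> tanS S p (fun y => f y *: L y).
Proof. by apply: filterS => y tL Sy; apply: CT_scale; auto. Qed.

Lemma tanS_conj L : tanS S p L -> tanS S p (fun y => vconj (L y)).
Proof. by apply: filterS => y tL Sy; apply: CT_conj; auto. Qed.

Lemma local_defining_function : exists U rho, U p /\ defining_function S U rho.
Proof. by exists U, rho. Qed.

Lemma flat_preserving_brk X Y : flat_preserving X -> flat_preserving Y ->
  flat_preserving (brk X Y).
Proof.
move=> [sX tX rX fX] [sY tY rY fY]; split.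
- exact: vsm_brk.
- exact: (tanS_brk Sp local_defining_function).
- exact: real_brk.
move=> f sf ff.
have s1 := csm_der sX (csm_der sY sf); have s2 := csm_der sY (csm_der sX sf).
have f1 := fX _ (csm_der sY sf) (fY _ sf ff).
have f2 := fY _ (csm_der sX sf) (fX _ sf ff).
apply: (flat_eqS Sp GS _ _ _ (flatB Sp GS s1 s2 f1 f2)).
- exact: csmB.
- by apply: csm_der => //; exact: vsm_brk.
apply: near_eqS; apply: filterS3 (vsm_near sX) (vsm_near sY) (csm_near sf) => y sX' sY' sf'.
by rewrite der_brk.
Qed.

Lemma flat_preserving_comb X Y (t : R) : flat_preserving X -> flat_preserving Y ->
  flat_preserving (fun y => X y + rc t *: Y y).
Proof.
move=> [sX tX rX fX] [sY tY rY fY]; split.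
- by apply: vsm_add => //; apply: (@vsm_scale _ _ p (fun=> rc t)) => //; exact: csm_cst.
- by apply: tanS_add => //; exact: (@tanS_scale (fun=> rc t)).
- by move=> y; rewrite vconjD vconjZ conjc_real rX rY.
move=> f sf ff.
have s1 := csm_der sX sf; have s2 := csm_der sY sf.
rewrite (_ : der _ f = fun y => der X f y + rc t * der Y f y).
  apply: (flatD Sp GS) => //; [|exact: fX|].
    by apply: csmM => //; exact: csm_cst.
  by apply: (flatZ Sp GS) => //; exact: fY.
by apply/funext => y; rewrite der_addv (@der_scalev _ _ _ (fun=> rc t)).
Qed.

Definition real_part Z : T -> V := fun y => 2^-1 *: (Z y + vconj (Z y)).

Lemma real_part_real Z : real_field (real_part Z).
Proof. by move=> y; rewrite /real_part vconjZ conjc_2V vconjD vconjK addrC. Qed.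

Lemma der_real_part Z f y :
  der (real_part Z) f y = 2^-1 * (der Z f y + der (fun z => vconj (Z z)) f y).
Proof.
by rewrite (@der_scalev _ _ y (fun=> 2^-1) (fun z => Z z + vconj (Z z))) der_addv.
Qed.

Lemma vsm_real_part Z : vsm p Z -> vsm p (real_part Z).
Proof.
move=> sZ; apply: (@vsm_scale _ _ p (fun=> 2^-1)); first exact: csm_cst.
by apply: vsm_add => //; exact: vsm_conj.
Qed.

Lemma tanS_real_part Z : tanS S p Z -> tanS S p (real_part Z).
Proof.
move=> tZ; apply: (@tanS_scale (fun=> 2^-1)); apply: tanS_add => //.
exact: tanS_conj.
Qed.

Lemma real_part_flat_preserving Z : G Z -> flat_preserving (real_part Z).
Proof.
move=> GZ; have [sZ tZ] := GS GZ; split.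
- exact: vsm_real_part.
- exact: tanS_real_part.
- exact: real_part_real.
move=> f sf ff; have GC := G_conj GZ; have [sZc tZc] := GS GC.
rewrite (_ : der _ f = fun y => 2^-1 * (der Z f y + der (fun z => vconj (Z z)) f y)).
  have s1 := csm_der sZ sf; have s2 := csm_der sZc sf.
  apply: (flatZ Sp GS); first exact: csmD.
  by apply: (flatD Sp GS) => //; exact: flat_der.
by apply/funext => y; rewrite der_real_part.
Qed.

(** [Z = Re Z + i Im Z], where [Im Z] is the real part of [-i Z]. This is why [G] is required to be
    stable under complex scalars. *)
Lemma der_real_parts Z f :
  der Z f = fun y => der (real_part Z) f y + 'i%C * der (real_part (fun z => - 'i%C *: Z z)) f y.
Proof.
apply/funext => y; rewrite !der_real_part.
have -> : (fun z => vconj (- 'i%C *: Z z)) = (fun z => 'i%C *: vconj (Z z)).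
  by apply/funext => z; rewrite vconjZ conjcN conjc_i opprK.
rewrite (@der_scalev _ _ y (fun=> - 'i%C)) (@der_scalev _ _ y (fun=> 'i%C)).
move: (der Z f y) (der (fun z => vconj (Z z)) f y) => a b.
have C (j h : R[i]) : j * j = -1 -> 2 * h = 1 ->
    a = h * (a + b) + j * (h * (- j * a + j * b)).
  by move=> j2 h2; ring: j2 h2.
by apply: C; [exact: mulii|rewrite divff // two_neq0].
Qed.

(** The letters of a word in [G] are replaced one by one, starting with the innermost, by
    combinations of real parts, which belong to [flat_preserving]. *)
Lemma flat_of_real_words f : csm p f ->
  (forall s, all_in flat_preserving s -> word s f p = 0) -> flat G p f.
Proof.
move=> sf H k; elim: k f sf H => [|k IH] f sf H; split; try exact: (H [::] I).
  by [].
move=> Z GZ; have [sZ tZ] := GS GZ.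
apply: IH => [|s Gs]; first exact: csm_der.
have P1 := real_part_flat_preserving GZ.
have P2 := real_part_flat_preserving (G_scale (- 'i%C) GZ).
have [s1 _ _ _] := P1; have [s2 _ _ _] := P2.
rewrite der_real_parts.
have := word_comb flat_preserving_germs 'i%C Gs (csm_der s1 sf) (csm_der s2 sf).
move=> /nbhs_singleton ->.
have W X : flat_preserving X -> word s (der X f) p = 0.
  move=> PX; have := H (rcons s X); rewrite /word foldr_rcons; apply.
  by rewrite -cats1; apply/all_in_cat.
by rewrite !W // mulr0 addr0.
Qed.

(** By [words_vanish] only pure powers of a field [X] in [flat_preserving] matter, with all shorter
    words already zero. All [X^l ka] are flat because [X] preserves flatness, and all [X^l rho]
    vanish at [p] because [X] is tangent, so [square_root_jet] applies. *)
Lemma sqrt_flat (u ka : T -> R) : rsm p u -> rsm p ka ->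
  flat G p (fun y => rc (ka y)) ->
  (\forall y \near p, S y -> u y ^+ 2 <= ka y) ->
  flat G p (fun y => rc (u y)).
Proof.
move=> su ska fka uka.
have [_ _ DS /(_ p Up) [j Dj]] := D.
have sr := defining_rsm D Up.
have scu := csm_real su.
apply: flat_of_real_words => //.
have ka0 : ka p = 0 by have := flat_val fka => /complexI.
have WV := words_vanish flat_preserving_germs scu flat_preserving_brk flat_preserving_comb.
apply: WV.
  have := nbhs_singleton uka Sp; rewrite ka0 => h.
  by congr rc; apply/eqP; rewrite -sqrf_eq0 eq_le h sqr_ge0.
move=> m X PX IH; have [sX tX rX fX] := PX.
rewrite word_nseq iter_der_real //; congr rc.
apply: (square_root_jet sr Dj (fun i => rsm_re_field i sX) su ska).
- move=> l; apply: complexI; rewrite -[LHS](congr1 (@^~ p) (iter_der_real rho l rX)).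
  have scr := csm_real sr.
  have r0 : eqS S p (fun y => rc (rho y)) (fun=> 0).
    by apply: filterS (defining_near D Up) => y Uy Sy; rewrite (iffLR (DS y Uy) Sy).
  have Gn : all_in flat_preserving (nseq l X) by exact: all_in_nseq.
  have W0 : word (nseq l X) (fun=> 0 : R[i]) = fun=> 0.
    elim: (l) => //= k ->; apply/funext => y; exact: der_cst.
  have := word_eqS flat_preserving_germs Gn scr (csm_cst p 0) r0.
  by move=> /nbhs_singleton /(_ Sp); rewrite word_nseq W0.
- move=> l; apply: complexI; rewrite -[LHS](congr1 (@^~ p) (iter_der_real ka l rX)).
  apply: flat_val; have sck := csm_real ska.
  suff [] : csm p (iter l (der X) (fun y => rc (ka y))) /\ flat G p (iter l (der X) (fun y => rc (ka y))).
    by move=> _; exact.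
  elim: l => //= l [sl fl]; split; first exact: csm_der.
  exact: fX.
- move=> l lm; apply: complexI; rewrite -[LHS](congr1 (@^~ p) (iter_der_real u l rX)).
  by rewrite -word_nseq; apply: IH; [rewrite size_nseq|exact: all_in_nseq].
- apply: filterS2 (defining_near D Up) uka => y Uy H ry.
  by apply: H; apply/DS.
Qed.

End Root.

End SquareRoot.

(** * Fields of the orbit of a special subbundle *)

Section SpecialSubbundle.
Context {R : realType} {n : nat}.
Local Notation T := 'rV[R]_(n + n).
Local Notation V := 'rV[R[i]]_(n + n).
Local Notation rc := (real_complex R).
Implicit Types (x y : T) (v w : V) (f g : T -> R[i]) (X Y Z L M H K : T -> V).
Implicit Types (s : seq (T -> V)).

Variables (S U : set T) (rho : T -> R) (p : T) (theta : T -> 'cV[R[i]]_(n + n)).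
Variable E : T -> set V.
Hypotheses (HS : smooth_hypersurface S) (PC : pseudoconvex S) (CF : contact_form S theta).
Hypotheses (subE : complex_subbundle S E) (ILT : infinite_levi_type S theta E p).
Hypotheses (D : defining_function S U rho) (Up : U p) (Sp : S p).

Lemma E_H10 y v : S y -> E y v -> H10 S y v.
Proof. by move=> Sy Ev; have [EH _] := subE; exact: EH. Qed.

Lemma E_scale y (a : R[i]) v : S y -> E y v -> E y (a *: v).
Proof.
move=> Sy; have [_ [r fr]] := subE; have [W [e [oW Wy _ _ Ee]]] := fr y Sy.
by move=> /(Ee y v Sy Wy) ve; apply/(Ee y _ Sy Wy); exact: scalemx_sub.
Qed.

Definition E_germs : set (T -> V) := [set L | vsm p L /\ \forall y \near p, S y -> E y (L y)].

(** A union and not a sum of bundles: each letter of a word is a section of [E] or of its conjugate,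
    exactly as in the definition of infinite Levi type. *)
Definition EE_germs : set (T -> V) :=
  [set Z | E_germs Z \/ E_germs (fun y => vconj (Z y))].

Lemma E_germs_tan : E_germs `<=` field_germs S p.
Proof.
move=> L [sL EL]; split=> //; apply: filterS EL => y EL Sy.
by apply: H10_CT; apply: E_H10 => //; exact: EL.
Qed.

Lemma vconj_vconj Z : (fun y => vconj (vconj (Z y))) = Z.
Proof. by apply/funext => y; rewrite vconjK. Qed.

Lemma EE_germs_tan : EE_germs `<=` field_germs S p.
Proof.
move=> Z [|/E_germs_tan[sZ tZ]]; first exact: E_germs_tan.
by rewrite -(vconj_vconj Z); split; [exact: vsm_conj|exact: tanS_conj].
Qed.

Lemma EE_germs_conj Z : EE_germs Z -> EE_germs (fun y => vconj (Z y)).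
Proof. by move=> [EZ|EZ]; [right; rewrite vconj_vconj|left]. Qed.

Lemma E_germs_scale (a : R[i]) L : E_germs L -> E_germs (fun y => a *: L y).
Proof.
move=> [sL EL]; split.
  by apply: (@vsm_scale _ _ p (fun=> a)) => //; exact: csm_cst.
by apply: filterS EL => y EL Sy; apply: E_scale => //; exact: EL.
Qed.

Lemma EE_germs_scale (a : R[i]) Z : EE_germs Z -> EE_germs (fun y => a *: Z y).
Proof.
move=> [EZ|EZ]; [left|right]; first exact: E_germs_scale.
rewrite (_ : (fun y => _) = fun y => conjc a *: vconj (Z y)); first exact: E_germs_scale.
by apply/funext => y; rewrite vconjZ.
Qed.

Local Notation flatE := (flat EE_germs p).

Lemma near_open (P : T -> Prop) : (\forall y \near p, P y) ->
  exists W, [/\ open W, W p & forall y, W y -> P y].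
Proof. by rewrite /prop_near1 nbhsE => -[W [oW Wp] WP]; exists W. Qed.

(** Allowing every smaller [W'] lets finitely many germs be represented over one common open set, as
    infinite Levi type demands. *)
Lemma EE_is_section Z : EE_germs Z ->
  exists W, [/\ open W, W p & forall W', W' `<=` W -> is_section_or_conj S E W' Z].
Proof.
move=> [[sZ EZ]|[sZ EZ]].
  have [W [oW Wp WP]] := near_open (near_and (vsm_near sZ) EZ).
  exists W; split=> // W' WW; left; apply: germ_section => [y /WW /WP[]|y Sy /WW /WP[_]] //.
  exact.
have sZ' := vsm_near (vsm_conj sZ); rewrite vconj_vconj in sZ'.
have [W [oW Wp WP]] := near_open (near_and sZ' EZ).
exists W; split=> // W' WW; right; apply: germ_section => [y /WW /WP[]|y Sy /WW /WP[_ EZ']] //.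
by exists (vconj (Z y)); [exact: EZ'|rewrite vconjK].
Qed.

Lemma EE_list_section s : all_in EE_germs s ->
  exists W, [/\ open W, W p & forall W', W' `<=` W -> forall K, K \in s -> is_section_or_conj S E W' K].
Proof.
elim: s => [|Z s IH] /=; first by exists setT; split=> //; exact: openT.
move=> [EZ Es]; have [W1 [oW1 pW1 H1]] := EE_is_section EZ; have [W2 [oW2 pW2 H2]] := IH Es.
exists (W1 `&` W2); split=> //; first exact: openI.
move=> W' sub K; rewrite in_cons => /orP[/eqP ->|Ks].
  by apply: H1 => y /sub[].
by apply: H2 => // y /sub[].
Qed.

(** The factor by which [theta] is a multiple of [th0] on tangent vectors. Since [theta] is
    arbitrary off S, the factor is replaced by a smooth ambient germ with the same values on S. *)
Definition contact_coef_spec (c : T -> R[i]) := [/\ csm p c, c p != 0 &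
  \forall y \near p, S y -> pairing theta y (Nr rho y) = c y].

Lemma vsm_Nr : vsm p (Nr rho).
Proof.
have sr := defining_rsm D Up.
have sd : vsm p (fun z => dz_vec (dbar rho z)) by apply: vsm_dz => k; exact: csm_dbar.
apply: (@vsm_scale _ _ p (fun z => (Qr rho z)^-1) (fun z => dz_vec (dbar rho z) - vconj (dz_vec (dbar rho z)))).
  exact: csmV (csm_Qr sr) (Qr_neq0 D Up).
have := vsm_add sd (@vsm_scale _ _ p (fun=> -1) _ (csm_cst _ _) (vsm_conj sd)).
rewrite (_ : (fun z => _ + _ *: _) = (fun z => dz_vec (dbar rho z) - vconj (dz_vec (dbar rho z)))) //.
by apply/funext => z; rewrite scaleN1r.
Qed.

Lemma contact_smooth : exists eta : T -> 'cV[R[i]]_(n + n),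
  (forall j, csm p (fun y => eta y j 0)) /\
  \forall y \near p, S y -> forall v, CT S y v -> pairing theta y v = pairing eta y v.
Proof.
have [sth _ _] := CF; have [W [eta [oW Wp seta E']]] := sth p Sp I.
exists eta; split; first by move=> j; apply/csmP; exists W.
by have := open_nbhs_nbhs (conj oW Wp); apply: filterS => y Wy Sy v; exact: E'.
Qed.

Lemma csm_pairing (eta : T -> 'cV[R[i]]_(n + n)) L : (forall j, csm p (fun y => eta y j 0)) ->
  vsm p L -> csm p (fun y => pairing eta y (L y)).
Proof.
move=> se sL; apply: csm_eq (csm_sum _ (fun j => csmM (sL j) (se j))).
by apply: filterE => y; rewrite /pairing mxE; apply: eq_bigr.
Qed.

Lemma contact_coef : exists c, contact_coef_spec c.
Proof.
have [eta [seta E']] := contact_smooth.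
have E2 : \forall y \near p, S y -> pairing theta y (Nr rho y) = pairing eta y (Nr rho y).
  apply: filterS2 (defining_near D Up) E' => y Uy H Sy.
  by apply: H => //; exact: (Nr_CT D Uy Sy).
exists (fun y => pairing eta y (Nr rho y)); split=> //.
  exact: csm_pairing vsm_Nr.
by rewrite -(nbhs_singleton E2 Sp); exact: (contact_neq0 D Up Sp CF I).
Qed.

Lemma veqS_refl L : veqS S p L L.
Proof. exact: filterE. Qed.

Lemma near_join2 (P : T -> Prop) : (\forall y \near p, P y) ->
  \forall y \near p, \forall z \near y, P z.
Proof. by move/near_join. Qed.

Lemma levi_ext L M c : contact_coef_spec c -> field_germs S p L -> field_germs S p M ->
  (\forall z \near p, S z -> th0 rho z (L z) = 0) ->
  (\forall z \near p, S z -> th0 rho z (M z) = 0) ->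
  eqS S p (levi S theta L M) (fun y => - (c y * Om rho y (L y) (M y))).
Proof.
move=> [_ _ cE] [sL tL] [sM tM] zL zM.
have B := bracket_ext Sp sL sM tL tM (veqS_refl L) (veqS_refl M).
have H1 := near_and (near_and (vsm_near sL) (vsm_near sM)) (near_and (tanS_near tL) (tanS_near tM)).
have H2 := near_and (near_and (near_join2 zL) (near_join2 zM)) (near_and cE (defining_near D Up)).
apply: filterS3 B H1 H2 => y B [[sL' sM'] [tL' tM']] [[zL' zM'] [cE' Uy]] Sy.
rewrite /levi B // (levi_Om D Uy Sy CF I sL' sM' tL' tM' zL' zM').
by rewrite cE'.
Qed.

(** Each [vf_app] makes its own choice of extension; the iterated result still agrees on S near [p]
    with the ambient word. *)
Lemma foldr_vf_app s f g : all_in (field_germs S p) s -> csm p g -> eqS S p f g ->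
  eqS S p (foldr (vf_app S) f s) (word s g).
Proof.
elim: s => [|Z s IH] //= [[sZ tZ] Gs] sg fg.
have sw := csm_word (fun K (h : field_germs S p K) => h) Gs sg.
apply: filterS3 (csm_near sw) tZ (eqS_near (IH Gs sg fg)) => y sw' tZ' fg' Sy.
by apply: vf_app_ext => //; exact: tZ'.
Qed.

Lemma all_in_sub (G1 G2 : set (T -> V)) s : G1 `<=` G2 -> all_in G1 s -> all_in G2 s.
Proof. by move=> sub; elim: s => //= Z s IH [/sub GZ /IH]. Qed.

Lemma th0_H10 L : (\forall y \near p, S y -> H10 S y (L y)) ->
  \forall y \near p, S y -> th0 rho y (L y) = 0.
Proof.
apply: filterS2 (defining_near D Up) => y Uy HL Sy.
by have /(H10_th0 _ D Uy Sy)[] := HL Sy.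
Qed.

Lemma th0_conj_H10 L : (\forall y \near p, S y -> H10 S y (L y)) ->
  \forall y \near p, S y -> th0 rho y (vconj (L y)) = 0.
Proof.
apply: filterS => y HL Sy; have [_ [xi ->]] := HL Sy; exact: th0_conj_dz.
Qed.

Lemma E_germs_H10 L : E_germs L -> \forall y \near p, S y -> H10 S y (L y).
Proof. by move=> [_ EL]; apply: filterS EL => y EL Sy; apply: E_H10; auto. Qed.

Lemma csm_comp10 L k : vsm p L -> csm p (fun y => comp10 (L y) 0 k).
Proof.
move=> sL; apply: csm_eq (csmD (sL (lshift n k)) (csmM (csm_cst p 'i%C) (sL (rshift n k)))).
by apply: filterE => z; rewrite mxE.
Qed.

Lemma csm_th0 L : vsm p L -> csm p (fun y => th0 rho y (L y)).
Proof.
move=> sL; apply: csm_sum => k; apply: csmM; first exact: csm_comp10.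
exact: csm_dzr (defining_rsm D Up).
Qed.

Lemma csm_Om L M : vsm p L -> vsm p M -> csm p (fun y => Om rho y (L y) (M y)).
Proof.
move=> sL sM; have sr := defining_rsm D Up; apply: csm_sum => k; apply: csmB.
  by apply: csmM; [exact: csm_comp10|apply: (csm_der sL); exact: csm_dzr].
by apply: csmM; [exact: csm_comp10|apply: (csm_der sM); exact: csm_dzr].
Qed.

(** Infinite Levi type says that [- c * Om] is flat, with [c] the factor of [theta]. As [c] is
    smooth and nonzero at [p], and flat functions form an ideal, it can be divided out. *)
Lemma flat_Om_self L : E_germs L -> flatE (fun y => Om rho y (L y) (vconj (L y))).
Proof.
move=> EL; have [sL _] := EL; have sLc := vsm_conj sL.
have [c cS] := contact_coef; have [sc c0 _] := cS.
have HL := E_germs_H10 EL.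
have sO := csm_Om sL sLc.
have GL : EE_germs L by left.
have GLc := EE_germs_conj GL.
have le := levi_ext cS (EE_germs_tan GL) (EE_germs_tan GLc) (th0_H10 HL) (th0_conj_H10 HL).
have sN : csm p (fun y => - (c y * Om rho y (L y) (vconj (L y)))).
  by apply: csmN; exact: csmM.
have fl : flatE (fun y => - (c y * Om rho y (L y) (vconj (L y)))).
  apply: word_flat => s Gs.
  have := foldr_vf_app (all_in_sub EE_germs_tan Gs) sN le.
  move=> /nbhs_singleton /(_ Sp) <-.
  have [W [oW Wp WP]] := EE_list_section (conj GL (conj GLc Gs) : all_in EE_germs [:: L, (fun y => vconj (L y)) & s]).
  have {}WP := WP W (@subset_refl _ W).
  apply: (ILT oW Wp).
  - by move=> K Ks; apply: WP; rewrite !in_cons Ks !orbT.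
  - by apply: WP; rewrite in_cons eqxx.
  - by apply: WP; rewrite !in_cons eqxx orbT.
have := flatM Sp EE_germs_tan sN (csmN (csmV sc c0)) fl.
apply: (flat_eqS Sp EE_germs_tan) => //.
  by apply: csmM => //; apply: csmN; exact: csmV.
apply: filterS (csm_near_neq0 sc c0) => y cy Sy.
by rewrite mulrNN mulrAC mulfV // mul1r.
Qed.

(** The bound [ka] is flat because one of its factors is. [sqrt_flat] concerns real functions, so it
    is applied separately to the real and imaginary parts of [mu], each of whose squares is at most
    [ka] on S. *)
Lemma flat_Om_H10 L H : E_germs L -> vsm p H ->
  (\forall y \near p, S y -> H10 S y (H y)) ->
  flatE (fun y => Om rho y (L y) (vconj (H y))).
Proof.
move=> EL sH HH; have [sL _] := EL.
have sLc := vsm_conj sL; have sHc := vsm_conj sH; have HL := E_germs_H10 EL.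
pose mu y := Om rho y (L y) (vconj (H y)).
pose ka y := Om rho y (L y) (vconj (L y)) * Om rho y (H y) (vconj (H y)).
have smu : csm p mu by exact: csm_Om.
have ska : csm p ka by apply: csmM; exact: csm_Om.
have fka : flatE ka.
  by apply: (flatM Sp EE_germs_tan); [exact: csm_Om|exact: csm_Om|exact: flat_Om_self].
have CS : \forall y \near p, S y -> complex.Im (ka y) = 0 /\
    complex.Re (mu y) ^+ 2 + complex.Im (mu y) ^+ 2 <= complex.Re (ka y).
  have H1 := near_and HL HH; have H2 := near_and (levi_semidefinite HS PC D Up Sp) (defining_near D Up).
  apply: filterS2 H1 H2 => y [HLy HHy] [sd Uy] Sy.
  have [c c0 pos] := sd Sy.
  have := Om_CS D Uy Sy c0 pos (HLy Sy) (HHy Sy).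
  rewrite -/(mu y) -/(ka y) lecE => /andP[/eqP -> ].
  case: (mu y) => a b /=; rewrite mulrN opprK -!expr2 => h; split=> //.
  by ring.
have fkr : flatE (fun y => rc (complex.Re (ka y))).
  apply: (flat_eqS Sp EE_germs_tan _ _ _ fka) => //; first exact: csm_real ska.1.
  apply: filterS CS => y CSy Sy; have [im _] := CSy Sy.
  by apply: complex_ext.
have fr : flatE (fun y => rc (complex.Re (mu y))).
  apply: (sqrt_flat D Up Sp EE_germs_tan EE_germs_conj EE_germs_scale smu.1 ska.1 fkr).
  apply: filterS CS => y CSy Sy; have [_] := CSy Sy; apply: le_trans.
  by rewrite lerDl sqr_ge0.
have fi : flatE (fun y => rc (complex.Im (mu y))).
  apply: (sqrt_flat D Up Sp EE_germs_tan EE_germs_conj EE_germs_scale smu.2 ska.1 fkr).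
  apply: filterS CS => y CSy Sy; have [_] := CSy Sy; apply: le_trans.
  by rewrite lerDr sqr_ge0.
have sr := csm_real smu.1; have si := csm_real smu.2.
have := flatD Sp EE_germs_tan sr (csmM (csm_cst p 'i%C) si) fr (flatZ Sp EE_germs_tan 'i%C si fi).
apply: (flat_eqS Sp EE_germs_tan) => //.
  by apply: csmD => //; apply: csmM => //; exact: csm_cst.
by apply: filterE => y _; rewrite -complexE.
Qed.

Definition contact_flat : set (T -> V) := [set H |
  [/\ vsm p H, tanS S p H & flatE (fun y => th0 rho y (H y))]].

Lemma th0_vconj y v : U y -> S y -> CT S y v -> th0 rho y (vconj v) = - conjc (th0 rho y v).
Proof.
move=> Uy Sy /(CT_th0 _ D Uy Sy) tv.
by apply/eqP; rewrite -subr_eq0 opprK -[th0 rho y (vconj v)]conjcK -conjcD addrC tv conjc0.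
Qed.

(** On tangent vectors d rho vanishes, so [th0] of the conjugate is minus the conjugate of [th0];
    the family [EE_germs] is stable under conjugation. *)
Lemma contact_flat_conj H : contact_flat H -> contact_flat (fun y => vconj (H y)).
Proof.
move=> [sH tH fH]; have sHc := vsm_conj sH; split=> //; first exact: tanS_conj.
have st := csm_th0 sH.
have := flatZ Sp EE_germs_tan (-1) (csm_conj st) (flat_conj Sp EE_germs_tan EE_germs_conj st fH).
apply: (flat_eqS Sp EE_germs_tan).
- by apply: csmM; [exact: csm_cst|exact: csm_conj].
- exact: csm_th0.
- apply: filterS2 (defining_near D Up) tH => y Uy tHy Sy.
  by rewrite th0_vconj ?mulN1r //; exact: tHy.
Qed.

(** [H] splits into [th0 H] times [Nr], a (1,0) part and a (0,1) part. The first contributes a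
    multiple of the flat function [th0 H], the second nothing since [Om] has no (2,0) component, and
    the third is the case of [flat_Om_H10]. *)
Lemma flat_Om_contact L H : E_germs L -> contact_flat H ->
  flatE (fun y => Om rho y (L y) (H y)).
Proof.
move=> EL [sH tH fH]; have [sL _] := EL; have sN := vsm_Nr.
have st := csm_th0 sH.
have snt : csm p (fun y => - th0 rho y (H y)) by exact: csmN.
(* Tangent with [th0 H' = 0], so both of its type components are tangent; [b] is the conjugate of
   its (0,1) component. *)
pose H' y := H y + (- th0 rho y (H y)) *: Nr rho y.
have sH' : vsm p H' by exact: (vsm_add sH (vsm_scale snt sN)).
pose b y : V := dz_vec (comp10 (vconj (H' y))).
have sb : vsm p b by apply: vsm_dz => k; apply: csm_comp10; exact: vsm_conj.
have Hb : \forall y \near p, S y -> H10 S y (b y).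
  apply: filterS2 (defining_near D Up) tH => y Uy tHy Sy.
  have tH' : CT S y (H' y).
    by apply: CT_add => //; [exact: tHy|apply: CT_scale; exact: (Nr_CT D Uy Sy)].
  apply/(H10_th0 _ D Uy Sy); split; first by exists (comp10 (vconj (H' y))).
  rewrite th0_comp10 th0_vconj // /H' th0D th0Z th0_Nr ?(Qr_neq0 D Uy) //.
  by rewrite mulr1 subrr conjc0 oppr0.
have f1 := flatM Sp EE_germs_tan st (csm_Om sL sN) fH.
have f2 := flat_Om_H10 EL sb Hb.
have s1 := csmM st (csm_Om sL sN); have s2 := csm_Om sL (vsm_conj sb).
apply: (flat_eqS Sp EE_germs_tan _ _ _ (flatD Sp EE_germs_tan s1 s2 f1 f2)).
- exact: csmD.
- exact: csm_Om.
have HL := E_germs_H10 EL.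
apply: filterS2 (defining_near D Up) HL => y Uy HLy Sy.
have [_ [xi LE]] := HLy Sy.
have HE : H y = th0 rho y (H y) *: Nr rho y + (dz_vec (comp10 (H' y)) + vconj (b y)).
  rewrite -(comp10_decomposition (H' y)) /H' scaleNr.
  by rewrite addrCA subrr addr0.
apply: esym; apply: etrans (congr1 (Om rho y (L y)) HE) _.
rewrite !OmDr OmZr; congr (_ + _).
by rewrite LE Om_dz ?add0r //; exact: defining_rsm D Uy.
Qed.

Lemma contact_flat_near H H' : (\forall y \near p, H y = H' y) ->
  contact_flat H -> contact_flat H'.
Proof.
move=> HH [sH tH fH].
have sH' : vsm p H' by move=> j; apply: csm_eq (sH j); apply: filterS HH => y ->.
split=> //; first by apply: filterS2 HH tH => y ->.
apply: (flat_eqS Sp EE_germs_tan _ _ _ fH); [exact: csm_th0|exact: csm_th0|].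
by apply: filterS HH => y -> _.
Qed.

Lemma contact_flat_add H K : contact_flat H -> contact_flat K ->
  contact_flat (fun y => H y + K y).
Proof.
move=> [sH tH fH] [sK tK fK].
have sHK : vsm p (fun y => H y + K y) by exact: vsm_add.
split=> //; first exact: tanS_add.
have := flatD Sp EE_germs_tan (csm_th0 sH) (csm_th0 sK) fH fK.
apply: (flat_eqS Sp EE_germs_tan).
- exact: csmD (csm_th0 sH) (csm_th0 sK).
- exact: csm_th0.
- by apply: filterE => y _; rewrite th0D.
Qed.

Lemma contact_flat_scale (a : R[i]) H : contact_flat H -> contact_flat (fun y => a *: H y).
Proof.
move=> [sH tH fH].
have saH : vsm p (fun y => a *: H y).
  exact: (@vsm_scale _ _ p (fun=> a) _ (csm_cst _ _) sH).
split=> //; first exact: (@tanS_scale _ _ _ _ (fun=> a)).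
have := flatZ Sp EE_germs_tan a (csm_th0 sH) fH.
apply: (flat_eqS Sp EE_germs_tan).
- exact: csmM (csm_cst _ _) (csm_th0 sH).
- exact: csm_th0.
- by apply: filterE => y _; rewrite th0Z.
Qed.

(** In Cartan's formula [L (th0 H)] is a derivative of a flat function along [E], [H (th0 L)]
    vanishes on S because [th0 L] does, and [Om L H] is flat by [flat_Om_contact]. *)
Lemma contact_flat_brk_E L H : E_germs L -> contact_flat H -> contact_flat (brk L H).
Proof.
move=> EL CH; have [sL _] := EL; have [sH tH fH] := CH.
have [_ tL] := E_germs_tan EL.
have GL : EE_germs L by left.
have sB := vsm_brk sL sH.
split=> //; first exact: (tanS_brk Sp (local_defining_function D Up) sL sH tL tH).
have sr := defining_rsm D Up.
have s1 := csm_der sL (csm_th0 sH); have s2 := csm_der sH (csm_th0 sL).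
have s3 := csm_Om sL sH.
have f1 : flatE (der L (fun y => th0 rho y (H y))) by exact: flat_der.
have f3 := flat_Om_contact EL CH.
have := flatB Sp EE_germs_tan s1 s3 f1 f3.
apply: (flat_eqS Sp EE_germs_tan); [exact: csmB|exact: csm_th0|].
have z2 := der_eqS tH (csm_th0 sL) (csm_cst p 0) (th0_H10 (E_germs_H10 EL)).
have H1 := near_and (vsm_near sL) (vsm_near sH).
apply: filterS3 (rsm_near sr) z2 H1 => y sr' z2' [sL' sH'] Sy.
by rewrite (th0_brk sr' sL' sH') (z2' Sy) der_cst subr0.
Qed.

(** The bracket of conj L with H is the conjugate of the bracket of L with conj H, which reduces to
    [contact_flat_brk_E]. *)
Lemma contact_flat_brk_conj L H : E_germs L -> contact_flat H ->
  contact_flat (brk (fun y => vconj (L y)) H).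
Proof.
move=> EL CH; have [sL _] := EL; have [sH _ _] := CH.
have := contact_flat_conj (contact_flat_brk_E EL (contact_flat_conj CH)).
apply: contact_flat_near; apply: filterS2 (vsm_near sL) (vsm_near sH) => y sL' sH'.
apply/rowP => j; rewrite vconjE !mxE conjcD conjcN.
congr (_ - _).
  rewrite (_ : (fun z => vconj (H z) 0 j) = fun z => conjc (H z 0 j)).
    by rewrite der_conj ?conjcK.
  by apply/funext => z; rewrite vconjE.
rewrite (_ : (fun z => vconj (L z) 0 j) = fun z => conjc (L z 0 j)).
  by rewrite der_conj.
by apply/funext => z; rewrite vconjE.
Qed.

Lemma brk_comb X Y H (a b : R[i]) : vsm p X -> vsm p Y ->
  \forall y \near p, brk (fun z => a *: X z + b *: Y z) H y = a *: brk X H y + b *: brk Y H y.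
Proof.
move=> sX sY; apply: filterS2 (vsm_near sX) (vsm_near sY) => y sX' sY'.
apply/rowP => j; rewrite [LHS]mxE ![in RHS]mxE der_addv.
rewrite (@der_scalev _ _ y (fun=> a)) (@der_scalev _ _ y (fun=> b)).
rewrite (_ : (fun z => (a *: X z + b *: Y z) 0 j) = fun z => a * X z 0 j + b * Y z 0 j).
  have saX : csm y (fun z => a * X z 0 j) by apply: csmM (csm_cst _ _) (sX' j).
  have sbY : csm y (fun z => b * Y z 0 j) by apply: csmM (csm_cst _ _) (sY' j).
  rewrite (derD _ saX sbY) (derZ _ _ (sX' j)) (derZ _ _ (sY' j)).
  by ring.
by apply/funext => z; rewrite !mxE.
Qed.

Lemma contact_flat_E L : E_germs L -> contact_flat L.
Proof.
move=> EL; have [sL tL] := E_germs_tan EL; split=> //.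
apply: (flat_eqS0 Sp EE_germs_tan (csm_th0 sL)).
exact: th0_H10 (E_germs_H10 EL).
Qed.

Lemma real_part_comb Z :
  real_part Z = fun z => 2^-1 *: Z z + 2^-1 *: vconj (Z z).
Proof. by apply/funext => z; rewrite /real_part scalerDr. Qed.

(* Functions whose real differentials represent the dual forms with [t >= 2]. *)
Definition annihilated f := csm p f /\
  forall Z, EE_germs Z -> eqS S p (der Z f) (fun=> 0).

(* A Lie algebra of real fields containing the real parts of the sections of [E];
   the third clause passes to brackets by the Jacobi identity. *)
Definition orbit_fields : set (T -> V) := [set X |
  [/\ flat_preserving S p EE_germs X, contact_flat X,
      forall H, contact_flat H -> contact_flat (brk X H) &
      forall f, annihilated f -> eqS S p (der X f) (fun=> 0)]].

Lemma orbit_fields_brk X Y : orbit_fields X -> orbit_fields Y -> orbit_fields (brk X Y).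
Proof.
move=> [pX cX aX nX] [pY cY aY nY].
have [sX tX rX fX] := pX; have [sY tY rY fY] := pY; split.
- exact: (flat_preserving_brk D Up Sp EE_germs_tan).
- exact: aX.
- move=> H cH; have [sH _ _] := cH.
  have c1 := aX _ (aY _ cH); have c2 := contact_flat_scale (-1) (aY _ (aX _ cH)).
  apply: contact_flat_near (contact_flat_add c1 c2).
  apply: filterS3 (vsm_near sX) (vsm_near sY) (vsm_near sH) => y sX' sY' sH'.
  by rewrite (brk_jacobi sX' sY' sH') scaleN1r.
- move=> f [sf af].
  have zX := nX f (conj sf af); have zY := nY f (conj sf af).
  have z1 := der_eqS tX (csm_der sY sf) (csm_cst p 0) zY.
  have z2 := der_eqS tY (csm_der sX sf) (csm_cst p 0) zX.
  have H1 := near_and (near_and (vsm_near sX) (vsm_near sY)) (csm_near sf).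
  apply: filterS3 z1 z2 H1 => y z1' z2' [[sX' sY'] sf'] Sy.
  by rewrite (der_brk sX' sY' sf') (z1' Sy) (z2' Sy) !der_cst subrr.
Qed.

Lemma orbit_fields_comb X Y (t : R) : orbit_fields X -> orbit_fields Y ->
  orbit_fields (fun y => X y + rc t *: Y y).
Proof.
move=> [pX cX aX nX] [pY cY aY nY].
have [sX tX rX fX] := pX; have [sY tY rY fY] := pY; split.
- exact: (flat_preserving_comb Sp EE_germs_tan).
- exact: contact_flat_add cX (contact_flat_scale _ cY).
- move=> H cH.
  have c1 := aX _ cH; have c2 := contact_flat_scale (rc t) (aY _ cH).
  apply: contact_flat_near (contact_flat_add c1 c2).
  apply: filterS (brk_comb H 1 (rc t) sX sY) => y.
  rewrite (_ : (fun z => 1 *: X z + _) = fun z => X z + rc t *: Y z) => [->|].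
    by rewrite scale1r.
  by apply/funext => z; rewrite scale1r.
- move=> f af; apply: filterS2 (nX f af) (nY f af) => y zX zY Sy.
  by rewrite der_addv (@der_scalev _ _ y (fun=> rc t)) (zX Sy) (zY Sy) mulr0 addr0.
Qed.

Lemma orbit_fields_real_part L : E_germs L -> orbit_fields (real_part L).
Proof.
move=> EL; have GL : EE_germs L by left.
have [sL _] := EL; have sLc := vsm_conj sL.
split.
- exact: (real_part_flat_preserving Sp EE_germs_tan EE_germs_conj).
- rewrite real_part_comb; have cL := contact_flat_E EL.
  exact: contact_flat_add (contact_flat_scale _ cL) (contact_flat_scale _ (contact_flat_conj cL)).
- move=> H cH.
  have c1 := contact_flat_scale 2^-1 (contact_flat_brk_E EL cH).
  have c2 := contact_flat_scale 2^-1 (contact_flat_brk_conj EL cH).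
  apply: contact_flat_near (contact_flat_add c1 c2).
  rewrite real_part_comb.
  by apply: filterS (brk_comb H 2^-1 2^-1 sL sLc) => y ->.
- move=> f [sf af]; have z1 := af _ GL; have z2 := af _ (EE_germs_conj GL).
  apply: filterS2 z1 z2 => y z1' z2' Sy.
  by rewrite der_real_part (z1' Sy) (z2' Sy) addr0 mulr0.
Qed.

Lemma orbit_fields0 : orbit_fields (fun=> 0).
Proof.
have s0 : vsm p (fun=> 0) by move=> j; exact: csm_cst.
have d0 f : der (fun=> 0) f = fun=> 0.
  by apply/funext => y; rewrite /der big1 // => j _; rewrite mxE mul0r.
have t0 : tanS S p (fun=> 0).
  apply: filterS (defining_near D Up) => y Uy Sy.
  by have := CT_scale 0 (Nr_CT D Uy Sy); rewrite scale0r.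
have c0 : contact_flat (fun=> 0).
  split=> //; apply: (flat_eqS0 Sp EE_germs_tan (csm_th0 s0)).
  by apply: filterE => y _; rewrite -(scale0r (0 : V)) th0Z mul0r.
split=> //.
- split=> //; first by move=> y; apply/rowP => j; rewrite vconjE !mxE conjc0.
  by move=> f sf ff; rewrite d0; exact: (flat0 Sp EE_germs_tan).
- move=> H [sH _ _]; apply: contact_flat_near c0.
  apply: filterE => y; apply/rowP => j; rewrite !mxE d0 sub0r.
  by rewrite der_cst oppr0.
- by move=> f af; rewrite d0; exact: filterE.
Qed.

(** All three [th0] terms in Cartan's formula are flat, hence zero at [p]: the bracket belongs to
    [contact_flat], and each field preserves the flatness of [th0] of the other. *)
Lemma orbit_fields_Om X Y : orbit_fields X -> orbit_fields Y -> Om rho p (X p) (Y p) = 0.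
Proof.
move=> [pX cX aX nX] [pY cY aY nY].
have [sX tX rX fX] := pX; have [sY tY rY fY] := pY.
have [_ _ fB] := aX _ cY.
have [_ _ cX'] := cX; have [_ _ cY'] := cY.
have := th0_brk (defining_rsm D Up) sX sY.
rewrite (flat_val fB) (flat_val (fX _ (csm_th0 sY) cY')) (flat_val (fY _ (csm_th0 sX) cX')).
by rewrite subrr sub0r => /esym/eqP; rewrite oppr_eq0 => /eqP.
Qed.

Lemma H10_section_ext K : is_section_or_conj S (H10 S) setT K ->
  exists K', [/\ vsm p K', veqS S p K K', tanS S p K' &
    (\forall y \near p, S y -> H10 S y (K' y)) \/
    (\forall y \near p, S y -> conj_bundle (H10 S) y (K' y))].
Proof.
move=> [sec|sec]; have [K' [sK KK FK]] := section_ext sec openT I Sp; exists K'.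
  by split=> //; [apply: filterS FK => y H /H; exact: H10_CT|left].
split=> //; last by right.
by apply: filterS FK => y H /H[w Hw <-]; apply: CT_conj; exact: H10_CT.
Qed.

(** The functions differentiated in a dual form are defined through choices and matter only on S; a
    smooth ambient representative is built letter by letter. *)
Lemma levi_deriv_ext Ks L2 L1 :
  (forall K, K \in Ks -> is_section_or_conj S (H10 S) setT K) ->
  is_section_or_conj S (H10 S) setT L2 -> is_section_or_conj S (H10 S) setT L1 ->
  exists g, csm p g /\ eqS S p (levi_deriv S theta Ks L2 L1) g.
Proof.
move=> HK /H10_section_ext[M2 [s2 e2 t2 _]] /H10_section_ext[M1 [s1 e1 t1 _]].
elim: Ks HK => [|K Ks IH] HK.
  have [eta [se eE]] := contact_smooth.
  exists (fun y => pairing eta y (brk M2 M1 y)); split.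
    by apply: csm_pairing => //; exact: vsm_brk.
  have tB := tanS_brk Sp (local_defining_function D Up) s2 s1 t2 t1.
  apply: filterS3 eE tB (bracket_ext Sp s2 s1 t2 t1 e2 e1) => y eE' tB' B Sy.
  by rewrite /levi_deriv /= /levi (B Sy) eE' //; exact: tB'.
have [g [sg gE]] : exists g, csm p g /\ eqS S p (levi_deriv S theta Ks L2 L1) g.
  by apply: IH => K' K'in; apply: HK; rewrite in_cons K'in orbT.
have [K' [sK KK tK _]] := H10_section_ext (HK K (mem_head _ _)).
exists (der K' g); split; first exact: csm_der.
apply: filterS3 (csm_near sg) (near_and KK tK) (eqS_near gE) => y sg' [KK' tK'] gE' Sy.
have KE := KK' Sy.
rewrite ddirE -KE; apply: vf_app_ext => //.
by rewrite KE; exact: tK'.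
Qed.

(** A dual form with [t >= 2] is thereby the restriction to [H10] of the differential of a smooth
    real function near [p]. *)
Lemma dual_form_function (om : T -> 'cV[R[i]]_(n + n)) Ks L2 L1 :
  (forall K, K \in Ks -> is_section_or_conj S (H10 S) setT K) ->
  is_section_or_conj S (H10 S) setT L2 -> is_section_or_conj S (H10 S) setT L1 ->
  (forall L x, is_section S (H10 S) setT L -> S x ->
     pairing om x (L x) =
     vf_app S L (fun y => rc (complex.Re (levi_deriv S theta Ks L2 L1 y))) x) ->
  exists g : T -> R, rsm p g /\
    \forall y \near p, S y -> forall v, H10 S y v ->
      pairing om y v = ddir (fun z => rc (g z)) y v.
Proof.
move=> HK H2 H1 omE; have [g0 [sg gE]] := levi_deriv_ext HK H2 H1.
exists (fun y => complex.Re (g0 y)); split; first exact: sg.1.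
apply: filterS2 (csm_near sg) (eqS_near gE) => y sg' gE' Sy v Hv.
have [_ [xi vE]] := Hv.
have hs := hsec_section xi HS.
have hv : hsec S xi y = v by rewrite hsec_id -?vE.
rewrite -hv omE //.
apply: vf_app_ext => //.
- by rewrite hv; exact: H10_CT.
- exact: csm_real sg'.1.
- by apply: filterS gE' => z H Sz; rewrite H.
Qed.

Lemma ddir_real_conj (g : T -> R) y v :
  ddir (fun z => rc (g z)) y (vconj v) = conjc (ddir (fun z => rc (g z)) y v).
Proof.
rewrite /ddir conjc_sum; apply: eq_bigr => j _.
by rewrite cpartial_real conjcM conjc_real vconjE.
Qed.

(** If [L1] has type (1,0), [Om] vanishes for reasons of type. If it has type (0,1), the
    Cauchy-Schwarz inequality with [Om v (conj v) = 0] forces the value to be zero. *)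
Lemma dual_form_levi (om : T -> 'cV[R[i]]_(n + n)) L1 v :
  is_section_or_conj S (H10 S) setT L1 ->
  (forall L x, is_section S (H10 S) setT L -> S x ->
     pairing om x (L x) = levi S theta L L1 x) ->
  H10 S p v -> Om rho p v (vconj v) = 0 -> pairing om p v = 0.
Proof.
move=> H1 omE Hv Ov; have [_ [xi vE]] := Hv.
have sr := defining_rsm D Up.
have hs := hsec_section xi HS.
have hv : hsec S xi p = v by rewrite hsec_id -?vE.
have [L [sL LE HL]] := section_ext hs openT I Sp.
have tL : tanS S p L by apply: filterS HL => y H /H; exact: H10_CT.
have [M [sM ME tM FM]] := H10_section_ext H1.
have Lp : L p = v by rewrite -(nbhs_singleton LE Sp).
have zM : \forall z \near p, S z -> th0 rho z (M z) = 0.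
  case: FM => FM; first exact: th0_H10.
  by apply: filterS FM => y F /F[w [_ [eta ->]] <-]; exact: th0_conj_dz.
rewrite -hv omE // /levi (nbhs_singleton (bracket_ext Sp sL sM tL tM LE ME) Sp).
rewrite (levi_Om D Up Sp CF I sL sM tL tM (th0_H10 HL) zM).
suff -> : Om rho p (L p) (M p) = 0 by rewrite mulr0 oppr0.
case: FM => /nbhs_singleton /(_ Sp).
  by move=> [_ [eta ->]]; rewrite Lp vE Om_dz.
move=> [w Hw <-]; rewrite Lp.
have [c c0 pos] := nbhs_singleton (levi_semidefinite HS PC D Up Sp) Sp.
have := Om_CS D Up Sp c0 pos Hv Hw; rewrite Ov mul0r.
move=> le; have : Om rho p v (vconj w) * conjc (Om rho p v (vconj w)) = 0.
  by apply/eqP; rewrite eq_le le mulcJ_ge0.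
by move=> /eqP; rewrite mulf_eq0 conjc_eq0 orbb => /eqP.
Qed.

Hypothesis specE : exists l (om : 'I_l -> T -> 'cV[R[i]]_(n + n)),
    [/\ forall i, dual_form S theta (om i),
        forall x, S x -> wedge_neq0 S om x &
        forall x, S x ->
          E x = [set v | H10 S x v /\ forall i, pairing (om i) x v = 0]].

Lemma orbit_H10_E X Y xi : orbit_fields X -> orbit_fields Y ->
  X p + 'i%C *: Y p = dz_vec xi -> E p (dz_vec xi).
Proof.
move=> AX AY vE; have [l [om [dual _ EE]]] := specE.
have [[sX tX rX _] _ _ nX] := AX; have [[sY tY rY _] _ _ nY] := AY.
have Hv : H10 S p (dz_vec xi).
  split; last by exists xi.
  rewrite -vE; apply: CT_add => //; first exact: (nbhs_singleton tX).
  by apply: CT_scale; exact: (nbhs_singleton tY).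
(* As [X] and [Y] are real, this expands into values of [Om] on pairs formed from [X] and [Y], all
   zero by antisymmetry or [orbit_fields_Om]. *)
have Ov : Om rho p (dz_vec xi) (vconj (dz_vec xi)) = 0.
  rewrite -vE vconjD vconjZ conjc_i rX rY !OmDl !OmDr !OmZl !OmZr !Om_self.
  by rewrite (orbit_fields_Om AX AY) (orbit_fields_Om AY AX) !mulr0 !addr0.
rewrite EE //; split=> // i.
case: (dual i) => [[L1 [H1 omE]]|[Ks [L2 [L1 [HK H2 H1 omE]]]]].
  exact: dual_form_levi H1 omE Hv Ov.
have [g [sg gE]] := dual_form_function HK H2 H1 omE.
rewrite (nbhs_singleton gE Sp _ Hv) -vE ddirD ddirZ.
(* Sections of [E] kill [g] on S because the dual form vanishes on [E]; conjugate sections do so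
   because [g] is real. *)
have ann : annihilated (fun z => rc (g z)).
  split; first exact: csm_real.
  move=> Z [[sZ EZ]|[sZ EZ]]; apply: filterS2 gE EZ => y gE' EZ' Sy.
    have := EZ' Sy; rewrite EE // => -[HZ Z0].
    by rewrite ddirE -gE' //; exact: Z0.
  have := EZ' Sy; rewrite EE // => -[HZ Z0].
  rewrite ddirE -[Z y]vconjK ddir_real_conj -gE' // (Z0 i) conjc0 //.
have zX := nbhs_singleton (nX _ ann) Sp; have zY := nbhs_singleton (nY _ ann) Sp.
by rewrite ddirE in zX; rewrite ddirE in zY; rewrite zX zY mulr0 addr0.
Qed.

(** The vector is expanded in a local frame of [E] at [p], and the coefficients are kept
    constant. *)
Lemma E_local_section xi : E p (dz_vec xi) ->
  exists a : T -> 'rV[R[i]]_n, [/\ forall k, csm p (fun y => a y 0 k), a p = xi &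
    \forall y \near p, S y -> E y (dz_vec (a y))].
Proof.
move=> Ev; have [_ [r fr]] := subE; have [W [e [oW Wp secE _ Ee]]] := fr p Sp.
have [c cE] : exists c, dz_vec xi = c *m e p.
  by apply/submxP; apply/(Ee p _ Sp Wp).
have ext i : exists L', [/\ vsm p L', veqS S p (fun y => row i (e y)) L' &
    \forall y \near p, S y -> E y (L' y)].
  exact: section_ext (secE i) oW Wp Sp.
pose L i := sval (cid (ext i)).
have LP i : [/\ vsm p (L i), veqS S p (fun y => row i (e y)) (L i) &
    \forall y \near p, S y -> E y (L i y)] by exact: svalP (cid (ext i)).
pose M y := \sum_i c 0 i *: L i y.
have ME : \forall y \near p, S y -> M y = c *m e y.
  have H : \forall y \near p, forall i, S y -> row i (e y) = L i y.
    apply: (@filter_forall _ _ (fun i y => S y -> row i (e y) = L i y) (nbhs p) _) => i.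
    by have [_] := LP i.
  apply: filterS H => y H Sy; rewrite mulmx_sum_row; apply: eq_bigr => i _.
  by rewrite H.
have sM : vsm p M.
  move=> j; apply: csm_eq (csm_sum _ (fun i => csmM (csm_cst p (c 0 i)) ((let: And3 h _ _ := LP i in h) j))).
  by apply: filterE => y; rewrite /M summxE; apply: eq_bigr => i _; rewrite mxE.
have EM : \forall y \near p, S y -> E y (M y).
  apply: filterS2 (open_nbhs_nbhs (conj oW Wp)) ME => y Wy ME' Sy.
  by apply/(Ee y _ Sy Wy); rewrite ME' //; exact: submxMl.
exists (fun y => comp10 (M y)); split.
- by move=> k; exact: csm_comp10.
- by rewrite (nbhs_singleton ME Sp) -cE comp10_dz.
- apply: filterS EM => y EM' Sy; have EMy := EM' Sy.
  by have [_ [eta Me]] := E_H10 Sy EMy; move: EMy; rewrite Me comp10_dz.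
Qed.

End SpecialSubbundle.

(** * Taylor series *)

Section FormalAlgebra.
Context {K : numFieldType} {N : nat}.
Implicit Types (F G : fps K N) (m : {ffun 'I_N -> nat}) (X : fvf K N).

Definition mincr (j : 'I_N) m : {ffun 'I_N -> nat} := [ffun i => (m i + (i == j))%N].

Definition mdeg m := (\sum_i m i)%N.

Lemma fderivE j F m : fderiv j F m = F (mincr j m) *+ (m j).+1.
Proof. by []. Qed.

(** With [fderiv_inj], the induction principle for identities between series: compare the values at
    the base point, then the derivatives, whose coefficients have lower degree. *)
Lemma mdeg_case m : (m = [ffun=> 0%N]) \/
  exists j m', m = mincr j m' /\ mdeg m = (mdeg m').+1.
Proof.
have [/eqP m0|] := boolP (mdeg m == 0%N).
  left; apply/ffunP => i; rewrite ffunE.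
  by move/eqP: m0; rewrite /mdeg sum_nat_eq0 => /forallP /(_ i) /eqP.
rewrite /mdeg sum_nat_eq0 negb_forall => /existsP[j] /= mj; right.
pose m' : {ffun 'I_N -> nat} := [ffun i => (m i - (i == j))%N].
exists j, m'.
have E : m = mincr j m'.
  apply/ffunP => i; rewrite !ffunE; case: eqP => [->|_] /=; last by rewrite subn0 addn0.
  by rewrite subnK // lt0n.
split=> //; rewrite {1}E /mdeg (bigD1 j) //= [in RHS](bigD1 j) //= !ffunE eqxx addn1 addSn.
congr (_ + _).+1; apply: eq_bigr => i ij.
by rewrite ffunE (negbTE ij) addn0.
Qed.

Lemma fderiv_inj j F G m : fderiv j F m = fderiv j G m -> F (mincr j m) = G (mincr j m).
Proof. by rewrite !fderivE => /eqP; rewrite eqr_pMn2r // => /eqP. Qed.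

Definition midx B (k : {ffun 'I_N -> 'I_B.+1}) : {ffun 'I_N -> nat} := [ffun i => k i : nat].

Definition msub m B (k : {ffun 'I_N -> 'I_B.+1}) : {ffun 'I_N -> nat} := [ffun i => (m i - k i)%N].

(** The index type in [fmul] depends on [m]. A common bound [B] gives one index type for [m] and its
    successors, so that sums can be reindexed. *)
Lemma fmulE B F G m : (forall i, m i <= B)%N ->
  fmul F G m = \sum_(k : {ffun 'I_N -> 'I_B.+1} | [forall i, k i <= m i]%N)
    F (midx k) * G (msub m k).
Proof.
move=> mB; rewrite /fmul.
pose h (k : {dffun forall i : 'I_N, 'I_(m i).+1}) : {ffun 'I_N -> 'I_B.+1} :=
  [ffun i => inord (k i)].
pose h' (k : {ffun 'I_N -> 'I_B.+1}) : {dffun forall i : 'I_N, 'I_(m i).+1} :=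
  [ffun i => inord (k i) : 'I_(m i).+1].
have hE k i : h k i = k i :> nat.
  by rewrite ffunE inordK // (leq_trans (ltn_ord (k i))) // ltnS.
rewrite [RHS](reindex_onto h h') => [|k /forallP km]; last first.
  by apply/ffunP => i; apply: val_inj; rewrite /= hE ffunE inordK // ltnS.
apply: eq_big => [k|k _].
  apply/esym/andP; split.
    by apply/forallP => i; rewrite hE -ltnS.
  by apply/eqP/ffunP => i; apply: val_inj; rewrite /= ffunE hE inord_val.
by congr (F _ * G _); apply/ffunP => i; rewrite !ffunE inordK // (leq_trans (ltn_ord (k i))) // ltnS.
Qed.

Lemma fmul_bound m : exists B, forall i, (m i <= B)%N.
Proof. by exists (\max_i m i) => i; exact: leq_bigmax. Qed.

Lemma fval_fmul F G : fval (fmul F G) = fval F * fval G.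
Proof.
rewrite /fval (@fmulE 0) => [|i]; last by rewrite ffunE.
rewrite (big_pred1 [ffun=> ord0]) => [|k].
  by congr (F _ * G _); apply/ffunP => i; rewrite !ffunE.
apply/forallP/eqP => [_|-> i]; last by rewrite !ffunE.
by apply/ffunP => i; rewrite ffunE; exact: ord1.
Qed.

Definition fone : fps K N := fun m => (m == [ffun=> 0%N])%:R.

Lemma fmul1 F : fmul fone F = F.
Proof.
apply/funext => m; have [B mB] := fmul_bound m.
rewrite (fmulE _ _ mB) (bigD1 [ffun=> ord0]) /=; last by apply/forallP => i; rewrite ffunE.
rewrite big1 ?addr0 => [|k /andP[_ k0]].
  rewrite /fone (_ : midx _ = [ffun=> 0%N]) ?eqxx ?mul1r.
    by congr F; apply/ffunP => i; rewrite !ffunE subn0.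
  by apply/ffunP => i; rewrite !ffunE.
rewrite /fone (_ : (midx k == _) = false) ?mul0r //.
apply: contraNF k0 => /eqP /ffunP E; apply/eqP/ffunP => i.
by apply: val_inj; have := E i; rewrite !ffunE.
Qed.

(** The weight [m_j + 1] is split as [k_j] plus [m_j + 1 - k_j]. In the first sum the terms with
    [k_j = 0] drop out and [k] is shifted by one in position [j]; in the second the terms with
    [k_j = m_j + 1] drop out. *)
Lemma fderiv_fmul j F G m :
  fderiv j (fmul F G) m = fmul (fderiv j F) G m + fmul F (fderiv j G) m.
Proof.
have [B0 mB0] := fmul_bound m.
(* One more than a bound for [m], so that [mincr j m] is bounded as well. *)
pose B := B0.+1.
have mB i : (m i <= B)%N by rewrite (leq_trans (mB0 i)).
have mB' i : (mincr j m i <= B)%N.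
  by rewrite ffunE /B; have := mB0 i; case: (i == j); lia.
rewrite fderivE (fmulE _ _ mB') (fmulE (fderiv j F) _ mB) (fmulE F _ mB).
rewrite -sumrMnl.
pose A (k : {ffun 'I_N -> 'I_B.+1}) := F (midx k) * G (msub (mincr j m) k).
rewrite (eq_bigr (fun k => A k *+ k j + A k *+ ((m j).+1 - k j))); last first.
  move=> k /forallP /(_ j); rewrite ffunE eqxx addn1 => kj.
  by rewrite -mulrnDr subnKC.
rewrite big_split /=; congr (_ + _).
- rewrite (bigID (fun k : {ffun 'I_N -> 'I_B.+1} => (0 < k j)%N)) /= [X in _ + X]big1 ?addr0; last first.
    by move=> k /andP[_]; rewrite lt0n negbK => /eqP ->.
  pose h (k : {ffun 'I_N -> 'I_B.+1}) : {ffun 'I_N -> 'I_B.+1} := [ffun i => inord (k i + (i == j))].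
  pose h' (k : {ffun 'I_N -> 'I_B.+1}) : {ffun 'I_N -> 'I_B.+1} := [ffun i => inord (k i - (i == j))].
  have h'E k i : h' k i = (k i - (i == j))%N :> nat.
    by rewrite ffunE inordK //; have := ltn_ord (k i); lia.
  have hE (k : {ffun 'I_N -> 'I_B.+1}) i : (forall i, k i <= m i)%N -> h k i = (k i + (i == j))%N :> nat.
    move=> km; rewrite ffunE inordK //; have := km i; have := mB0 i; rewrite /B.
    by case: (i == j); lia.
  rewrite (reindex_onto h h') => [|k /andP[/forallP km kj]]; last first.
    have h'm i : (h' k i <= m i)%N.
      by rewrite h'E; have := km i; rewrite ffunE; case: (i == j); lia.
    apply/ffunP => i; apply: val_inj; rewrite /= hE // h'E.
    by case: eqP => [->|_]; rewrite ?subn0 ?addn0 //= subnK.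
  apply: eq_big => [k|k].
    apply/idP/forallP => [/andP[/andP[/forallP H1 H2] /eqP H3] i|km].
      have := h'E (h k) i; rewrite H3; have := H1 i; rewrite [mincr j m i]ffunE.
      by move=> le ->; rewrite leq_subLR addnC.
    apply/andP; split; [apply/andP; split|].
    - by apply/forallP => i; rewrite hE // ffunE leq_add2r.
    - by rewrite hE // eqxx addn1.
    - apply/eqP/ffunP => i; apply: val_inj; rewrite /= h'E hE // addnK //.
  move=> /andP[/andP[/forallP H1 H2] /eqP H3].
  have km i : (k i <= m i)%N.
    have := h'E (h k) i; rewrite H3; have := H1 i; rewrite [mincr j m i]ffunE.
    by move=> le ->; rewrite leq_subLR addnC.
  rewrite /A hE // eqxx addn1 -mulrnAl fderivE ffunE; congr (F _ *+ _ * G _).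
    by apply/ffunP => i; rewrite ffunE hE // !ffunE.
  by apply/ffunP => i; rewrite ffunE hE // !ffunE; lia.
- rewrite (bigID (fun k : {ffun 'I_N -> 'I_B.+1} => (k j <= m j)%N)) /= [X in _ + X]big1 ?addr0; last first.
    by move=> k /andP[_]; rewrite -ltnNge => kj; rewrite (_ : _ - _ = 0)%N //; lia.
  apply: eq_big => [k|k /andP[/forallP km kj]].
    apply/andP/forallP => [[/forallP km kj] i|km].
      have := km i; rewrite ffunE; case: eqP => [->|_] //=.
      by rewrite addn0.
    split; last exact: km.
    by apply/forallP => i; rewrite ffunE (leq_trans (km i)) // leq_addr.
  have km' i : (k i <= m i)%N.
    have := km i; rewrite ffunE; case: eqP => [->|_] //=.
    by rewrite addn0.
  rewrite /A -mulrnAr fderivE ffunE subSn //; congr (_ * (G _ *+ _)).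
  by apply/ffunP => i; rewrite !ffunE addnBAC.
Qed.

Lemma fmulDl F1 F2 G m : fmul (fun m => F1 m + F2 m) G m = fmul F1 G m + fmul F2 G m.
Proof. by rewrite /fmul -big_split; apply: eq_bigr => k _; rewrite mulrDl. Qed.

Lemma fmulDr F G1 G2 m : fmul F (fun m => G1 m + G2 m) m = fmul F G1 m + fmul F G2 m.
Proof. by rewrite /fmul -big_split; apply: eq_bigr => k _; rewrite mulrDr. Qed.

Lemma fmulZl (a : K) F G m : fmul (fun m => a * F m) G m = a * fmul F G m.
Proof. by rewrite /fmul mulr_sumr; apply: eq_bigr => k _; rewrite mulrA. Qed.

Lemma fmulZr (a : K) F G m : fmul F (fun m => a * G m) m = a * fmul F G m.
Proof. by rewrite /fmul mulr_sumr; apply: eq_bigr => k _; rewrite mulrCA. Qed.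

Lemma fmul0l G m : fmul (fun=> 0) G m = 0.
Proof. by rewrite /fmul big1 // => k _; rewrite mul0r. Qed.

Lemma fval_fapp X F : fval (fapp X F) = \sum_j fval (X j) * fval (fderiv j F).
Proof. by rewrite {1}/fval /fapp; apply: eq_bigr => j _; rewrite -fval_fmul. Qed.

End FormalAlgebra.

(** * Compatibility of Taylor series with the operations on functions and fields *)

Section Taylor.
Context {R : realType} {n : nat}.
Local Notation T := 'rV[R]_(n + n).
Local Notation rc := (real_complex R).
Implicit Types (p : T) (f g : T -> R[i]) (m : {ffun 'I_(n + n) -> nat}).

Definition mpartial m (r : seq 'I_(n + n)) f : T -> R[i] :=
  foldr (fun j g => iter (m j) (cpartial j) g) f r.

Lemma csm_iter p k j f : csm p f -> csm p (iter k (cpartial j) f).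
Proof. by move=> sf; elim: k => //= k; exact: csm_cpartial. Qed.

Lemma csm_mpartial p m r f : csm p f -> csm p (mpartial m r f).
Proof. by move=> sf; elim: r => //= j r; exact: csm_iter. Qed.

Lemma cpartial_eq_near p j f g : (\forall y \near p, f y = g y) ->
  \forall y \near p, cpartial j f y = cpartial j g y.
Proof. by move/near_join => H; apply: filterS H => y; exact: cpartial_eq. Qed.

Lemma iter_cpartial_eq p k j f g : (\forall y \near p, f y = g y) ->
  \forall y \near p, iter k (cpartial j) f y = iter k (cpartial j) g y.
Proof. by move=> fg; elim: k => //= k; exact: cpartial_eq_near. Qed.

Lemma near_trans (A : Type) p (f g h : T -> A) : (\forall y \near p, f y = g y) ->
  (\forall y \near p, g y = h y) -> \forall y \near p, f y = h y.
Proof. by move=> fg gh; apply: filterS2 fg gh => y -> ->. Qed.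

Lemma iter_cpartialC p k i j f : csm p f ->
  \forall y \near p, iter k (cpartial i) (cpartial j f) y = cpartial j (iter k (cpartial i) f) y.
Proof.
move=> sf; elim: k => [|k IH] /=; first exact: filterE.
apply: near_trans (cpartial_eq_near i IH) _.
by apply: filterS (csm_near (csm_iter k i sf)) => y; exact: cpartialC.
Qed.

Lemma mpartial_notin p m r j f : csm p f -> j \notin r ->
  \forall y \near p, mpartial m r (cpartial j f) y = cpartial j (mpartial m r f) y.
Proof.
move=> sf; elim: r => [|i r IH]; first by move=> _; exact: filterE.
rewrite in_cons negb_or => /andP[_ /IH H] /=.
apply: near_trans (iter_cpartial_eq (m i) i H) _.
exact: iter_cpartialC (csm_mpartial m r sf).
Qed.

Lemma mpartial_incr_notin m r j f : j \notin r -> mpartial (mincr j m) r f = mpartial m r f.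
Proof.
elim: r => //= i r IH; rewrite in_cons negb_or => /andP[ij /IH ->].
by rewrite ffunE eq_sym (negbTE ij) addn0.
Qed.

Lemma mpartial_incr p m r j f : csm p f -> uniq r -> j \in r ->
  \forall y \near p, mpartial (mincr j m) r f y = mpartial m r (cpartial j f) y.
Proof.
move=> sf; elim: r => //= i r IH /andP[ir ur]; rewrite in_cons.
have [-> _|ji /= jr] := eqVneq j i.
  rewrite mpartial_incr_notin // ffunE eqxx addn1 iterSr.
  apply: iter_cpartial_eq.
  have H := mpartial_notin m sf ir.
  by apply: filterS H => y ->.
rewrite ffunE eq_sym (negbTE ji) addn0.
by apply: iter_cpartial_eq; exact: IH.
Qed.

Lemma taylorE p f m :
  taylor p f m = mpartial m (enum 'I_(n + n)) f p / (\prod_j (m j)`!)%N%:R.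
Proof. by []. Qed.

Lemma fval_taylor p f : fval (taylor p f) = f p.
Proof.
rewrite /fval taylorE (_ : mpartial _ _ f = f).
  by rewrite big1 ?divr1 // => j _; rewrite ffunE.
by elim: (enum _) => //= j r ->; rewrite ffunE.
Qed.

(** Partial derivatives commute, so the extra derivative can be brought innermost; the extra factor
    of the factorial cancels the coefficient [m_j + 1] of formal differentiation. The Taylor
    identities below follow by induction on the degree. *)
Lemma fderiv_taylor p f j : csm p f -> fderiv j (taylor p f) = taylor p (cpartial j f).
Proof.
move=> sf; apply/funext => m; rewrite fderivE !taylorE.
rewrite (nbhs_singleton (mpartial_incr m sf (enum_uniq _) (mem_enum _ j))).
rewrite (bigD1 j) //= [in RHS](bigD1 j) //= !ffunE eqxx addn1 factS.
rewrite (eq_bigr (fun i => (m i)`!)); last by move=> i ij; rewrite ffunE (negbTE ij) addn0.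
rewrite -mulnA natrM.
have C (A q : R[i]) (s : nat) : A / (s.+1%:R * q) *+ s.+1 = A / q.
  by rewrite invfM -mulr_natr mulrAC mulrA mulfK // pnatr_eq0.
exact: C.
Qed.

Lemma taylor_eq p f g : csm p f -> (\forall y \near p, f y = g y) -> taylor p f = taylor p g.
Proof.
move=> sf fg; apply/funext => m; move: {2}(mdeg m) (erefl (mdeg m)) => d.
elim: d m f g sf fg => [|d IH] m f g sf fg dm; case: (mdeg_case m) => [m0|[j [m' [mE dE]]]].
- by rewrite m0 -/(fval (taylor p f)) -/(fval (taylor p g)) !fval_taylor; exact: nbhs_singleton fg.
- by rewrite dE in dm.
- by rewrite m0 -/(fval (taylor p f)) -/(fval (taylor p g)) !fval_taylor; exact: nbhs_singleton fg.
have sg : csm p g by exact: csm_eq fg sf.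
rewrite mE; apply: fderiv_inj; rewrite !fderiv_taylor //.
apply: IH; [exact: csm_cpartial|exact: cpartial_eq_near|by move: dm; rewrite dE => -[]].
Qed.

Lemma taylor_additive p f g m : csm p f -> csm p g ->
  taylor p (fun y => f y + g y) m = taylor p f m + taylor p g m.
Proof.
move: {2}(mdeg m) (erefl (mdeg m)) => d.
elim: d m f g => [|d IH] m f g dm sf sg; case: (mdeg_case m) => [m0|[j [m' [mE dE]]]].
- by rewrite m0 -!/(fval (taylor p _)) !fval_taylor.
- by rewrite dE in dm.
- by rewrite m0 -!/(fval (taylor p _)) !fval_taylor.
have sfg := csmD sf sg.
rewrite mE; apply: (@fderiv_inj _ _ j _ (fun m => taylor p f m + taylor p g m)).
rewrite fderiv_taylor // [RHS]mulrnDl -!fderivE !fderiv_taylor //.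
rewrite -IH; [|by move: dm; rewrite dE => -[]|exact: csm_cpartial|exact: csm_cpartial].
rewrite (@taylor_eq p _ (fun y => cpartial j f y + cpartial j g y)) //; first exact: csm_cpartial.
by apply: filterS2 (csm_near sf) (csm_near sg) => y; exact: cpartialD.
Qed.

Lemma taylorM p f g m : csm p f -> csm p g ->
  taylor p (fun y => f y * g y) m = fmul (taylor p f) (taylor p g) m.
Proof.
move: {2}(mdeg m) (erefl (mdeg m)) => d.
elim: d m f g => [|d IH] m f g dm sf sg; case: (mdeg_case m) => [m0|[j [m' [mE dE]]]].
- by rewrite m0 -!/(fval _) fval_fmul !fval_taylor.
- by rewrite dE in dm.
- by rewrite m0 -!/(fval _) fval_fmul !fval_taylor.
have sfg := csmM sf sg; have sf' := csm_cpartial j sf; have sg' := csm_cpartial j sg.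
have dm' : mdeg m' = d by move: dm; rewrite dE => -[].
rewrite mE; apply: fderiv_inj.
rewrite fderiv_taylor // fderiv_fmul !fderiv_taylor // -!IH //.
rewrite -taylor_additive; [|exact: csmM|exact: csmM].
rewrite (@taylor_eq p _ (fun y => cpartial j f y * g y + f y * cpartial j g y)) //.
  exact: csm_cpartial.
apply: filterS2 (csm_near sf) (csm_near sg) => y sfy sgy.
by rewrite cpartialM // addrC [g y * _]mulrC.
Qed.

Lemma taylor_conj p f m : csm p f -> taylor p (fun y => conjc (f y)) m = conjc (taylor p f m).
Proof.
move: {2}(mdeg m) (erefl (mdeg m)) => d.
elim: d m f => [|d IH] m f dm sf; case: (mdeg_case m) => [m0|[j [m' [mE dE]]]].
- by rewrite m0 -!/(fval (taylor p _)) !fval_taylor.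
- by rewrite dE in dm.
- by rewrite m0 -!/(fval (taylor p _)) !fval_taylor.
have sfc := csm_conj sf.
rewrite mE; apply: (@fderiv_inj _ _ j _ (fun m => conjc (taylor p f m))).
rewrite fderiv_taylor // [RHS]fderivE -rmorphMn -fderivE fderiv_taylor //.
have dm' : mdeg m' = d by move: dm; rewrite dE => -[].
apply: etrans (IH m' _ dm' (csm_cpartial j sf)).
rewrite (@taylor_eq p _ (fun y => conjc (cpartial j f y))) //; first exact: csm_cpartial.
by apply: filterS (csm_near sf) => y; exact: cpartial_conj.
Qed.

Lemma taylor_cst p (c : R[i]) m : taylor p (fun=> c) m = c * fone m.
Proof.
case: (mdeg_case m) => [->|[j [m' [mE dE]]]].
  by rewrite -/(fval (taylor p _)) fval_taylor /fone eqxx mulr1.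
rewrite /fone (_ : (m == _) = false) ?mulr0.
  rewrite mE; apply: (@fderiv_inj _ _ j _ (fun=> 0)).
  rewrite fderiv_taylor; last exact: csm_cst.
  rewrite (_ : cpartial j _ = fun=> 0); last by apply/funext => y; rewrite cpartial_cst.
  rewrite [RHS]mul0rn taylorE (_ : mpartial _ _ _ = fun=> 0) ?mul0r //.
  elim: (enum _) => //= i r ->; elim: (m' i) => //= k ->.
  by apply/funext => y; rewrite cpartial_cst.
apply/eqP => m0; move: dE; rewrite m0 /mdeg big1 // => i _; by rewrite ffunE.
Qed.

Lemma taylorZ p (c : R[i]) f m : csm p f -> taylor p (fun y => c * f y) m = c * taylor p f m.
Proof.
move=> sf; rewrite taylorM //; last exact: csm_cst.
rewrite (_ : taylor p (fun=> c) = fun m => c * fone m); last first.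
  by apply/funext => k; rewrite taylor_cst.
by rewrite fmulZl fmul1.
Qed.

Lemma taylor_sum p (I : Type) (r : seq I) (F : I -> T -> R[i]) m : (forall i, csm p (F i)) ->
  taylor p (fun y => \sum_(i <- r) F i y) m = \sum_(i <- r) taylor p (F i) m.
Proof.
move=> sF; elim: r => [|i r IH].
  rewrite big_nil (@taylor_eq p _ (fun=> 0)) ?taylor_cst ?mul0r //.
    exact: csm_sum.
  by apply: filterE => y; rewrite big_nil.
rewrite big_cons -IH -taylor_additive //; last exact: csm_sum.
rewrite (@taylor_eq p _ (fun y => F i y + \sum_(i <- r) F i y)) //.
  exact: csm_sum.
by apply: filterE => y; rewrite big_cons.
Qed.

Definition taylor_vf p (L : T -> 'rV[R[i]]_(n + n)) : fvf R[i] (n + n) :=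
  fun j => taylor p (fun y => L y 0 j).

Lemma taylor_der p L f m : vsm p L -> csm p f ->
  taylor p (der L f) m = fapp (taylor_vf p L) (taylor p f) m.
Proof.
move=> sL sf; rewrite /der taylor_sum; last by move=> j; apply: csmM => //; exact: csm_cpartial.
apply: eq_bigr => j _; rewrite taylorM //; last exact: csm_cpartial.
by rewrite fderiv_taylor.
Qed.

Lemma taylor_brk p L M j m : vsm p L -> vsm p M ->
  taylor_vf p (brk L M) j m = fbracket (taylor_vf p L) (taylor_vf p M) j m.
Proof.
move=> sL sM; rewrite /taylor_vf /fbracket.
rewrite -!taylor_der // (@taylor_eq p _ (fun y => der L (fun z => M z 0 j) y + -1 * der M (fun z => L z 0 j) y)).
- rewrite taylor_additive; [|exact: csm_der|by apply: csmM; [exact: csm_cst|exact: csm_der]].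
  by rewrite taylorZ ?mulN1r //; exact: csm_der.
- exact: vsm_brk.
- by apply: filterE => y; rewrite mxE mulN1r.
Qed.

Definition cplx (F : fps R (n + n)) : fps R[i] (n + n) := fun m => rc (F m).

Lemma fmul_cplx F G : fmul (cplx F) (cplx G) = cplx (fmul F G).
Proof.
apply/funext => m; rewrite /cplx /fmul rmorph_sum; apply: eq_bigr => k _.
by rewrite rmorphM.
Qed.

Lemma fderiv_cplx j F : fderiv j (cplx F) = cplx (fderiv j F).
Proof. by apply/funext => m; rewrite /fderiv /cplx rmorphMn. Qed.

Lemma fapp_cplx (X : fvf R (n + n)) F : fapp (fun j => cplx (X j)) (cplx F) = cplx (fapp X F).
Proof.
apply/funext => m; rewrite /fapp [RHS]/cplx rmorph_sum; apply: eq_bigr => j _.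
by rewrite fderiv_cplx fmul_cplx.
Qed.

End Taylor.

(** * Formal submanifolds and the orbit *)

Section FormalSubmanifold.
Context {R : realType} {n : nat}.
Local Notation T := 'rV[R]_(n + n).
Local Notation V := 'rV[R[i]]_(n + n).
Local Notation rc := (real_complex R).
Implicit Types (I : set (fps R (n + n))) (p : T).

Lemma formal_submanifold_closed I k : formal_submanifold I k ->
  [/\ I (fun=> 0), forall F G, I F -> I G -> I (fun m => F m + G m) &
      forall (c : R) F, I F -> I (fun m => c * F m)].
Proof.
move=> [h [_ _ ->]]; split.
- by exists (fun _ _ => 0); apply/funext => m; rewrite big1 // => i _; rewrite fmul0l.
- move=> F G [a ->] [b ->]; exists (fun i m => a i m + b i m); apply/funext => m.
  by rewrite -big_split; apply: eq_bigr => i _; rewrite fmulDl.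
- move=> c F [a ->]; exists (fun i m => c * a i m); apply/funext => m.
  by rewrite mulr_sumr; apply: eq_bigr => i _; rewrite fmulZl.
Qed.

(** Values of tangent fields are killed by the differentials of the generators. These being
    independent, their common kernel has dimension [n + n - k], the dimension of [vs], so the
    inclusion is an equality. *)
Lemma formal_tangent_values I k (vs : {vspace T}) (h : 'I_k -> fps R (n + n)) :
  (forall i, fval (h i) = 0) ->
  row_free (\matrix_(i, j) fval (fderiv j (h i))) ->
  I = [set f | exists a : 'I_k -> fps R (n + n), f = fun m => \sum_i fmul (a i) (h i) m] ->
  \dim vs = (n + n - k)%N ->
  (forall w, w \in vs -> exists2 X, ftangent I X & w = fvalue X) ->
  forall w : T, (forall i, \sum_j w 0 j * fval (fderiv j (h i)) = 0) -> w \in vs.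
Proof.
move=> h0 rf IE dimv tv.
set M := \matrix_(i, j) _ in rf.
have Ih i : I (h i).
  rewrite IE; exists (fun i' => if i' == i then fone else fun=> 0); apply/funext => m.
  rewrite (bigD1 i) //= eqxx fmul1 big1 ?addr0 // => i' /negbTE ->.
  by rewrite fmul0l.
have I0 F : I F -> fval F = 0.
  rewrite IE => -[a ->]; rewrite /fval big1 // => i _.
  by rewrite -/(fval (fmul _ _)) fval_fmul h0 mulr0.
pose f : 'Hom(T, 'rV[R]_k) := linfun (mulmxr M^T).
have fE w i : f w 0 i = \sum_j w 0 j * fval (fderiv j (h i)).
  by rewrite lfunE /= mxE; apply: eq_bigr => j _; rewrite !mxE.
have sub : (vs <= lker f)%VS.
  apply/subvP => w /tv[X tX ->]; rewrite memv_ker; apply/eqP/rowP => i.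
  rewrite fE [RHS]mxE; apply: etrans _ (I0 _ (tX _ (Ih i))).
  by rewrite fval_fapp; apply: eq_bigr => j _; rewrite mxE.
have full : (f @: fullv = fullv)%VS.
  apply/eqP; rewrite eqEsubv subvf; apply/subvP => u _.
  have : (u <= M^T)%MS.
    by apply: submx_full; rewrite -col_leq_rank mxrank_tr row_leq_rank.
  move=> /submxP[w ->].
  rewrite (_ : w *m M^T = f w); last by rewrite lfunE.
  by apply: memv_img; exact: memvf.
have := limg_ker_dim f fullv; rewrite full !dimvf capfv => dk.
have dimk : \dim (lker f) = (n + n - k)%N.
  by move: dk; rewrite /dim /= !mul1n => dk; move: (congr1 (subn^~ k) dk); rewrite addnK.
have E : (vs == lker f)%VS by rewrite eqEdim sub dimv dimk leqnn.
move=> w w0; rewrite (eqP E) memv_ker; apply/eqP/rowP => i.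
by rewrite fE w0 mxE.
Qed.

Definition re_fps (F : fps R[i] (n + n)) : fps R (n + n) := fun m => complex.Re (F m).
Definition im_fps (F : fps R[i] (n + n)) : fps R (n + n) := fun m => complex.Im (F m).

Lemma Re_fapp (X : fvf R[i] (n + n)) F m :
  complex.Re (fapp X F m) =
  fapp (re_vf X) (re_fps F) m - fapp (fun j => im_fps (X j)) (im_fps F) m.
Proof.
rewrite /fapp cRe_sum -sumrB; apply: eq_bigr => j _.
rewrite /fmul cRe_sum -sumrB; apply: eq_bigr => k _.
rewrite cReM /fderiv; congr (_ * _ - _ * _).
  exact: (raddfMn (@complex.Re R : Rcomplex R -> R)).
exact: (raddfMn (@complex.Im R : Rcomplex R -> R)).
Qed.

Lemma Im_fapp (X : fvf R[i] (n + n)) F m :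
  complex.Im (fapp X F m) =
  fapp (re_vf X) (im_fps F) m + fapp (fun j => im_fps (X j)) (re_fps F) m.
Proof.
rewrite /fapp cIm_sum -big_split; apply: eq_bigr => j _.
rewrite /fmul cIm_sum -big_split; apply: eq_bigr => k _.
rewrite /= cImM /fderiv; congr (_ * _ + _ * _).
  exact: (raddfMn (@complex.Im R : Rcomplex R -> R)).
exact: (raddfMn (@complex.Re R : Rcomplex R -> R)).
Qed.

Lemma fapp_opp (X : fvf R (n + n)) F m :
  fapp (fun j m => - X j m) F m = -1 * fapp X F m.
Proof.
rewrite /fapp mulr_sumr; apply: eq_bigr => j _.
by rewrite -fmulZl; congr fmul; apply/funext => k; rewrite mulN1r.
Qed.

(** The imaginary part of a field is minus the real part of its product by i. Thus both real fields
    making up the complex one are tangent, and it preserves the complexified ideal. *)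
Lemma tangent_dz_D10 I k p (a : T -> 'rV[R[i]]_n) : formal_submanifold I k ->
  (forall j, csm p (fun y => a y 0 j)) ->
  ftangent I (re_vf (taylor_vf p (fun y => dz_vec (a y)))) ->
  ftangent I (re_vf (taylor_vf p (fun y => 'i%C *: dz_vec (a y)))) ->
  D10 I (fun j => taylor p (fun y => a y 0 j)).
Proof.
move=> fI sa tX tiX f [If1 If2].
have [_ ID IZ] := formal_submanifold_closed fI.
set X := taylor_vf p (fun y => dz_vec (a y)) in tX.
have sX : vsm p (fun y => dz_vec (a y)) by exact: vsm_dz.
have XE m : \sum_j fmul (taylor p (fun y => a y 0 j)) (fdz j f) m = fapp X f m.
  rewrite /fapp big_split_ord /= -big_split /=; apply: eq_bigr => j _.
  have El : X (lshift n j) = fun m => 2^-1 * taylor p (fun y => a y 0 j) m.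
    apply/funext => m'; rewrite -taylorZ // /X /taylor_vf.
    rewrite (@taylor_eq _ _ p (fun y => dz_vec (a y) 0 (lshift n j)) (fun y => 2^-1 * a y 0 j)) //.
    by apply: filterE => y; rewrite dz_vec_l mulrC.
  have Er : X (rshift n j) = fun m => - ('i%C / 2) * taylor p (fun y => a y 0 j) m.
    apply/funext => m'; rewrite -taylorZ // /X /taylor_vf.
    rewrite (@taylor_eq _ _ p (fun y => dz_vec (a y) 0 (rshift n j)) (fun y => - ('i%C / 2) * a y 0 j)) //.
    by apply: filterE => y; rewrite dz_vec_r; ring.
  rewrite El Er !fmulZl.
  rewrite (_ : fdz j f = fun m => 2^-1 * (fderiv (lshift n j) f m + - 'i%C * fderiv (rshift n j) f m)).
    by rewrite fmulZr fmulDr fmulZr; ring.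
  by apply/funext => m'; rewrite /fdz mulrC mulNr.
have imE : (fun j => im_fps (X j)) =
    fun j m => - re_vf (taylor_vf p (fun y => 'i%C *: dz_vec (a y))) j m.
  apply/funext => j; apply/funext => m.
  have H : taylor_vf p (fun y => 'i%C *: dz_vec (a y)) j = fun m => 'i%C * X j m.
    apply/funext => m'; rewrite /X /taylor_vf -taylorZ; last exact: sX.
    rewrite (@taylor_eq _ _ p (fun y => ('i%C *: dz_vec (a y)) 0 j) (fun y => 'i%C * dz_vec (a y) 0 j)) //.
      by apply: (@vsm_scale _ _ p (fun=> 'i%C)) => //; exact: csm_cst.
    by apply: filterE => y; rewrite mxE.
  by rewrite /re_vf H /im_fps cReM /= mul0r mul1r sub0r opprK.
split.
  rewrite (_ : (fun m => _) = fun m => fapp (re_vf X) (re_fps f) m +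
      fapp (re_vf (taylor_vf p (fun y => 'i%C *: dz_vec (a y)))) (im_fps f) m).
    by apply: ID; [exact: tX|exact: tiX].
  apply/funext => m; rewrite XE Re_fapp imE fapp_opp; ring.
rewrite (_ : (fun m => _) = fun m => fapp (re_vf X) (im_fps f) m +
    -1 * fapp (re_vf (taylor_vf p (fun y => 'i%C *: dz_vec (a y)))) (re_fps f) m).
  by apply: ID; [exact: tX|apply: IZ; exact: tiX].
by apply/funext => m; rewrite XE Im_fapp imE fapp_opp.
Qed.

(** A real formal field equal to the Taylor series of a smooth germ, through which properties
    holding near [p] on S become available for formal fields. *)
Definition represents p (Z : fvf R (n + n)) (X : T -> V) :=
  (fun j => cplx (Z j)) = taylor_vf p X.

Lemma represents_value p Z X : represents p Z X ->
  map_mx rc (fvalue Z) = X p.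
Proof.
move=> ZX; apply/rowP => j; rewrite !mxE.
have := congr1 (fun F : fvf R[i] (n + n) => fval (F j)) ZX.
by rewrite /= fval_taylor.
Qed.

End FormalSubmanifold.

(** * The real formal orbit and its CR property *)

Section Orbit.
Context {R : realType} {n : nat}.
Local Notation T := 'rV[R]_(n + n).
Local Notation V := 'rV[R[i]]_(n + n).
Local Notation rc := (real_complex R).

Variables (S U : set T) (rho : T -> R) (p : T) (theta : T -> 'cV[R[i]]_(n + n)).
Variable E : T -> set V.
Hypotheses (HS : smooth_hypersurface S) (PC : pseudoconvex S) (CF : contact_form S theta).
Hypotheses (subE : complex_subbundle S E) (ILT : infinite_levi_type S theta E p).
Hypotheses (D : defining_function S U rho) (Up : U p) (Sp : S p).

Lemma jets_germ X : jets S E p X -> exists2 L, E_germs S p E L & X = taylor_vf p L.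
Proof.
move=> [W [L [oW Wp sL EL ->]]]; exists L => //; split.
  by move=> j; apply/csmP; exists W.
by have := open_nbhs_nbhs (conj oW Wp); apply: filterS => y Wy Sy; exact: EL.
Qed.

Lemma germ_jets L : E_germs S p E L -> jets S E p (taylor_vf p L).
Proof.
move=> [sL EL].
have [W [oW Wp WP]] := near_open EL.
have fs j : exists W', [/\ open W', W' p & csmooth_on W' (fun y => L y 0 j)] by apply/csmP.
pose Wj j := sval (cid (fs j)).
have WjP j : [/\ open (Wj j), Wj j p & csmooth_on (Wj j) (fun y => L y 0 j)] by exact: svalP (cid (fs j)).
have H : \forall y \near p, forall j, Wj j y.
  apply: (@filter_forall _ _ (fun j y => Wj j y) (nbhs p) _) => j.
  by have [oj pj _] := WjP j; exact: open_nbhs_nbhs.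
have [W1 [oW1 W1p W1P]] := near_open H.
exists (W `&` W1), L; split=> //; first exact: openI.
- move=> j; have [_ _ [s1 s2]] := WjP j.
  by split=> k; [apply: Ck_on_sub (s1 k)|apply: Ck_on_sub (s2 k)] => y [_ /W1P].
- by move=> y Sy [Wy _]; exact: WP.
Qed.

(** The formal fields represented by members of [orbit_fields] form a Lie subalgebra containing the
    generators, hence contain the smallest one. *)
Lemma orbit_algebra_represented Z : orbit_algebra S E p Z ->
  exists2 X, orbit_fields S rho p E X & represents p Z X.
Proof.
pose A : set (fvf R (n + n)) := [set Z | exists2 X, orbit_fields S rho p E X & represents p Z X].
have mk Z' X : orbit_fields S rho p E X -> (forall j m, rc (Z' j m) = taylor_vf p X j m) -> A Z'.
  by move=> OX H; exists X => //; apply/funext => j; apply/funext => m; exact: H.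
have real X : orbit_fields S rho p E X -> real_field X /\ vsm p X.
  by move=> [[sX _ rX _] _ _ _].
have ev Z' X : represents p Z' X -> forall j m, rc (Z' j m) = taylor_vf p X j m.
  by move=> H j m; exact: (congr1 (fun F : fvf R[i] (n + n) => F j m) H).
suff sub : orbit_algebra S E p `<=` A by move=> /sub.
apply: smallest_sub; last first.
  move=> _ [X /jets_germ[L EL ->] <-].
  have [sL _] := EL; have sLc := vsm_conj sL.
  apply: (mk _ (real_part L)); first exact: (orbit_fields_real_part HS PC CF subE ILT D Up Sp).
  move=> j m; rewrite /re_vf /taylor_vf.
  rewrite (@taylor_eq _ _ p (fun y => real_part L y 0 j) (fun y => 2^-1 * (L y 0 j + conjc (L y 0 j)))).
  - rewrite taylorZ; last by apply: csmD; [exact: sL|exact: csm_conj].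
    rewrite taylor_additive; [|exact: sL|exact: csm_conj].
    rewrite taylor_conj; last exact: sL.
    by rewrite ReJ_add mulrC.
  - exact: vsm_real_part.
  - by apply: filterE => y; rewrite !mxE.
split.
- apply: (mk _ (fun=> 0)); first exact: (orbit_fields0 subE D Up Sp).
  move=> j m; rewrite /taylor_vf (_ : (fun y => _) = fun=> 0); last by apply/funext => y; rewrite mxE.
  by rewrite taylor_cst mul0r.
- move=> Z1 Z2 [X1 O1 E1] [X2 O2 E2].
  apply: (mk _ (fun y => X1 y + rc 1 *: X2 y)).
    exact: (orbit_fields_comb subE D Up Sp 1 O1 O2).
  move=> j m; have [r1 s1] := real _ O1; have [r2 s2] := real _ O2.
  rewrite rmorphD /= (ev _ _ E1) (ev _ _ E2).
  rewrite /taylor_vf -taylor_additive; [|exact: s1|exact: s2].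
  congr (taylor p _ m); apply/funext => y; by rewrite !mxE mul1r.
- move=> c Z1 [X1 O1 E1].
  (* A scalar multiple is obtained as a real combination with the zero field, to reuse
     [orbit_fields_comb]. *)
  apply: (mk _ (fun y => 0 + rc c *: X1 y)).
    exact: (orbit_fields_comb subE D Up Sp c (orbit_fields0 subE D Up Sp) O1).
  move=> j m; have [r1 s1] := real _ O1.
  rewrite rmorphM /= (ev _ _ E1).
  rewrite /taylor_vf -taylorZ; last exact: s1.
  by congr (taylor p _ m); apply/funext => y; rewrite !mxE add0r.
- move=> Z1 Z2 [X1 O1 E1] [X2 O2 E2].
  apply: (mk _ (brk X1 X2)); first exact: (orbit_fields_brk subE D Up Sp O1 O2).
  move=> j m; have [r1 s1] := real _ O1; have [r2 s2] := real _ O2.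
  rewrite /represents in E1 E2; rewrite taylor_brk // -E1 -E2 /fbracket rmorphB /=.
  by rewrite !fapp_cplx.
Qed.

Hypothesis specE : exists l (om : 'I_l -> T -> 'cV[R[i]]_(n + n)),
    [/\ forall i, dual_form S theta (om i),
        forall x, S x -> wedge_neq0 S om x &
        forall x, S x ->
          E x = [set v | H10 S x v /\ forall i, pairing (om i) x v = 0]].

Lemma orbit_formal_CR : formal_Huang_Yin S E p.
Proof.
move=> I [k [vs [fI vsP dimv tan]]] xi Hxi.
have [h [h0 rf IE]] := fI.
have [I0 ID IZ] := formal_submanifold_closed fI.
have Ih i : I (h i).
  rewrite IE; exists (fun i' => if i' == i then fone else fun=> 0); apply/funext => m.
  rewrite (bigD1 i) //= eqxx fmul1 big1 ?addr0 // => i' /negbTE ->.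
  by rewrite fmul0l.
have vsK := formal_tangent_values h0 rf IE dimv.
have {}vsK : forall w : T, (forall i, \sum_j w 0 j * fval (fderiv j (h i)) = 0) -> w \in vs.
  apply: vsK => w /vsP[X OX ->]; exists X => //; exact: tan.
pose v := dz_vec xi.
(* The generators are real series of the ideal, so they lie in its complexification and are killed
   by [v] to first order; being real, they are then killed by both parts of [v]. *)
have vh i : \sum_j v 0 j * rc (fval (fderiv j (h i))) = 0.
  have CIh : CI I (cplx (h i)) by split; [exact: Ih|exact: I0].
  rewrite -[RHS](Hxi _ CIh) big_split_ord /= -big_split /=; apply: eq_bigr => j _.
  rewrite /v dz_vec_l dz_vec_r /fval /fdz !fderiv_cplx /cplx; ring.
have vre : map_mx (@complex.Re R) v \in vs.
  apply: vsK => i; have := congr1 (@complex.Re R) (vh i); rewrite cRe_sum => H; apply: etrans _ H.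
  by apply: eq_bigr => j _; rewrite mxE cReM /= mulr0 subr0.
have vim : map_mx (@complex.Im R) v \in vs.
  apply: vsK => i; have := congr1 (@complex.Im R) (vh i); rewrite cIm_sum => H; apply: etrans _ H.
  by apply: eq_bigr => j _; rewrite mxE cImM /= mulr0 add0r.
have [Zr /orbit_algebra_represented[X OX EX] Er] := (iffLR (vsP _) vre).
have [Zi /orbit_algebra_represented[Y OY EY] Ei] := (iffLR (vsP _) vim).
have vXY : X p + 'i%C *: Y p = v.
  (* [X] and [Y] take at [p] the real and imaginary parts of [v] as values. *)
  rewrite -(represents_value EX) -(represents_value EY) -Er -Ei {Er Ei vre vim vh}.
  move: v => u; apply/rowP => j; rewrite !mxE; case: (u 0 j) => a b; by simpc.
have Ev := orbit_H10_E HS PC CF D Up Sp specE OX OY vXY.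
have [a [sa ap Ea]] := E_local_section subE Sp Ev.
have La : E_germs S p E (fun y => dz_vec (a y)) by split=> //; exact: vsm_dz.
have iLa : E_germs S p E (fun y => 'i%C *: dz_vec (a y)) by exact: (E_germs_scale subE _ La).
have gen L : E_germs S p E L -> ftangent I (re_vf (taylor_vf p L)).
  move=> EL; apply: tan; apply: sub_gen_smallest.
  by exists (taylor_vf p L) => //; exact: germ_jets.
exists (fun j => taylor p (fun y => a y 0 j)).
  exact: tangent_dz_D10 fI sa (gen _ La) (gen _ iLa).
by apply/rowP => j; rewrite mxE fval_taylor ap.
Qed.

End Orbit.

Theorem corollary5p3 (R : realType) (n : nat) (S : set 'rV[R]_(n + n))
    (theta : 'rV[R]_(n + n) -> 'cV[R[i]]_(n + n))
    (E : 'rV[R]_(n + n) -> set 'rV[R[i]]_(n + n)) (p : 'rV[R]_(n + n)) :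
  smooth_hypersurface S ->
  pseudoconvex S ->
  contact_form S theta ->
  special_subbundle S theta E ->
  S p ->
  infinite_levi_type S theta E p ->
  formal_Huang_Yin S E p.
Proof.
move=> HS PC CF [subE specE] Sp ILT; have [U [rho [Up D]]] := HS p Sp.
exact: (orbit_formal_CR HS PC CF subE ILT D Up Sp specE).
Qed.
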